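(* Let $n\ge1$. (1) The formal power series $P^{\mathbb L}_\lambda(x_1,\ldots,x_n)$ $(\lambda\in\mathcal{SP}_n)$ form a formal $\mathbb L$-basis of $\Gamma^{\mathbb L}(\mathbf x_n)$. (2) The formal power series $Q^{\mathbb L}_\lambda(x_1,\ldots,x_n)$ $(\lambda\in\mathcal{SP}_n)$ form a formal $\mathbb L$-basis of $\Gamma^{\mathbb L}_+(\mathbf x_n)$.
   Context: $\mathbb L$ is the Lazard ring with universal formal group law $F_{\mathbb L}(u,v)=u+v+\sum_{i,j\ge1}a_{i,j}u^iv^j$; $a+_Fb=F_{\mathbb L}(a,b)$ and $\overline a\in\mathbb L[[a]]$ is the formal inverse ($a+_F\overline a=0$). $\mathcal{SP}_n$ is the set of strict partitions $\lambda=(\lambda_1>\cdots>\lambda_r>0)$ of length $r\le n$. For $\lambda\in\mathcal{SP}_n$ of length $r$, $$P^{\mathbb L}_\lambda(x_1,\ldots,x_n)=\frac1{(n-r)!}\sum_{w\in S_n}w\Big[\prod_{i=1}^rx_i^{\lambda_i}\prod_{i=1}^r\prod_{j=i+1}^n\frac{x_i+_Fx_j}{x_i+_F\overline x_j}\Big],$$ $$Q^{\mathbb L}_\lambda(x_1,\ldots,x_n)=\frac1{(n-r)!}\sum_{w\in S_n}w\Big[\prod_{i=1}^r(x_i+_Fx_i)x_i^{\lambda_i-1}\prod_{i=1}^r\prod_{j=i+1}^n\frac{x_i+_Fx_j}{x_i+_F\overline x_j}\Big],$$ where $S_n$ permutes $x_1,\ldots,x_n$. A formal power series $f(x_1,\ldots,x_n)$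 over $\mathbb L$ is $\mathbb L$-supersymmetric if it is symmetric and $f(t,\overline t,x_3,\ldots,x_n)=f(0,0,x_3,\ldots,x_n)$. $\Gamma^{\mathbb L}(\mathbf x_n)$ is the ring of all such series, and $\Gamma^{\mathbb L}_+(\mathbf x_n)$ the subring of those $f$ for which $f(t,x_2,\ldots,x_n)-f(0,x_2,\ldots,x_n)$ is divisible by $t+_Ft$. ''Formal $\mathbb L$-basis'' means that every element of the ring can be written uniquely as a possibly infinite formal linear combination $\sum_\lambda c_\lambda P^{\mathbb L}_\lambda$ (resp. $\sum_\lambda c_\lambda Q^{\mathbb L}_\lambda$) with $c_\lambda\in\mathbb L$ (such sums converge as formal power series since $P^{\mathbb L}_\lambda,Q^{\mathbb L}_\lambda$ have no terms of degree less than $|\lambda|$ in the $x_i$). *)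

(* Defs.v *)
From HB Require Import structures.
From mathcomp Require Import all_boot all_order all_fingroup all_algebra.
From mathcomp Require Import boolp.
From mathcomp Require Import mpoly.

Set Implicit Arguments.
Unset Strict Implicit.
Unset Printing Implicit Defensive.

Import Order.TTheory GRing.Theory.
Local Open Scope ring_scope.

(* A power series in n variables is the family of its coefficients, indexed by
   exponent vectors; the variables are numbered from 0. *)
Record mps (n : nat) (R : Type) := Mps { mps_coef :> 'X_{1..n} -> R }.

Lemma mpsP (n : nat) (R : Type) (f g : mps n R) : f =1 g -> f = g.
Proof. by case: f g => [f] [g] /= /funext ->. Qed.

HB.instance Definition _ (n : nat) (R : Type) := gen_eqMixin (mps n R).
HB.instance Definition _ (n : nat) (R : Type) := gen_choiceMixin (mps n R).

Section Ring.
Variables (n : nat) (R : comNzRingType).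
Implicit Types (f g h : mps n R) (m : 'X_{1..n}).

Definition mps_zero : mps n R := Mps (fun _ => 0).
Definition mps_opp f : mps n R := Mps (fun m => - f m).
Definition mps_add f g : mps n R := Mps (fun m => f m + g m).
Definition mps_scale (c : R) f : mps n R := Mps (fun m => c * f m).
Definition mps_one : mps n R := Mps (fun m => (m == 0%MM)%:R).
Definition mps_mul f g : mps n R := Mps (fun m =>
  \sum_(k : 'X_{1..n < (mdeg m).+1, (mdeg m).+1} | m == (k.1 + k.2)%MM)
     f k.1 * g k.2).

Fact mps_addA : associative mps_add.
Proof. by move=> f g h; apply: mpsP => m; apply: addrA. Qed.
Fact mps_addC : commutative mps_add.
Proof. by move=> f g; apply: mpsP => m; apply: addrC. Qed.
Fact mps_add0 : left_id mps_zero mps_add.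
Proof. by move=> f; apply: mpsP => m; apply: add0r. Qed.
Fact mps_addN : left_inverse mps_zero mps_opp mps_add.
Proof. by move=> f; apply: mpsP => m; apply: addNr. Qed.

HB.instance Definition _ := GRing.isZmodule.Build (mps n R)
  mps_addA mps_addC mps_add0 mps_addN.

Lemma mps_coef0 m : (0 : mps n R) m = 0. Proof. by []. Qed.
Lemma mps_coefD f g m : (f + g) m = f m + g m. Proof. by []. Qed.
Lemma mps_coefN f m : (- f) m = - f m. Proof. by []. Qed.

(* The ring axioms are inherited from polynomials through truncation. *)
Definition mps_trunc (d : nat) f : {mpoly R[n]} :=
  \sum_(m : 'X_{1..n < d}) f m *: 'X_[m].

Lemma mps_truncE d f m : (mps_trunc d f)@_m = if (mdeg m < d)%N then f m else 0.
Proof.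
rewrite /mps_trunc linear_sum /=; case: ifPn => [lt_md | ge_md].
  rewrite (bigD1 (BMultinom lt_md)) //= linearZ /= mcoeffX eqxx mulr1.
  rewrite big1 ?addr0 // => k; rewrite -val_eqE /= => ne.
  by rewrite linearZ /= mcoeffX (negPf ne) mulr0.
rewrite big1 // => k _; rewrite linearZ /= mcoeffX.
by case: eqP => [eq_km|_]; [rewrite -eq_km bmdeg in ge_md | rewrite mulr0].
Qed.

Lemma mps_mulE d f g m : (mdeg m < d)%N ->
  mps_mul f g m = (mps_trunc d f * mps_trunc d g)@_m.
Proof.
move=> lt_md; rewrite mcoeffM /=; apply: eq_bigr => -[k1 k2] _ /=.
by rewrite !mps_truncE !(leq_trans (bmdeg _) lt_md).
Qed.

Lemma mcoeff_mul_eq (p p' q q' : {mpoly R[n]}) d m : (mdeg m < d)%N ->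
  (forall k, (mdeg k < d)%N -> p@_k = p'@_k) ->
  (forall k, (mdeg k < d)%N -> q@_k = q'@_k) ->
  (p * q)@_m = (p' * q')@_m.
Proof.
move=> lt_md eq_p eq_q; rewrite !mcoeffM; apply: eq_bigr => -[k1 k2] _ /=.
by rewrite eq_p ?eq_q // (leq_trans (bmdeg _) lt_md).
Qed.

Lemma mps_trunc_mul d f g k : (mdeg k < d)%N ->
  (mps_trunc d (mps_mul f g))@_k = (mps_trunc d f * mps_trunc d g)@_k.
Proof. by move=> lt_kd; rewrite mps_truncE lt_kd (mps_mulE f g lt_kd). Qed.

Fact mps_mulA : associative mps_mul.
Proof.
move=> f g h; apply: mpsP => m; have lt := ltnSn (mdeg m).
rewrite !(mps_mulE _ _ lt).
rewrite (mcoeff_mul_eq lt (fun k _ => erefl) (@mps_trunc_mul _ g h)) mulrA.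
by rewrite -(mcoeff_mul_eq lt (@mps_trunc_mul _ f g) (fun k _ => erefl)).
Qed.
Fact mps_mulC : commutative mps_mul.
Proof.
by move=> f g; apply: mpsP => m; rewrite !(mps_mulE _ _ (ltnSn _)) mulrC.
Qed.
Fact mps_mul1 : left_id mps_one mps_mul.
Proof.
move=> f; apply: mpsP => m; have lt := ltnSn (mdeg m).
rewrite (mps_mulE _ _ lt).
rewrite (@mcoeff_mul_eq _ 1 _ (mps_trunc (mdeg m).+1 f) _ _ lt) //.
  by rewrite mul1r mps_truncE lt.
by move=> k lt_k; rewrite mps_truncE lt_k mcoeff1.
Qed.
Fact mps_mulDl : left_distributive mps_mul mps_add.
Proof.
move=> f g h; apply: mpsP => m /=; rewrite -big_split /=.
by apply: eq_bigr => k _; rewrite mulrDl.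
Qed.
Fact mps_one_neq0 : mps_one != 0.
Proof.
apply/eqP => /(congr1 (fun f : mps n R => f 0%MM)) /eqP.
by rewrite /= eqxx oner_eq0.
Qed.

HB.instance Definition _ := GRing.Zmodule_isComNzRing.Build (mps n R)
  mps_mulA mps_mulC mps_mul1 mps_mulDl mps_one_neq0.

Fact mps_scaleA a b f : mps_scale a (mps_scale b f) = mps_scale (a * b) f.
Proof. by apply: mpsP => m /=; rewrite mulrA. Qed.
Fact mps_scale1 : left_id 1 mps_scale.
Proof. by move=> f; apply: mpsP => m /=; rewrite mul1r. Qed.
Fact mps_scaleDr : right_distributive mps_scale +%R.
Proof. by move=> a f g; apply: mpsP => m /=; rewrite mulrDr. Qed.
Fact mps_scaleDl f : {morph mps_scale^~ f : a b / a + b}.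
Proof. by move=> a b; apply: mpsP => m /=; rewrite mulrDl. Qed.

HB.instance Definition _ := GRing.Zmodule_isLmodule.Build R (mps n R)
  mps_scaleA mps_scale1 mps_scaleDr mps_scaleDl.

Definition mps_unit : {pred mps n R} := fun f => `[< exists g, g * f = 1 >].
Definition mps_inv f : mps n R :=
  if pselect (exists g, g * f = 1) is left ex then projT1 (cid ex) else f.

Fact mps_mulVf : {in mps_unit, left_inverse 1 mps_inv *%R}.
Proof.
move=> f /asboolP ex_g; rewrite /mps_inv; case: pselect => // ex.
by case: (cid ex).
Qed.
Fact mps_unitPl f g : g * f = 1 -> mps_unit f.
Proof. by move=> gf1; apply/asboolP; exists g. Qed.
Fact mps_inv_out : {in [predC mps_unit], mps_inv =1 id}.
Proof.
by move=> f /asboolP no_g; rewrite /mps_inv; case: pselect.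
Qed.

HB.instance Definition _ := GRing.ComNzRing_hasMulInverse.Build (mps n R)
  mps_mulVf mps_unitPl mps_inv_out.

End Ring.

Lemma mps_idomainAxiom (n : nat) (R : idomainType) (f g : mps n R) :
  f * g = 0 -> (f == 0) || (g == 0).
Proof.
have lead (h : mps n R) : h != 0 ->
    exists2 m, h m != 0 & forall k, (k < m)%O -> h k = 0.
  move=> /eqP h0; have [m hm] : exists m, h m != 0.
    apply: contrapT => noh; apply: h0; apply: mpsP => m.
    by apply/eqP; apply: contrapT => /negP hm; apply: noh; exists m.
  move: m hm; apply: ltmwf => m IH hm.
  have [[k lt_km hk]|no] := pselect (exists2 k, (k < m)%O & h k != 0).
    exact: IH hk.
  exists m => // k lt_km; apply/eqP; apply: contrapT => /negP hk.
  by apply: no; exists k.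
move=> fg0; apply: contrapT => /negP; rewrite negb_or => /andP[].
move=> /lead[a fa mina] /lead[b gb minb].
have /(congr1 (fun h : mps n R => h (a + b)%MM)) /= := fg0.
have lta : (mdeg a < (mdeg (a + b)).+1)%N by rewrite mdegD ltnS leq_addr.
have ltb : (mdeg b < (mdeg (a + b)).+1)%N by rewrite mdegD ltnS leq_addl.
rewrite (bigD1 (BMultinom lta, BMultinom ltb)) //= big1 ?addr0.
  by move/eqP; rewrite mulf_eq0 (negPf fa) (negPf gb).
move=> -[k1 k2] /= /andP[/eqP eq_k ne].
have [lt1|] := boolP ((k1 : 'X_{1..n}) < a)%O; first by rewrite mina ?mul0r.
rewrite -leNgt => ge1.
have [lt2|] := boolP ((k2 : 'X_{1..n}) < b)%O; first by rewrite minb ?mulr0.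
rewrite -leNgt => ge2; case/negP: ne.
have eq1 : (k1 : 'X_{1..n}) = a.
  apply/eqP; move: ge1; rewrite le_eqVlt => /orP[|gt1]; first by rewrite eq_sym.
  by have := ltmc_le_add gt1 ge2; rewrite -eq_k ltxx.
have eq2 : (k2 : 'X_{1..n}) = b.
  by apply/eqP; rewrite -(eqm_add2l a) -{1}eq1 -eq_k.
by rewrite xpair_eqE -!val_eqE /= eq1 eq2 !eqxx.
Qed.

HB.instance Definition _ (n : nat) (R : idomainType) :=
  GRing.ComUnitRing_isIntegral.Build (mps n R) (@mps_idomainAxiom n R).

Definition mps_var (n : nat) (R : comNzRingType) (i : 'I_n) : mps n R :=
  Mps (fun m => (m == U_(i)%MM)%:R).

Definition mps_map (n : nat) (R S : comNzRingType) (phi : R -> S)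
  (f : mps n R) : mps n S := Mps (fun m => phi (f m)).

(* f(s_0, ..., s_(n-1)). The truncation to exponents of degree at most mdeg m
   loses nothing when every s i has zero constant term, the only case used. *)
Definition mps_subst (n k : nat) (R : comNzRingType) (s : 'I_n -> mps k R)
  (f : mps n R) : mps k R := Mps (fun m =>
  \sum_(e : 'X_{1..n < (mdeg m).+1}) f e * (\prod_(i < n) s i ^+ e i) m).

(* F(a, b) *)
Definition fgl_add (R : comNzRingType) (F : mps 2 R) (k : nat)
  (a b : mps k R) : mps k R :=
  mps_subst (fun i : 'I_2 => if i == ord0 then a else b) F.

Definition is_fgl (R : comNzRingType) (F : mps 2 R) : Prop :=
  [/\ (let t := mps_var R (ord0 : 'I_1) in
       fgl_add F t 0 = t /\ fgl_add F 0 t = t),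
      (let u := mps_var R (ord0 : 'I_2) in let v := mps_var R (ord_max : 'I_2) in
       fgl_add F u v = fgl_add F v u)
    & (let x i := mps_var R (i : 'I_3) in
       fgl_add F (x ord0) (fgl_add F (x (inord 1)) (x ord_max)) =
       fgl_add F (fgl_add F (x ord0) (x (inord 1))) (x ord_max))].

(* The universal property determines (L, F) up to a unique isomorphism. *)
Definition is_lazard (L : comNzRingType) (F : mps 2 L) : Prop :=
  is_fgl F /\
  forall (R : comNzRingType) (G : mps 2 R), is_fgl G ->
  exists phi : {rmorphism L -> R}, mps_map phi F = G /\
    forall psi : {rmorphism L -> R}, mps_map psi F = G -> psi =1 phi.

Definition is_fgl_inverse (R : comNzRingType) (F : mps 2 R) (c : mps 1 R) :=
  c 0%MM = 0 /\ fgl_add F (mps_var R ord0) c = 0.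

(* The formal inverse, as a series in one variable; the default value 0 is never
   taken when F is a formal group law. *)
Definition fgl_inverse (R : comNzRingType) (F : mps 2 R) : mps 1 R :=
  if pselect (exists c, is_fgl_inverse F c) is left ex then projT1 (cid ex)
  else 0.

Definition fgl_opp (R : comNzRingType) (F : mps 2 R) (k : nat)
  (a : mps k R) : mps k R := mps_subst (fun _ : 'I_1 => a) (fgl_inverse F).

Record strict_partition (n : nat) := StrictPartition {
  parts :> seq nat;
  _ : [&& sorted gtn parts, 0 \notin parts & size parts <= n]%N
}.
HB.instance Definition _ (n : nat) := [isSub for @parts n].
HB.instance Definition _ (n : nat) := [Choice of strict_partition n by <:].

Section HallLittlewood.
Variables (L : idomainType) (F : mps 2 L) (n : nat).
Local Notation x := (mps_var L).
Local Notation "a +_F b" := (fgl_add F a b) (at level 50).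
Local Notation "x %:F" := (@tofrac (mps n L) x).
Implicit Type lam : strict_partition n.

(* The denominators, and the division by (n - r)!, live in the field of fractions
   of L[[x_0, ..., x_(n-1)]]. This uses that the Lazard ring is a domain, which
   is part of Lazard's theorem (L is a polynomial ring over the integers).
   HL_ratio is the image under w of the product of the quotients. *)
Definition HL_ratio lam (w : 'S_n) : {fraction mps n L} :=
  \prod_(i < n | (i < size lam)%N) \prod_(j < n | (i < j)%N)
    ((x (w i) +_F x (w j))%:F / (x (w i) +_F fgl_opp F (x (w j)))%:F).

Definition HL_P lam : {fraction mps n L} :=
  ((n - size lam)`!)%:R^-1 * \sum_(w : 'S_n)
    ((\prod_(i < n | (i < size lam)%N) x (w i) ^+ nth 0%N lam i)%:F
     * HL_ratio lam w).

Definition HL_Q lam : {fraction mps n L} :=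
  ((n - size lam)`!)%:R^-1 * \sum_(w : 'S_n)
    ((\prod_(i < n | (i < size lam)%N)
        ((x (w i) +_F x (w i)) * x (w i) ^+ (nth 0%N lam i).-1))%:F
     * HL_ratio lam w).

Definition mps_symmetric (f : mps n L) : Prop :=
  forall w : 'S_n, mps_subst (fun i => x (w i)) f = f.

(* The variable t is identified with x_0, which is free after the substitution.
   The cancellation condition is empty when n < 2. *)
Definition supersymmetric (f : mps n L) : Prop :=
  mps_symmetric f /\
  forall i0 i1 : 'I_n, i0 = 0%N :> nat -> i1 = 1%N :> nat ->
    mps_subst (fun k => if k == i0 then x i0
                        else if k == i1 then fgl_opp F (x i0) else x k) f =
    mps_subst (fun k => if (k == i0) || (k == i1) then 0 else x k) f.

Definition supersymmetric_plus (f : mps n L) : Prop :=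
  supersymmetric f /\
  forall i0 : 'I_n, i0 = 0%N :> nat ->
    exists g : mps n L,
      f - mps_subst (fun k => if k == i0 then 0 else x k) f =
      (x i0 +_F x i0) * g.

End HallLittlewood.

(* f is the sum of the family g: every coefficient of f is the sum of the
   corresponding coefficients of g, all but finitely many of which are zero. *)
Definition is_formal_sum (n : nat) (R : comNzRingType) (I : eqType)
  (g : I -> mps n R) (f : mps n R) : Prop :=
  forall m, exists s : seq I,
    [/\ uniq s, (forall i, i \notin s -> g i m = 0)
      & f m = \sum_(i <- s) g i m].

(* The B i, a priori fractions, are power series belonging to the ring Gamma, and
   form a formal basis of it. *)
Definition is_formal_basis (n : nat) (L : idomainType)
  (Gamma : mps n L -> Prop) (I : eqType) (B : I -> {fraction mps n L}) : Prop :=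
  exists b : I -> mps n L,
    (forall i, tofrac (b i) = B i /\ Gamma (b i)) /\
    forall f, Gamma f ->
      exists! c : I -> L, is_formal_sum (fun i => c i *: b i) f.

(* Main.v *)
(* Order the monomials by degree, then lexicographically. The exponents of the
   least monomial of a supersymmetric series increase weakly, by symmetry, and two
   equal nonzero ones would contribute a term that f(t, -_F t, ...) = f(0, 0, ...)
   forbids: this monomial is a strict partition written backwards. P_lambda and
   Q_lambda have least monomial lambda, with coefficients 1 and 2^r, so both parts
   follow by successive subtraction, once it is known that for f in Gamma_+ the
   least coefficient is divisible by 2^r.

   Since x - y is x +_F (-_F y) times a power series, the sum defining P_lambda or
   Q_lambda times the Vandermonde product is an alternating power series, hence
   divisible by that product.

   For f in Gamma_+, applying the operators f -> f - f(x_i = 0) to the r variables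
   of the least monomial does not change its coefficient, and gives a multiple of
   each of the series [2](x_i). These are pairwise coprime,
   because a_11 is a nonzerodivisor modulo 2 in L. For the latter, associativity
   makes the a_{i,N-i} a symmetric 2-cocycle modulo lower terms, so up to odd
   factors L is generated by one a_{i,N-i} for each N >= 2; and conjugating the
   universal law by x + s x^N shifts this generator by a nonzero multiple of s
   while fixing the previous ones, so the generators are algebraically
   independent. *)
From HB Require Import structures.
Require Import Defs.
From mathcomp Require Import all_boot all_order all_fingroup all_algebra.
From mathcomp Require Import boolp.
From mathcomp Require Import mpoly.
From mathcomp Require Import ring zify.

Set Implicit Arguments.
Unset Strict Implicit.
Unset Printing Implicit Defensive.

Import Order.TTheory GRing.Theory Num.Theory.
Local Open Scope ring_scope.

(** * Power series and substitution *)

(** Substitution does not extend to the fraction field, where a denominator may become zero. It is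
    applied to power series only, and the defining formula is shown to persist for every family of
    pairwise distinct arguments ([mps_subst_hl_series]). The family with t and -_F t qualifies
    because 2 is nonzero in L; there each summand vanishes or is a fraction free of t, so the value
    does not change when t is set to 0.

    Integers need not be invertible in L, so division by (n - r)! takes a coset argument, once for
    integrality and once more for divisibility by [2](x_0).

    Coprimality rests on [2](t) = 2 t + a_11 t^2 + ... : as a series in x_i, [2](x_i) starts with 2,
    so it is regular modulo [2](x_j) as soon as 2 is. Exchanging the two elements, this amounts to
    [2](t) being regular modulo 2, where it starts with a_11 t^2. Only evenness is at stake, so the
    coefficients of F are studied up to odd factors: if an odd multiple of b is even, so is b. *)

Lemma sum_bmnm_widen (V : nmodType) n (G : 'X_{1..n} -> V) d d' : (d <= d')%N ->
  (forall e, (d <= mdeg e)%N -> G e = 0) ->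
  \sum_(e : 'X_{1..n < d'}) G e = \sum_(e : 'X_{1..n < d}) G e.
Proof.
move=> ledd' G0; rewrite (bigID (fun e : 'X_{1..n < d'} => mdeg e < d)%N) /=.
rewrite [X in _ + X]big1 ?addr0 => [|e]; last by rewrite -leqNgt => /G0.
rewrite -(big_map (@bmnm n d') (fun e => mdeg e < d)%N G).
rewrite -(big_map (@bmnm n d) xpredT G) -big_filter.
apply: perm_big; apply: uniq_perm.
- by rewrite filter_uniq // map_inj_uniq ?index_enum_uniq //; apply: val_inj.
- by rewrite map_inj_uniq ?index_enum_uniq //; apply: val_inj.
move=> m; rewrite mem_filter; apply/andP/mapP => [[lt_md _]|[e _ ->]].
  by exists (BMultinom lt_md) => //; rewrite mem_index_enum.
split; first exact: bmdeg.
apply/mapP; exists (BMultinom (leq_trans (bmdeg e) ledd')) => //.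
by rewrite mem_index_enum.
Qed.

Section Order.
Variables (n : nat) (R : comNzRingType).
Implicit Types (f g h : mps n R) (m : 'X_{1..n}).

(** The filtration by order plays the role of the topology: an identity of series is proved modulo
    every order and concluded by [ordge_eq]. *)
Definition ordge d f := forall m, (mdeg m < d)%N -> f m = 0.

Lemma mps_coefB f g m : (f - g) m = f m - g m.
Proof. by rewrite mps_coefD mps_coefN. Qed.

Lemma mps_coefZ c f m : (c *: f) m = c * f m.
Proof. by []. Qed.

Lemma mps_coef1 m : (1 : mps n R) m = (m == 0%MM)%:R.
Proof. by []. Qed.

Lemma mps_coefM f g m : (f * g) m =
  \sum_(k : 'X_{1..n < (mdeg m).+1, (mdeg m).+1} | m == (k.1 + k.2)%MM)
     f k.1 * g k.2.
Proof. by []. Qed.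

Lemma mps_coef_sum (I : Type) (r : seq I) (P : pred I) (E : I -> mps n R) m :
  (\sum_(i <- r | P i) E i) m = \sum_(i <- r | P i) E i m.
Proof. by elim/big_rec2: _ => // i x y _ <-. Qed.

Lemma mps_coefMn f k m : (f *+ k) m = f m *+ k.
Proof. by elim: k => // k IH; rewrite !mulrS mps_coefD IH. Qed.

Lemma ordge0 d : ordge d 0. Proof. by []. Qed.

Lemma ordgeN d f : ordge d f -> ordge d (- f).
Proof. by move=> hf m lt_m; rewrite mps_coefN hf ?oppr0. Qed.

Lemma ordgeD d f g : ordge d f -> ordge d g -> ordge d (f + g).
Proof. by move=> hf hg m lt_m; rewrite mps_coefD hf ?hg ?addr0. Qed.

Lemma ordgeB d f g : ordge d f -> ordge d g -> ordge d (f - g).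
Proof. by move=> hf /ordgeN; apply: ordgeD. Qed.

Lemma ordge_sum d (I : Type) (r : seq I) (P : pred I) (E : I -> mps n R) :
  (forall i, P i -> ordge d (E i)) -> ordge d (\sum_(i <- r | P i) E i).
Proof. by move=> hE; elim/big_ind: _ => //; exact: ordgeD. Qed.

Lemma ordgeW d d' f : (d <= d')%N -> ordge d' f -> ordge d f.
Proof. by move=> le hf m lt_m; apply: hf; exact: leq_trans le. Qed.

Lemma ordgeM a b f g : ordge a f -> ordge b g -> ordge (a + b) (f * g).
Proof.
move=> hf hg m lt_m; rewrite mps_coefM big1 // => -[k1 k2] /= /eqP def_m.
have [lt1|le1] := ltnP (mdeg k1) a; first by rewrite hf ?mul0r.
rewrite hg ?mulr0 //; rewrite def_m mdegD in lt_m; lia.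
Qed.

Lemma ordgeMl d f g : ordge d g -> ordge d (f * g).
Proof. by move=> hg; rewrite -[d]add0n; apply: ordgeM. Qed.

Lemma ordgeMr d f g : ordge d f -> ordge d (f * g).
Proof. by move=> hf; rewrite mulrC; apply: ordgeMl. Qed.

Lemma ordgeX e f : ordge 1 f -> ordge e (f ^+ e).
Proof.
by move=> hf; elim: e => // e IH; rewrite exprS -add1n; apply: ordgeM.
Qed.

Lemma ordge_prodX s (e : 'X_{1..s}) (F : 'I_s -> mps n R) :
  (forall i, ordge 1 (F i)) -> ordge (mdeg e) (\prod_(i < s) F i ^+ e i).
Proof.
move=> hF; rewrite mdegE; elim/big_rec2: _ => // i k f _.
by apply: ordgeM; apply: ordgeX.
Qed.

Lemma ordge_eq f g : (forall d, ordge d (f - g)) -> f = g.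
Proof.
move=> hfg; apply: mpsP => m; apply/eqP; rewrite -subr_eq0 -mps_coefB.
by rewrite (hfg (mdeg m).+1).
Qed.

Definition ofpoly (p : {mpoly R[n]}) : mps n R := Mps (fun m => p@_m).

Lemma ofpoly_is_zmod : zmod_morphism ofpoly.
Proof. by move=> p q; apply: mpsP => m; rewrite mps_coefB /= mcoeffB. Qed.
HB.instance Definition _ := GRing.isZmodMorphism.Build _ _ ofpoly ofpoly_is_zmod.

Lemma ofpoly_is_monoid : monoid_morphism ofpoly.
Proof.
split=> [|p q]; apply: mpsP => m; first by rewrite /= mcoeff1.
by rewrite mps_coefM /= mcoeffM; apply: eq_bigr.
Qed.
HB.instance Definition _ :=
  GRing.isMonoidMorphism.Build _ _ ofpoly ofpoly_is_monoid.

Lemma ordge_trunc d f : ordge d (f - ofpoly (mps_trunc d f)).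
Proof. by move=> m lt_m; rewrite mps_coefB /= mps_truncE lt_m subrr. Qed.

Definition mpsC (c : R) : mps n R := ofpoly c%:MP.

Lemma mpsC_is_zmod : zmod_morphism mpsC.
Proof. by move=> a b; rewrite /mpsC mpolyCB rmorphB. Qed.
HB.instance Definition _ := GRing.isZmodMorphism.Build _ _ mpsC mpsC_is_zmod.

Lemma mpsC_is_monoid : monoid_morphism mpsC.
Proof. by split=> [|a b]; rewrite /mpsC ?rmorph1 // mpolyCM rmorphM. Qed.
HB.instance Definition _ :=
  GRing.isMonoidMorphism.Build _ _ mpsC mpsC_is_monoid.

Lemma mps_coefCM c f m : (mpsC c * f) m = c * f m.
Proof.
have lt := ltnSn (mdeg m).
have : ordge (mdeg m).+1 (mpsC c * (f - ofpoly (mps_trunc (mdeg m).+1 f))).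
  by apply: ordgeMl; apply: ordge_trunc.
move=> /(_ m lt) /eqP; rewrite mulrBr mps_coefB subr_eq0 => /eqP->.
by rewrite /mpsC -rmorphM /= mul_mpolyC mcoeffZ mps_truncE lt.
Qed.

Lemma mpsCM c f : mpsC c * f = c *: f.
Proof. by apply: mpsP => m; rewrite mps_coefCM. Qed.

Definition monom m : mps n R := ofpoly 'X_[m].

Lemma monomE m k : monom m k = (m == k)%:R.
Proof. by rewrite /= mcoeffX. Qed.

Lemma monom_var m : monom m = \prod_(i < n) mps_var R i ^+ m i.
Proof.
rewrite /monom mpolyXE_id rmorph_prod; apply: eq_bigr => i _.
rewrite rmorphXn; congr (_ ^+ _); apply: mpsP => k.
by rewrite /= mcoeffX eq_sym.
Qed.

Lemma monomD a b : monom (a + b) = monom a * monom b.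
Proof. by rewrite /monom mpolyXD rmorphM. Qed.

Lemma mps_varE i : mps_var R i = monom U_(i).
Proof. by apply: mpsP => k; rewrite monomE /= eq_sym. Qed.

Lemma monomMn m k : monom (m *+ k) = monom m ^+ k.
Proof. by rewrite /monom -mpolyXn rmorphXn. Qed.

Lemma monom_coefM a f m : (monom a * f) m = if (a <= m)%MM then f (m - a)%MM else 0.
Proof.
have lt := ltnSn (mdeg m).
rewrite mps_coefM; case: ifPn => [le_am|nle].
  have lta : (mdeg a < (mdeg m).+1)%N.
    by rewrite ltnS -(submK le_am) mdegD leq_addl.
  have ltb : (mdeg (m - a) < (mdeg m).+1)%N.
    by rewrite ltnS -{2}(submK le_am) mdegD leq_addr.
  rewrite (bigD1 (BMultinom lta, BMultinom ltb)) /=; last first.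
    by rewrite addmC submK.
  rewrite mcoeffX eqxx mul1r big1 ?addr0 // => -[k1 k2] /= /andP[/eqP def_m ne].
  rewrite mcoeffX; case: eqP => [def_a|_]; last by rewrite mul0r.
  case/negP: ne; rewrite xpair_eqE !bmeqP /= -def_a eqxx /=.
  by rewrite -[X in X == _](addmK a) addmC def_a -def_m.
rewrite big1 // => -[k1 k2] /= /eqP def_m; rewrite mcoeffX.
case: eqP => [def_a|_]; last by rewrite mul0r.
by case/negP: nle; rewrite def_m -def_a lem_addr.
Qed.

End Order.

Lemma ordge_var n (R : comNzRingType) i : ordge 1 (mps_var R (i : 'I_n)).
Proof.
move=> m; rewrite ltnS leqn0 mdeg_eq0 => /eqP->.
by rewrite mps_varE monomE mnm1_eq0.
Qed.
#[global] Hint Resolve ordge_var ordge0 : core.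

Section Subst.
Variables (n k : nat) (R : comNzRingType) (s : 'I_n -> mps k R).
Hypothesis s0 : forall i, ordge 1 (s i).

Lemma mps_substE f m d : (mdeg m < d)%N -> mps_subst s f m =
  \sum_(e : 'X_{1..n < d}) f e * (\prod_(i < n) s i ^+ e i) m.
Proof.
move=> lt_m; rewrite [LHS]/=; symmetry.
apply: (sum_bmnm_widen (G := fun e => f e * (\prod_(i < n) s i ^+ e i) m)) => //.
by move=> e le_e; rewrite (ordge_prodX s0 le_e) mulr0.
Qed.

Lemma mps_subst_is_zmod : zmod_morphism (mps_subst s).
Proof.
move=> f g; apply: mpsP => m; rewrite mps_coefB !(mps_substE _ (ltnSn _)).
by rewrite -sumrB; apply: eq_bigr => e _; rewrite mps_coefB mulrBl.
Qed.

Lemma mps_subst_cont d f : ordge d f -> ordge d (mps_subst s f).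
Proof.
move=> hf m lt_m; rewrite (mps_substE _ lt_m) big1 // => e _.
by rewrite hf ?mul0r ?bmdeg.
Qed.

Lemma mps_subst_poly (p : {mpoly R[n]}) :
  mps_subst s (ofpoly p) = mmap (@mpsC k R) s p.
Proof.
apply: mpsP => m; pose d := maxn (mdeg m).+1 (msize p).
rewrite (mps_substE _ (d := d)) ?leq_maxl // (mmapE d) ?leq_maxr //.
by rewrite mps_coef_sum; apply: eq_bigr => e _; rewrite mps_coefCM.
Qed.

(** On polynomials substitution is the evaluation [mmap], hence multiplicative. Series differ from
    their truncations by high order, and substitution does not lower the order. *)
Lemma mps_subst_is_monoid : monoid_morphism (mps_subst s).
Proof.
have sB := mps_subst_is_zmod.
split; first by rewrite -(rmorph1 (@ofpoly n R)) mps_subst_poly rmorph1.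
move=> f g; apply: ordge_eq => d.
pose f' := ofpoly (mps_trunc d f); pose g' := ofpoly (mps_trunc d g).
have hf : ordge d (f - f') by apply: ordge_trunc.
have hg : ordge d (g - g') by apply: ordge_trunc.
have sf : ordge d (mps_subst s f - mps_subst s f').
  by rewrite -sB; apply: mps_subst_cont.
have sg : ordge d (mps_subst s g - mps_subst s g').
  by rewrite -sB; apply: mps_subst_cont.
have sfg : mps_subst s (f' * g') = mps_subst s f' * mps_subst s g'.
  by rewrite -rmorphM /= !mps_subst_poly rmorphM.
have -> : mps_subst s (f * g) - mps_subst s f * mps_subst s g =
  mps_subst s (f * (g - g') + (f - f') * g') -
  (mps_subst s f * (mps_subst s g - mps_subst s g') +
   (mps_subst s f - mps_subst s f') * mps_subst s g').
  have -> : f * (g - g') + (f - f') * g' = f * g - f' * g' by ring.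
  rewrite sB sfg; ring.
apply: ordgeB; last by apply: ordgeD; [apply: ordgeMl|apply: ordgeMr].
by apply: mps_subst_cont; apply: ordgeD; [apply: ordgeMl|apply: ordgeMr].
Qed.

(** The proof argument records that the substituted series have no constant term, so that ring
    morphism structures can be attached to the term. *)
Definition substm of (forall i, ordge 1 (s i)) := mps_subst s.

HB.instance Definition _ :=
  GRing.isZmodMorphism.Build _ _ (substm s0) mps_subst_is_zmod.
HB.instance Definition _ :=
  GRing.isMonoidMorphism.Build _ _ (substm s0) mps_subst_is_monoid.

Lemma mps_subst0 : mps_subst s 0 = 0.
Proof. exact: (raddf0 (substm s0)). Qed.
Lemma mps_subst1 : mps_subst s 1 = 1.
Proof. exact: (rmorph1 (substm s0)). Qed.
Lemma mps_substN f : mps_subst s (- f) = - mps_subst s f.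
Proof. exact: (raddfN (substm s0)). Qed.
Lemma mps_substD f g : mps_subst s (f + g) = mps_subst s f + mps_subst s g.
Proof. exact: (raddfD (substm s0)). Qed.
Lemma mps_substB f g : mps_subst s (f - g) = mps_subst s f - mps_subst s g.
Proof. exact: (raddfB (substm s0)). Qed.
Lemma mps_substMn f l : mps_subst s (f *+ l) = mps_subst s f *+ l.
Proof. exact: (raddfMn (substm s0)). Qed.
Lemma mps_substM f g : mps_subst s (f * g) = mps_subst s f * mps_subst s g.
Proof. exact: (rmorphM (substm s0)). Qed.
Lemma mps_substXn f l : mps_subst s (f ^+ l) = mps_subst s f ^+ l.
Proof. exact: (rmorphXn (substm s0)). Qed.
Lemma mps_subst_sum (I : Type) (r : seq I) (P : pred I) (E : I -> mps n R) :
  mps_subst s (\sum_(i <- r | P i) E i) = \sum_(i <- r | P i) mps_subst s (E i).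
Proof. exact: (rmorph_sum (substm s0)). Qed.
Lemma mps_subst_prod (I : Type) (r : seq I) (P : pred I) (E : I -> mps n R) :
  mps_subst s (\prod_(i <- r | P i) E i) = \prod_(i <- r | P i) mps_subst s (E i).
Proof. exact: (rmorph_prod (substm s0)). Qed.

Lemma mps_subst_var i : mps_subst s (mps_var R i) = s i.
Proof. by rewrite mps_varE mps_subst_poly mmapX mmap1U. Qed.

Lemma mps_substC c : mps_subst s (mpsC n c) = mpsC k c.
Proof. by rewrite mps_subst_poly mmapC. Qed.

Lemma mps_substZ c f : mps_subst s (c *: f) = c *: mps_subst s f.
Proof.
by rewrite -!mpsCM mps_substM mps_substC.
Qed.

(** Polynomials are dense, so a continuous morphism is determined by its values on constants and
    variables; composition of substitutions follows without computing coefficients. *)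
Lemma mps_subst_unique (phi : {rmorphism mps n R -> mps k R}) :
  (forall c, phi (mpsC n c) = mpsC k c) ->
  (forall d f, ordge d f -> ordge d (phi f)) ->
  (forall i, phi (mps_var R i) = s i) -> phi =1 mps_subst s.
Proof.
move=> phiC cont phi_var f; apply: ordge_eq => d.
have phi_poly p : phi (ofpoly p) = mps_subst s (ofpoly p).
  rewrite mps_subst_poly [p in LHS]mpolyE !rmorph_sum /mmap; apply: eq_bigr => m _.
  rewrite -mul_mpolyC !rmorphM /= -/(mpsC n _) phiC -/(monom R m) monom_var.
  by congr (_ * _); rewrite rmorph_prod; apply: eq_bigr => i _; rewrite rmorphXn /= phi_var.
have hf : ordge d (f - ofpoly (mps_trunc d f)) by apply: ordge_trunc.
have h1 := cont _ _ hf; have h2 := mps_subst_cont hf.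
move: h1 h2; rewrite mps_subst_is_zmod rmorphB /= phi_poly => h1 h2.
have -> : phi f - mps_subst s f =
  (phi f - mps_subst s (ofpoly (mps_trunc d f))) -
  (mps_subst s f - mps_subst s (ofpoly (mps_trunc d f))) by ring.
exact: ordgeB.
Qed.
End Subst.

Lemma eq_mps_subst n k (R : comNzRingType) (s s' : 'I_n -> mps k R) f :
  s =1 s' -> mps_subst s f = mps_subst s' f.
Proof. by move=> /funext->. Qed.

Lemma mps_subst_ordge n k (R : comNzRingType) (s : 'I_n -> mps k R) f d :
  (forall i, ordge 1 (s i)) -> ordge d f -> ordge d (mps_subst s f).
Proof. by move=> s0; apply: mps_subst_cont. Qed.

Lemma mps_subst_comp n k l (R : comNzRingType) (s : 'I_n -> mps k R)
    (t : 'I_k -> mps l R) f :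
  (forall i, ordge 1 (s i)) -> (forall i, ordge 1 (t i)) ->
  mps_subst t (mps_subst s f) = mps_subst (fun i => mps_subst t (s i)) f.
Proof.
move=> s0 t0; have ts0 i : ordge 1 (mps_subst t (s i)) by apply: mps_subst_ordge.
apply: (mps_subst_unique ts0 (phi := substm t0 \o substm s0)) => [c|d g hg|i] /=.
- by rewrite /substm !mps_substC.
- by rewrite /substm; do 2!apply: mps_subst_ordge => //.
- by rewrite /substm mps_subst_var.
Qed.

Lemma mps_subst_id n (R : comNzRingType) (f : mps n R) :
  mps_subst (mps_var R) f = f.
Proof.
have h i : ordge 1 (mps_var R (i : 'I_n)) by [].
by have /= <- := mps_subst_unique h (phi := idfun).
Qed.

Lemma mps_subst_eqmod n k (R : comNzRingType) (s s' : 'I_n -> mps k R) f d :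
  (forall i, ordge 1 (s i)) -> (forall i, ordge 1 (s' i)) ->
  (forall i, ordge d (s i - s' i)) -> ordge d (mps_subst s f - mps_subst s' f).
Proof.
move=> h h' hd m lt_m; rewrite mps_coefB !(mps_substE _ _ lt_m) //.
rewrite -sumrB big1 // => e _; rewrite -mulrBr -mps_coefB.
suff h0 : ordge d (\prod_i s i ^+ (e : 'X_{1..n}) i - \prod_i s' i ^+ (e : 'X_{1..n}) i) by rewrite h0 ?mulr0.
pose K (a b : mps k R) := ordge d (a - b).
apply: (big_ind2 K) => [|a a' b b' ha hb|i _]; first by rewrite /K subrr.
  rewrite /K.
  have -> : a * b - a' * b' = a * (b - b') + (a - a') * b' by ring.
  by apply: ordgeD; [apply: ordgeMl|apply: ordgeMr].
by rewrite /K subrXX; apply: ordgeMr.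
Qed.

(** * Formal group laws *)

Section Zeroing.
Variables (n : nat) (R : comNzRingType) (P : pred 'I_n).
Let s k : mps n R := if P k then 0 else mps_var R k.

Lemma ordge_zeroing k : ordge 1 (s k).
Proof. by rewrite /s; case: ifP. Qed.

Lemma mps_subst_zeroing f m :
  mps_subst s f m = if [forall k, P k ==> (m k == 0%N)] then f m else 0.
Proof.
rewrite (mps_substE ordge_zeroing _ (ltnSn _)).
have prodE (e : 'X_{1..n}) : \prod_k s k ^+ e k =
    if [forall k, P k ==> (e k == 0%N)] then monom R e else 0.
  case: ifPn => [/forallP h|/forallPn[k]].
    rewrite monom_var; apply: eq_bigr => k _; rewrite /s.
    by move/implyP: (h k); case: ifP => // _ /(_ isT)/eqP->.
  by rewrite negb_imply => /andP[Pk ek]; rewrite (bigD1 k) //= /s Pk expr0n (negPf ek) mul0r.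
rewrite (bigD1 (BMultinom (ltnSn (mdeg m)))) //= prodE big1 => [|e ne].
  by case: ifP; rewrite ?mulr0 ?addr0 // monomE eqxx mulr1.
rewrite prodE; case: ifP => _; last by rewrite mulr0.
by move: ne; rewrite bmeqP monomE => /negPf /= ->; rewrite mulr0.
Qed.
End Zeroing.

(** The fixed point theorem for the complete metric given by the order. It yields the formal inverse
    and the inverse of a change of coordinate. *)
Lemma contraction_fix n (R : comNzRingType) (Psi : mps n R -> mps n R) :
  (forall f, ordge 1 f -> ordge 1 (Psi f)) ->
  (forall d f g, ordge 1 f -> ordge 1 g -> ordge d (f - g) ->
    ordge d.+1 (Psi f - Psi g)) ->
  exists2 f, ordge 1 f & Psi f = f.
Proof.
move=> Psi1 contr; pose it j := iter j Psi 0.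
have it1 j : ordge 1 (it j) by elim: j => [|j IH] //=; apply: Psi1.
have itS j : ordge j.+1 (it j.+1 - it j).
  elim: j => [|j IH]; first by apply: ordgeB.
  exact: (contr _ _ _ (it1 _) (it1 _) IH).
have itD i j : ordge i.+1 (it (i + j)%N - it i).
  elim: j => [|j IH]; first by rewrite addn0 subrr.
  rewrite addnS -[it _.+1](subrK (it (i + j)%N)) -addrA; apply: ordgeD => //.
  by apply: ordgeW (itS _); rewrite ltnS leq_addr.
(* The coefficient at [m] is stable from iteration [mdeg m] on. *)
pose c : mps n R := Mps (fun m => it (mdeg m) m).
have cE j : ordge j.+1 (c - it j).
  move=> m lt_m; rewrite mps_coefB /=; apply/eqP; rewrite subr_eq0 eq_sym -subr_eq0.
  by rewrite -mps_coefB -(@subnKC (mdeg m) j) // itD.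
have c1 : ordge 1 c by move=> m lt_m; rewrite /= it1.
exists c => //; apply: ordge_eq => d.
have -> : Psi c - c = (Psi c - Psi (it d)) - (c - it d.+1) by rewrite /= opprB addrA subrK.
apply: ordgeB; last by apply: ordgeW (cE d.+1); lia.
by apply: ordgeW (contr _ _ _ c1 (it1 d) (cE d)); lia.
Qed.

Section FormalGroupLaw.
Variables (R : comNzRingType) (F : mps 2 R).

Lemma mps_subst_fgl_add k l (t : 'I_k -> mps l R) (a b : mps k R) :
  ordge 1 a -> ordge 1 b -> (forall i, ordge 1 (t i)) ->
  mps_subst t (fgl_add F a b) = fgl_add F (mps_subst t a) (mps_subst t b).
Proof.
move=> ha hb ht; rewrite /fgl_add mps_subst_comp // => [|i]; last by case: ifP.
by apply: eq_mps_subst => i; case: ifP.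
Qed.

Lemma fgl_add_ordge k (a b : mps k R) :
  ordge 1 F -> ordge 1 a -> ordge 1 b -> ordge 1 (fgl_add F a b).
Proof. by move=> hF ha hb; apply: mps_subst_ordge => // i; case: ifP. Qed.

Hypothesis hF : is_fgl F.

(** The series K with F(u, v) = u + v + u v K(u, v). *)
Definition fgl_cross : mps 2 R :=
  Mps (fun m => F (m + U_(ord0) + U_(ord_max))%MM).

(** The unit axioms F(u, 0) = u and F(0, v) = v determine the coefficients of the pure powers; every
    other monomial is divisible by u v. *)
Lemma fgl_addE' : F = mps_var R ord0 + mps_var R ord_max +
  mps_var R ord0 * mps_var R ord_max * fgl_cross.
Proof.
have [[hl hr] _ _] := hF.
pose t : 'I_1 -> mps 2 R := fun _ => mps_var R ord0.
pose t' : 'I_1 -> mps 2 R := fun _ => mps_var R ord_max.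
have t0 i : ordge 1 (t i) by exact: ordge_var.
have t'0 i : ordge 1 (t' i) by exact: ordge_var.
have ord2 (i : 'I_2) : (i == ord_max) = (i != ord0) by case: i => [[|[|k]] lt_k].
have h0 : mps_subst (fun i => if i == ord_max then 0 else mps_var R i) F = mps_var R ord0.
  have := congr1 (mps_subst t) hl; rewrite mps_subst_fgl_add // mps_subst_var //.
  rewrite mps_subst0 // => E; apply: etrans E; apply: eq_mps_subst => i; rewrite ord2.
  by case: eqP => // ->.
have h1 : mps_subst (fun i => if i == ord0 then 0 else mps_var R i) F = mps_var R ord_max.
  have := congr1 (mps_subst t') hr; rewrite mps_subst_fgl_add // mps_subst_var //.
  rewrite mps_subst0 // => E; apply: etrans E; apply: eq_mps_subst => i.
  by case: ifP => // /negbT; rewrite -ord2 => /eqP->.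
apply: mpsP => m; rewrite !mps_coefD !mps_varE -monomD monom_coefM !monomE.
case: ifPn => [le_m|].
  rewrite /= -addmA submK //.
  have /mnm_lepP le := le_m.
  have := le ord0; have := le ord_max; rewrite !mnmDE !mnm1E !eqxx /= => l1 l0.
  case: eqP => [E|_]; first by rewrite -E mnm1E in l1.
  case: eqP => [E|_]; first by rewrite -E mnm1E in l0.
  by rewrite !add0r.
move=> nle; have [m1|m1] := eqVneq (m ord_max) 0%N.
  have := mps_subst_zeroing (fun i => i == ord_max) F m; rewrite h0.
  case: ifPn => [_ <-|/forallPn[i]]; last first.
    by rewrite negb_imply => /andP[/eqP->]; rewrite m1.
  case: (U_(ord_max)%MM =P m) => [E|_]; last by rewrite !addr0 eq_sym.
  by rewrite -E mnm1E in m1.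
have m0 : m ord0 = 0%N.
  apply/eqP; apply: contraNT nle => m0; apply/mnm_lepP => i; rewrite mnmDE !mnm1E.
  have [->|/negPf ne] := eqVneq i ord0; first by rewrite lt0n.
  by move: (ord2 i); rewrite ne => /eqP->; rewrite lt0n.
have := mps_subst_zeroing (fun i => i == ord0) F m; rewrite h1.
case: ifPn => [_ <-|/forallPn[i]]; last first.
  by rewrite negb_imply => /andP[/eqP->]; rewrite m0.
case: (U_(ord0)%MM =P m) => [E|_]; last by rewrite add0r addr0 eq_sym.
by rewrite -E mnm1E in m0.
Qed.

Lemma fgl_addE k (a b : mps k R) : ordge 1 a -> ordge 1 b ->
  fgl_add F a b = a + b + a * b * fgl_add fgl_cross a b.
Proof.
move=> ha hb; rewrite {1}/fgl_add {1}fgl_addE'.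
set s := fun i : 'I_2 => _; have s0 i : ordge 1 (s i) by rewrite /s; case: ifP.
by rewrite mps_substD // !mps_substM // mps_substD // !mps_subst_var.
Qed.

Lemma fgl_ordge1 : ordge 1 F.
Proof.
rewrite fgl_addE'; apply: ordgeD; first by apply: ordgeD.
by do 2! apply: ordgeMr.
Qed.
Hint Resolve fgl_ordge1 : core.

Lemma ordge_fgl_add k (a b : mps k R) :
  ordge 1 a -> ordge 1 b -> ordge 1 (fgl_add F a b).
Proof. exact: fgl_add_ordge. Qed.

Section Group.
Variable k : nat.
Implicit Types a b c : mps k R.

Lemma fgl_addC a b : ordge 1 a -> ordge 1 b -> fgl_add F a b = fgl_add F b a.
Proof.
move=> ha hb; have [_ /= hC _] := hF; pose s (i : 'I_2) := if i == ord0 then a else b.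
have s0 i : ordge 1 (s i) by rewrite /s; case: ifP.
by have := congr1 (mps_subst s) hC; rewrite !mps_subst_fgl_add // !mps_subst_var.
Qed.

Lemma fgl_addA a b c : ordge 1 a -> ordge 1 b -> ordge 1 c ->
  fgl_add F a (fgl_add F b c) = fgl_add F (fgl_add F a b) c.
Proof.
move=> ha hb hc; have [_ _ /= hA] := hF.
pose s (i : 'I_3) := if i == ord0 then a else if i == inord 1 then b else c.
have s0 i : ordge 1 (s i) by rewrite /s; do 2!case: ifP => //.
have := congr1 (mps_subst s) hA.
have e1 : s (inord 1) = b by rewrite /s eqxx -val_eqE /= inordK.
have e2 : s ord_max = c by rewrite /s -!val_eqE /= inordK.
rewrite !mps_subst_fgl_add //; try exact: ordge_fgl_add.
by rewrite !mps_subst_var // e1 e2.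
Qed.

Lemma fgl_addr0 a : ordge 1 a -> fgl_add F a 0 = a.
Proof. by move=> ha; rewrite fgl_addE // mulr0 mul0r !addr0. Qed.

Lemma fgl_add0r a : ordge 1 a -> fgl_add F 0 a = a.
Proof. by move=> ha; rewrite fgl_addC // fgl_addr0. Qed.

End Group.

Lemma fgl_inverseP : is_fgl_inverse F (fgl_inverse F).
Proof.
suff [c hc] : exists c, is_fgl_inverse F c.
  by rewrite /fgl_inverse; case: pselect => [ex|[]]; [case: cid|exists c].
pose t : mps 1 R := mps_var R ord0.
have t1 : ordge 1 t by exact: ordge_var.
(* F(t, c) = 0 reads c = - t - t c K(t, c), and the factor t makes the right side contracting in
   c. *)
pose Psi (c : mps 1 R) := - t - t * (c * fgl_add fgl_cross t c).
have [||c c1 fix_c] := @contraction_fix 1 R Psi.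
- move=> f _; apply: ordgeB; first exact: ordgeN.
  exact: ordgeMr.
- move=> d f g hf hg hfg; rewrite /Psi.
  set Kf := fgl_add _ t f; set Kg := fgl_add _ t g.
  have -> : - t - t * (f * Kf) - (- t - t * (g * Kg)) =
    t * (- ((f - g) * Kf + g * (Kf - Kg))) by ring.
  apply: (@ordgeM _ _ 1 d) => //; apply: ordgeN; apply: ordgeD; first exact: ordgeMr.
  apply: ordgeMl; apply: mps_subst_eqmod; try by move=> i; case: ifP.
  by move=> i; case: ifP => // _; rewrite subrr.
exists c; split; first by rewrite c1 // mdeg0.
rewrite fgl_addE // -/t.
have -> : t + c + t * c * fgl_add fgl_cross t c = c - Psi c by rewrite /Psi; ring.
by rewrite fix_c subrr.
Qed.

Lemma ordge_fgl_opp k (a : mps k R) : ordge 1 a -> ordge 1 (fgl_opp F a).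
Proof.
move=> ha; apply: mps_subst_ordge => // m; rewrite ltnS leqn0 mdeg_eq0 => /eqP->.
by case: fgl_inverseP.
Qed.

Lemma ordge_fgl_inverse : ordge 1 (fgl_inverse F).
Proof.
move=> m; rewrite ltnS leqn0 mdeg_eq0 => /eqP->; by case: fgl_inverseP.
Qed.

Lemma fgl_addN k (a : mps k R) : ordge 1 a -> fgl_add F a (fgl_opp F a) = 0.
Proof.
move=> ha; have [_ h] := fgl_inverseP; pose s (i : 'I_1) := a.
have s0 i : ordge 1 (s i) by [].
have := congr1 (mps_subst s) h; rewrite mps_subst0 // mps_subst_fgl_add //.
  by rewrite mps_subst_var.
exact: ordge_fgl_inverse.
Qed.

Lemma fgl_opp_unique k (a b : mps k R) :
  ordge 1 a -> ordge 1 b -> fgl_add F a b = 0 -> b = fgl_opp F a.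
Proof.
move=> ha hb hab; have ho := ordge_fgl_opp ha.
rewrite -[b]fgl_add0r // -(fgl_addN ha) (fgl_addC ha ho) -fgl_addA // hab.
exact: fgl_addr0.
Qed.

Lemma fgl_oppK k (a : mps k R) : ordge 1 a -> fgl_opp F (fgl_opp F a) = a.
Proof.
move=> ha; have ho := ordge_fgl_opp ha.
by symmetry; apply: fgl_opp_unique => //; rewrite fgl_addC // fgl_addN.
Qed.

Lemma fgl_opp0 k : fgl_opp F (0 : mps k R) = 0.
Proof. by symmetry; apply: fgl_opp_unique; rewrite // fgl_addr0. Qed.

Lemma mps_subst_fgl_opp k l (t : 'I_k -> mps l R) (a : mps k R) :
  ordge 1 a -> (forall i, ordge 1 (t i)) ->
  mps_subst t (fgl_opp F a) = fgl_opp F (mps_subst t a).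
Proof.
move=> ha ht; have ho := ordge_fgl_opp ha; apply: fgl_opp_unique; try exact: mps_subst_ordge.
by rewrite -mps_subst_fgl_add // fgl_addN // mps_subst0.
Qed.

(* x - y = e * (1 + y K(e, y)) for e = x +_F (-_F y), obtained by expanding
   x = e +_F y *)
Definition sub_ratio k (a b : mps k R) : mps k R :=
  1 + b * fgl_add fgl_cross (fgl_add F a (fgl_opp F b)) b.

Lemma fgl_subE k (a b : mps k R) : ordge 1 a -> ordge 1 b ->
  a - b = fgl_add F a (fgl_opp F b) * sub_ratio a b.
Proof.
move=> ha hb; have ho := ordge_fgl_opp hb; set e := fgl_add F a _.
have he : ordge 1 e by apply: ordge_fgl_add.
have {1}-> : a = fgl_add F e b.
  by rewrite /e -fgl_addA // (fgl_addC ho) // fgl_addN // fgl_addr0.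
rewrite fgl_addE // /sub_ratio -/e; ring.
Qed.

Lemma mps_subst_sub_ratio k l (t : 'I_k -> mps l R) (a b : mps k R) :
  ordge 1 a -> ordge 1 b -> (forall i, ordge 1 (t i)) ->
  mps_subst t (sub_ratio a b) = sub_ratio (mps_subst t a) (mps_subst t b).
Proof.
move=> ha hb ht; have ho := ordge_fgl_opp hb; rewrite /sub_ratio.
rewrite mps_substD // mps_subst1 // mps_substM //.
rewrite mps_subst_comp //; last first.
  by move=> i; case: ifP => // _; apply: ordge_fgl_add.
congr (1 + _ * _); apply: eq_mps_subst => i; case: ifP => // _.
by rewrite mps_subst_fgl_add // mps_subst_fgl_opp.
Qed.

End FormalGroupLaw.

Lemma mps_subst_perm n (R : comNzRingType) (w : 'S_n) (f : mps n R) m :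
  mps_subst (fun i => mps_var R (w i)) f m = f [multinom m (w i) | i < n].
Proof.
pose mw := [multinom m (w i) | i < n].
have degw : mdeg mw = mdeg m.
  rewrite !mdegE [RHS](reindex_inj (@perm_inj _ w)) /=.
  by apply: eq_bigr => i _; rewrite mnmE.
have prodE (e : 'X_{1..n}) : \prod_i mps_var R (w i) ^+ e i =
    monom R [multinom e ((w^-1)%g i) | i < n].
  rewrite monom_var [RHS](reindex_inj (@perm_inj _ w)) /=.
  by apply: eq_bigr => i _; rewrite mnmE permK.
rewrite (mps_substE _ _ (ltnSn _)) //.
have lt : (mdeg mw < (mdeg m).+1)%N by rewrite degw.
rewrite (bigD1 (BMultinom lt)) //= prodE big1 ?addr0 => [|e ne].
  rewrite monomE (_ : _ == m) ?mulr1 //; apply/eqP/mnmP => i.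
  by rewrite !mnmE permKV.
rewrite prodE monomE; case: eqP => [E|_]; last by rewrite mulr0.
case/negP: ne; rewrite bmeqP /=; apply/eqP/mnmP => i.
by have := congr1 (fun m' : 'X_{1..n} => m' (w i)) E; rewrite !mnmE permK.
Qed.

Lemma ordge_exprB n (R : comNzRingType) (f g : mps n R) e :
  ordge 1 f -> ordge 1 g -> ordge 2 (f - g) -> ordge e.+1 (f ^+ e - g ^+ e).
Proof.
move=> hf hg hfg; elim: e => [|e IH]; first by rewrite subrr.
have -> : f ^+ e.+1 - g ^+ e.+1 = f * (f ^+ e - g ^+ e) + (f - g) * g ^+ e.
  rewrite !exprS; ring.
apply: ordgeD; first exact: (@ordgeM _ _ 1 e.+1).
by apply: (@ordgeM _ _ 2 e) => //; apply: ordgeX.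
Qed.

Section MapSeries.
Variables (R S : comNzRingType) (phi : {rmorphism R -> S}).

Lemma mps_map_is_zmod n : zmod_morphism (@mps_map n R S phi).
Proof. by move=> f g; apply: mpsP => m; rewrite mps_coefB /= rmorphB. Qed.

Lemma mps_map_is_monoid n : monoid_morphism (@mps_map n R S phi).
Proof.
split=> [|f g]; apply: mpsP => m; first by rewrite /= rmorph_nat.
by rewrite mps_coefM /= rmorph_sum; apply: eq_bigr => k _; rewrite rmorphM.
Qed.

Definition mapm n := @mps_map n R S phi.
HB.instance Definition _ n :=
  GRing.isZmodMorphism.Build _ _ (@mapm n) (@mps_map_is_zmod n).
HB.instance Definition _ n :=
  GRing.isMonoidMorphism.Build _ _ (@mapm n) (@mps_map_is_monoid n).

Lemma mps_map_var n i : mps_map phi (mps_var R (i : 'I_n)) = mps_var S i.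
Proof. by apply: mpsP => m; rewrite /= rmorph_nat. Qed.

Lemma mps_map_subst n k (s : 'I_n -> mps k R) f :
  mps_map phi (mps_subst s f) = mps_subst (fun i => mps_map phi (s i)) (mps_map phi f).
Proof.
apply: mpsP => m; rewrite /= rmorph_sum; apply: eq_bigr => e _.
rewrite rmorphM; congr (_ * _).
pose g : mps k R := \prod_(i < n) s i ^+ (e : 'X_{1..n}) i.
rewrite -[phi _]/(mapm g m) rmorph_prod.
by under eq_bigr do rewrite rmorphXn.
Qed.

Lemma mps_map_fgl_add (F : mps 2 R) k (a b : mps k R) :
  mps_map phi (fgl_add F a b) = fgl_add (mps_map phi F) (mps_map phi a) (mps_map phi b).
Proof. by rewrite mps_map_subst; apply: eq_mps_subst => i; case: ifP. Qed.

Lemma mps_map_fgl (F : mps 2 R) : is_fgl F -> is_fgl (mps_map phi F).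
Proof.
have map0 k : mps_map phi (0 : mps k R) = 0 by apply: (raddf0 (@mapm k)).
move=> [[hl hr] /= hC hA]; split => /=; first split.
- by rewrite -(mps_map_var 0%R) -map0 -mps_map_fgl_add hl.
- by rewrite -(mps_map_var 0%R) -map0 -mps_map_fgl_add hr.
- by rewrite -!mps_map_var -!mps_map_fgl_add hC.
- by rewrite -!mps_map_var -!mps_map_fgl_add hA.
Qed.

End MapSeries.

Section MapInjective.
Variables (R S : comNzRingType) (phi : {rmorphism R -> S}).
Hypothesis phi_inj : injective phi.

Lemma mps_map_inj n : injective (@mps_map n R S phi).
Proof.
move=> f g E; apply: mpsP => m; apply: phi_inj.
exact: (congr1 (fun h : mps n S => h m) E).
Qed.

Lemma mps_map_fgl_inj (F : mps 2 R) : is_fgl (mps_map phi F) -> is_fgl F.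
Proof.
have map0 k : mps_map phi (0 : mps k R) = 0 by apply: (raddf0 (@mapm _ _ phi k)).
move=> [[hl hr] /= hC hA]; split => /=; first split; apply: mps_map_inj;
  by rewrite ?mps_map_fgl_add ?map0 ?mps_map_var ?mps_map_fgl_add ?map0 ?mps_map_var.
Qed.
End MapInjective.

Section AdditiveLaw.
Variable R : comNzRingType.
Definition fgl_additive : mps 2 R := mps_var R ord0 + mps_var R ord_max.

Lemma fgl_additiveE k (a b : mps k R) : ordge 1 a -> ordge 1 b ->
  fgl_add fgl_additive a b = a + b.
Proof.
move=> ha hb; rewrite /fgl_add mps_substD ?mps_subst_var // => i; by case: ifP.
Qed.

Lemma fgl_additiveP : is_fgl fgl_additive.
Proof.
split => /=; first by rewrite !fgl_additiveE // add0r addr0.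
  by rewrite !fgl_additiveE // addrC.
by rewrite !fgl_additiveE //; [rewrite addrA|exact: ordgeD|exact: ordgeD].
Qed.
End AdditiveLaw.

(** The additive law over the integers is classified by a morphism from L to the integers, where [k]
    is visibly nonzero. *)
Lemma lazard_natr_neq0 (L : comNzRingType) (F : mps 2 L) k :
  is_lazard F -> k != 0%N -> k%:R != 0 :> L.
Proof.
move=> [_ univ] k0; have [phi _] := univ _ _ (fgl_additiveP int).
apply: contraNneq k0 => /(congr1 phi); rewrite rmorph_nat rmorph0 => /eqP.
by rewrite pnatr_eq0.
Qed.

Lemma ord2_max (i : 'I_2) : i != ord0 -> i = ord_max.
Proof. by move=> ne; apply: val_inj; case: i ne => [[|[|k]] lt_k]. Qed.

Definition mnm2 (i j : nat) : 'X_{1..2} := [multinom if k == ord0 then i else j | k < 2].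

Lemma mnm2_0 i j : mnm2 i j ord0 = i. Proof. by rewrite mnmE. Qed.
Lemma mnm2_1 i j : mnm2 i j ord_max = j. Proof. by rewrite mnmE. Qed.

Lemma mnm2P (m m' : 'X_{1..2}) :
  m ord0 = m' ord0 -> m ord_max = m' ord_max -> m = m'.
Proof.
move=> h0 h1; apply/mnmP => -[[|[|k]] lt_k] //.
  by have -> : Ordinal lt_k = ord0 by apply: val_inj.
by have -> : Ordinal lt_k = ord_max by apply: val_inj.
Qed.

Lemma mnm2_eta (m : 'X_{1..2}) : m = mnm2 (m ord0) (m ord_max).
Proof. by apply: mnm2P; rewrite ?mnm2_0 ?mnm2_1. Qed.

Lemma mdeg2 (m : 'X_{1..2}) : mdeg m = (m ord0 + m ord_max)%N.
Proof.
by rewrite mdegE big_ord_recl big_ord1; congr (_ + m _)%N; apply: val_inj.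
Qed.

Lemma mdeg_mnm2 i j : mdeg (mnm2 i j) = (i + j)%N.
Proof. by rewrite mdeg2 mnm2_0 mnm2_1. Qed.

Section FglCoefficients.
Variables (R : comNzRingType) (F : mps 2 R).
Hypothesis hF : is_fgl F.

Lemma fgl_coef_low (m : 'X_{1..2}) : (m ord0 == 0)%N || (m ord_max == 0)%N ->
  F m = (m == U_(ord0)%MM)%:R + (m == U_(ord_max)%MM)%:R.
Proof.
move=> m0; rewrite {1}(fgl_addE' hF) !mps_coefD !mps_varE -monomD monom_coefM.
rewrite !monomE ![_ == m]eq_sym ifN ?addr0 //.
apply/negP => /mnm_lepP le; have := le ord0; have := le ord_max.
by rewrite !mnmDE !mnm1E /=; case/orP: m0 => /eqP->.
Qed.

Lemma fgl_coef_mdeg1 (m : 'X_{1..2}) : (mdeg m <= 1)%N -> F m = (mdeg m)%:R.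
Proof.
move=> le1; have low : (m ord0 == 0)%N || (m ord_max == 0)%N.
  by move: le1; rewrite mdeg2; case: (m ord0) (m ord_max) => [|[]] [|].
rewrite fgl_coef_low //; case: (m =P U_(ord0)%MM) => [->|n0].
  by rewrite mdeg1 eq_mnm1 addr0.
case: (m =P U_(ord_max)%MM) => [->|n1]; first by rewrite mdeg1 add0r.
case: (mdeg m =P 1%N) => [/eqP/mdeg1P[i /eqP mi]|]; last first.
  by move: le1; case: (mdeg m) => [|[]] //; rewrite addr0.
by case: i mi => [[|[|i]] lt_i].
Qed.

Lemma fgl_coef_sym i j : F (mnm2 i j) = F (mnm2 j i).
Proof.
have [_ /= hC _] := hF.
pose w : 'S_2 := tperm ord0 ord_max.
have e1 : fgl_add F (mps_var R ord0) (mps_var R ord_max) = F.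
  rewrite -[RHS]mps_subst_id; apply: eq_mps_subst => l.
  by case: eqP => [->|/eqP ne] //; rewrite (ord2_max ne).
have e2 : fgl_add F (mps_var R ord_max) (mps_var R ord0) =
    mps_subst (fun i => mps_var R (w i)) F.
  apply: eq_mps_subst => l; case: eqP => [->|/eqP ne]; first by rewrite tpermL.
  by rewrite (ord2_max ne) tpermR.
rewrite -{1}e1 hC e2 mps_subst_perm; congr (F _); apply: mnm2P.
  by rewrite mnmE tpermL !mnmE.
by rewrite mnmE tpermR !mnmE.
Qed.
End FglCoefficients.

(* unification would otherwise unfold substitutions and products *)
Opaque mps_subst mps_mul mps_var.

(** * The Lazard ring at the prime 2 *)

(** [c] and [d] are families over all numbers of variables because the axioms of a law live in one,
    two and three variables. *)
Lemma fgl_transport (R : comNzRingType) (F G : mps 2 R) (c d : forall k, mps k R -> mps k R) :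
  is_fgl F ->
  (forall k (a : mps k R), ordge 1 a -> ordge 1 (c k a)) ->
  (forall k (a : mps k R), ordge 1 a -> ordge 1 (d k a)) ->
  (forall k (a : mps k R), ordge 1 a -> d k (c k a) = a) ->
  (forall k (a : mps k R), ordge 1 a -> c k (d k a) = a) ->
  (forall k, d k 0 = 0) ->
  (forall k (a b : mps k R), ordge 1 a -> ordge 1 b ->
     fgl_add G a b = c k (fgl_add F (d k a) (d k b))) ->
  is_fgl G.
Proof.
move=> hF hc hd dc cd d0 GE.
have op k (a b : mps k R) : ordge 1 a -> ordge 1 b -> ordge 1 (fgl_add F (d k a) (d k b)).
  by move=> ha hb; apply: ordge_fgl_add => //; apply: hd.
split=> /=; first split.
- have ht := @ordge_var 1 R ord0.
  by rewrite (GE _ _ _ ht (@ordge0 1 R 1)) d0 (fgl_addr0 hF (hd _ _ ht)) cd.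
- have ht := @ordge_var 1 R ord0.
  by rewrite (GE _ _ _ (@ordge0 1 R 1) ht) d0 (fgl_add0r hF (hd _ _ ht)) cd.
- have hu := @ordge_var 2 R ord0; have hv := @ordge_var 2 R ord_max.
  rewrite (GE _ _ _ hu hv) (GE _ _ _ hv hu).
  by rewrite (fgl_addC hF (hd _ _ hu) (hd _ _ hv)).
move: (@ordge_var 3 R ord0) (@ordge_var 3 R (inord 1)) (@ordge_var 3 R ord_max).
move: (mps_var R ord0) (mps_var R (inord 1)) (mps_var R ord_max) => x y z hx hy hz.
have hyz := op _ _ _ hy hz; have hxy := op _ _ _ hx hy.
rewrite (GE _ _ _ hy hz) (GE _ _ _ hx hy) (GE _ _ _ hx (hc _ _ hyz)).
rewrite (GE _ _ _ (hc _ _ hxy) hz) (dc _ _ hyz) (dc _ _ hxy).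
by rewrite (fgl_addA hF (hd _ _ hx) (hd _ _ hy) (hd _ _ hz)).
Qed.

(** * Conjugation of a law by the change of coordinate x + s x^N *)

Section Conjugation.
Variables (R : idomainType) (F : mps 2 R) (hF : is_fgl F) (s : R) (N : nat).
Hypothesis N2 : (2 <= N)%N.

Definition coord k (a : mps k R) : mps k R := a + mpsC k s * a ^+ N.

Lemma coord_inv_ex : exists2 p : mps 1 R, ordge 1 p & p = mps_var R ord0 - mpsC 1 s * p ^+ N.
Proof.
pose Psi (p : mps 1 R) := mps_var R ord0 - mpsC 1 s * p ^+ N.
have [||p p1 E] := @contraction_fix 1 R Psi; last by exists p.
  move=> f hf; apply: ordgeB => //; apply: ordgeMl.
  by apply: ordgeW (ordgeX (e := N) hf); lia.
move=> d f g hf hg hfg; rewrite /Psi.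
have -> : mps_var R ord0 - mpsC 1 s * f ^+ N - (mps_var R ord0 - mpsC 1 s * g ^+ N) =
  mpsC 1 s * (g ^+ N - f ^+ N) by ring.
apply: ordgeMl; rewrite -opprB; apply: ordgeN; rewrite subrXX.
apply: ordgeW (_ : d.+1 <= d + 1)%N _; first by rewrite addn1.
apply: ordgeM => //; apply: ordge_sum => i _.
have := ordgeM (ordgeX (e := N.-1 - i) hf) (ordgeX (e := i) hg).
by apply: ordgeW; have := ltn_ord i; lia.
Qed.

Definition coord_inv_series : mps 1 R := projT1 (cid2 coord_inv_ex).
Lemma ordge_coord_inv_series : ordge 1 coord_inv_series. Proof. by rewrite /coord_inv_series; case: cid2. Qed.
Lemma coord_inv_seriesE : coord_inv_series = mps_var R ord0 - mpsC 1 s * coord_inv_series ^+ N.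
Proof. by rewrite /coord_inv_series; case: cid2. Qed.

Definition coord_inv k (a : mps k R) : mps k R := mps_subst (fun _ => a) coord_inv_series.

Lemma ordge_coord_inv k (a : mps k R) : ordge 1 a -> ordge 1 (coord_inv a).
Proof. by move=> ha; apply: mps_subst_ordge => //; apply: ordge_coord_inv_series. Qed.

Lemma ordge_coord k (a : mps k R) : ordge 1 a -> ordge 1 (coord a).
Proof.
move=> ha; apply: ordgeD => //; apply: ordgeMl.
by apply: ordgeW (ordgeX (e := N) ha); lia.
Qed.

Lemma coord_invE k (a : mps k R) : ordge 1 a -> coord_inv a = a - mpsC k s * coord_inv a ^+ N.
Proof.
move=> ha; have ha' : 'I_1 -> ordge 1 a by [].
by rewrite {1}/coord_inv coord_inv_seriesE mps_substB // mps_substM // mps_substXn // mps_substC // mps_subst_var.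
Qed.

Lemma coord_invK k (a : mps k R) : ordge 1 a -> coord (coord_inv a) = a.
Proof. by move=> ha; rewrite /coord {1}coord_invE // addrNK. Qed.

(** The difference of the images is a - b times a series with constant term 1, since N >= 2; that
    factor is nonzero in a domain. *)
Lemma coord_inj k (a b : mps k R) : ordge 1 a -> ordge 1 b -> coord a = coord b -> a = b.
Proof.
move=> ha hb; rewrite /coord => /eqP; rewrite -subr_eq0.
have -> : a + mpsC k s * a ^+ N - (b + mpsC k s * b ^+ N) =
    (a - b) + mpsC k s * (a ^+ N - b ^+ N) by ring.
rewrite subrXX mulrCA -{1}[a - b]mulr1 -mulrDr mulf_eq0 subr_eq0.
case/orP => [/eqP //|/eqP h].
case/negP: (oner_neq0 R).
have := congr1 (fun f : mps k R => f 0%MM) h.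
rewrite mps_coefD mps_coef1 eqxx mps_coef0.
set f := mpsC k s * _; suff -> : f 0%MM = 0 by rewrite addr0 => /eqP.
have : ordge 1 f by apply: ordgeMl; apply: ordge_sum => i _;
  apply: ordgeW (ordgeM (ordgeX (e := N.-1 - i) ha) (ordgeX (e := i) hb));
  have := ltn_ord i; lia.
by apply; rewrite mdeg0.
Qed.

Lemma coordK k (a : mps k R) : ordge 1 a -> coord_inv (coord a) = a.
Proof.
move=> ha; have h := ordge_coord ha.
exact: (coord_inj (ordge_coord_inv h) ha (coord_invK h)).
Qed.

Lemma mps_subst_coord k l (t : 'I_k -> mps l R) (a : mps k R) : (forall i, ordge 1 (t i)) ->
  mps_subst t (coord a) = coord (mps_subst t a).
Proof. by move=> ht; rewrite /coord mps_substD // mps_substM // mps_substXn // mps_substC. Qed.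

Lemma mps_subst_coord_inv k l (t : 'I_k -> mps l R) (a : mps k R) : (forall i, ordge 1 (t i)) ->
  ordge 1 a -> mps_subst t (coord_inv a) = coord_inv (mps_subst t a).
Proof. by move=> ht ha; rewrite /coord_inv mps_subst_comp. Qed.

Lemma coord_inv0 k : coord_inv (0 : mps k R) = 0.
Proof.
apply: coord_inj; rewrite ?coord_invK //; first exact: ordge_coord_inv.
by rewrite /coord expr0n; case: N N2 => // ? _; rewrite mulr0 addr0.
Qed.

Lemma coordE k (a : mps k R) : coord a = a + mpsC k s * a ^+ N.
Proof. by []. Qed.

Opaque coord coord_inv.

Definition fgl_conj : mps 2 R :=
  coord (fgl_add F (coord_inv (mps_var R ord0)) (coord_inv (mps_var R ord_max))).

Let fgl_conjE k (a b : mps k R) : ordge 1 a -> ordge 1 b ->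
  fgl_add fgl_conj a b = coord (fgl_add F (coord_inv a) (coord_inv b)).
Proof.
move=> ha hb; have h i : ordge 1 (if i == ord0 :> 'I_2 then a else b) by case: ifP.
have hp i := ordge_coord_inv (@ordge_var 2 R i).
apply: etrans (mps_subst_coord _ h) _; congr (coord _).
rewrite (mps_subst_fgl_add _ (hp _) (hp _) h).
by rewrite !(mps_subst_coord_inv h (@ordge_var 2 R _)) !(mps_subst_var h).
Qed.

Lemma fgl_conjP : is_fgl fgl_conj.
Proof.
apply: (fgl_transport hF ordge_coord ordge_coord_inv coordK coord_invK coord_inv0).
exact: fgl_conjE.
Qed.

Let u := mps_var R (ord0 : 'I_2).
Let v := mps_var R (ord_max : 'I_2).
Let H := fgl_add F (coord_inv u) (coord_inv v).

Let psi_mod k (a : mps k R) : ordge 1 a -> ordge N (coord_inv a - a).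
Proof.
move=> ha; rewrite coord_invE // addrAC subrr add0r; apply: ordgeN; apply: ordgeMl.
by apply: ordgeX; apply: ordge_coord_inv.
Qed.

Let F_id : fgl_add F u v = F.
Proof.
rewrite -[RHS]mps_subst_id; apply: eq_mps_subst => i.
by case: eqP => [->|/eqP ne] //; rewrite (ord2_max ne).
Qed.

Let u1 : ordge 1 u. Proof. exact: ordge_var. Qed.
Let v1 : ordge 1 v. Proof. exact: ordge_var. Qed.
Let H1 : ordge 1 H.
Proof. by apply: ordge_fgl_add => //; apply: ordge_coord_inv. Qed.

Let H_mod : ordge N (H - F).
Proof.
rewrite -F_id; apply: mps_subst_eqmod => i; case: ifP => _ //; try exact: ordge_coord_inv.
  exact: psi_mod.
exact: psi_mod.
Qed.

Lemma fgl_conj_coef_lt m : (mdeg m < N)%N -> fgl_conj m = F m.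
Proof.
move=> lt; apply/eqP; rewrite -subr_eq0 -mps_coefB /fgl_conj coordE -/u -/v -/H.
rewrite addrAC mps_coefD H_mod // add0r.
by rewrite (ordgeMl _ (ordgeX H1)).
Qed.

(** In degree N the law changes by s ((u + v)^N - u^N - v^N), the coboundary of the coordinate
    change. Only mixed monomials are considered, which leaves the binomial coefficient. *)
Lemma fgl_conj_coef_eq i j : (0 < i)%N -> (0 < j)%N -> (i + j = N)%N ->
  fgl_conj (mnm2 i j) = F (mnm2 i j) + s *+ 'C(N, i).
Proof.
move=> i0 j0 ijN; set m := mnm2 i j.
have lt : (mdeg m < N.+1)%N by rewrite mdeg_mnm2 ijN.
have psi_mod' k (a : mps k R) : ordge 1 a -> ordge N.+1 (coord_inv a - a + mpsC k s * a ^+ N).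
  move=> ha; rewrite coord_invE //.
  have -> : a - mpsC k s * coord_inv a ^+ N - a + mpsC k s * a ^+ N =
     - (mpsC k s * (coord_inv a ^+ N - a ^+ N)) by ring.
  apply: ordgeN; apply: ordgeMl; apply: ordge_exprB => //; first exact: ordge_coord_inv.
  exact: ordgeW (psi_mod ha).
have coefX (l : 'I_2) : (monom R U_(l)%MM ^+ N) m = 0.
  rewrite -monomMn monomE; case: eqP => // E.
  have := congr1 (fun k : 'X_{1..2} => k ord0) E.
  have := congr1 (fun k : 'X_{1..2} => k ord_max) E.
  rewrite /m mnm2_0 mnm2_1 !mulmnE !mnm1E.
  by case: (l =P ord0) => [->|/eqP/ord2_max ->] /=; rewrite ?eqxx /=; lia.
have coef_psi (l : 'I_2) : (coord_inv (mps_var R l) - mps_var R l) m = 0.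
  have := psi_mod' _ _ (@ordge_var _ R l) m lt.
  by rewrite mps_coefD mps_coefCM mps_varE coefX mulr0 addr0.
(* Up to degree N the inverse coordinate changes u only by the pure power - s u^N, which does not
   reach the mixed monomial; in the product term the change is multiplied by a further variable. *)
have HF : H m = F m.
  apply/eqP; rewrite -subr_eq0 -mps_coefB -[in X in H - X]F_id /H !(fgl_addE hF) //; try exact: ordge_coord_inv.
  set K1 := fgl_add _ (coord_inv u) _; set K2 := fgl_add _ u _.
  have -> : coord_inv u + coord_inv v + coord_inv u * coord_inv v * K1 - (u + v + u * v * K2) =
    (coord_inv u - u) + (coord_inv v - v) + (coord_inv u * coord_inv v * (K1 - K2) + ((coord_inv u - u) * coord_inv v + u * (coord_inv v - v)) * K2) by ring.
  rewrite mps_coefD [X in X + _]mps_coefD !coef_psi !add0r.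
  suff h0 : ordge N.+1 (coord_inv u * coord_inv v * (K1 - K2) + ((coord_inv u - u) * coord_inv v + u * (coord_inv v - v)) * K2) by rewrite h0.
  apply: ordgeD.
    rewrite -mulrA; apply: (@ordgeM _ _ 1 N); first exact: ordge_coord_inv.
    apply: ordgeMl; apply: mps_subst_eqmod => l; case: ifP => _ //; try exact: ordge_coord_inv.
      exact: psi_mod.
    exact: psi_mod.
  apply: ordgeMr; apply: ordgeD.
    by rewrite mulrC; apply: (@ordgeM _ _ 1 N); [apply: ordge_coord_inv|apply: psi_mod].
  by apply: (@ordgeM _ _ 1 N) => //; apply: psi_mod.
(* H and u + v agree modulo degree 2, hence their N-th powers agree modulo degree N + 1. *)
have HN : (H ^+ N) m = ((u + v) ^+ N) m.
  apply/eqP; rewrite -subr_eq0 -mps_coefB (@ordge_exprB _ _ _ (u + v)) //; first exact: ordgeD.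
  have -> : H - (u + v) = (H - F) + (F - (u + v)) by ring.
  apply: ordgeD; first exact: ordgeW H_mod.
  rewrite -F_id (fgl_addE hF) // addrAC subrr add0r.
  by apply: ordgeMr; apply: (@ordgeM _ _ 1 1).
rewrite /fgl_conj coordE -/u -/v -/H mps_coefD HF mps_coefCM HN; congr (_ + _).
rewrite addrC exprDn mps_coef_sum.
have lti : (i < N.+1)%N by lia.
rewrite (bigD1 (Ordinal lti)) //= big1 ?addr0 => [|l /eqP ne].
  rewrite mps_coefMn /u /v !mps_varE -!monomMn -monomD monomE mulrnAr.
  rewrite (_ : _ == m) ?mulr1 //; apply/eqP/mnm2P.
    by rewrite mnmDE !mulmnE !mnm1E mnm2_0 /=; lia.
  by rewrite mnmDE !mulmnE !mnm1E mnm2_1 /=; lia.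
rewrite mps_coefMn /u /v !mps_varE -!monomMn -monomD monomE.
case: eqP => [E|_]; last by rewrite mul0rn.
case: ne; apply: val_inj; have := congr1 (fun k : 'X_{1..2} => k ord0) E.
by rewrite /= mnmDE !mulmnE !mnm1E mnm2_0 /=; lia.
Qed.

End Conjugation.

(** * Subrings, adjunction of an element, and saturation at odd integers *)

Section Subrings.
Variable R : comNzRingType.
Implicit Types (S T : R -> Prop).

Definition is_subring S :=
  [/\ S 1, forall x y, S x -> S y -> S (x - y) & forall x y, S x -> S y -> S (x * y)].

Lemma subring1 S : is_subring S -> S 1. Proof. by case. Qed.
Lemma subringB S x y : is_subring S -> S x -> S y -> S (x - y). Proof. by case=> _ h _; apply: h. Qed.
Lemma subringM S x y : is_subring S -> S x -> S y -> S (x * y). Proof. by case=> _ _; apply. Qed.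
Lemma subring0 S : is_subring S -> S 0.
Proof. by move=> hS; rewrite -(subrr 1); apply: subringB => //; apply: subring1. Qed.
Lemma subringN S x : is_subring S -> S x -> S (- x).
Proof. by move=> hS hx; rewrite -sub0r; apply: subringB => //; apply: subring0. Qed.
Lemma subringD S x y : is_subring S -> S x -> S y -> S (x + y).
Proof. by move=> hS hx hy; rewrite -[y]opprK; apply: subringB => //; apply: subringN. Qed.
Lemma subring_nat S k : is_subring S -> S k%:R.
Proof.
move=> hS; elim: k => [|k IH]; first exact: subring0.
by rewrite mulrS; apply: subringD => //; apply: subring1.
Qed.
Lemma subring_sum S (I : Type) (r : seq I) (P : pred I) (E : I -> R) : is_subring S ->
  (forall i, P i -> S (E i)) -> S (\sum_(i <- r | P i) E i).
Proof.
move=> hS hE; elim/big_ind: _ => //; first exact: subring0.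
by move=> x y; apply: subringD.
Qed.

Definition adjoin S (t : R) : R -> Prop :=
  fun x => exists2 p : {poly R}, forall k, S p`_k & x = p.[t].

Lemma adjoin_subring S t : is_subring S -> is_subring (adjoin S t).
Proof.
move=> hS; split.
- exists 1; last by rewrite hornerC.
  by move=> k; rewrite coef1; apply: subring_nat.
- move=> _ _ [p hp ->] [q hq ->]; exists (p - q); last by rewrite hornerD hornerN.
  by move=> k; rewrite coefB; apply: subringB.
- move=> _ _ [p hp ->] [q hq ->]; exists (p * q); last by rewrite hornerM.
  by move=> k; rewrite coefM; apply: subring_sum => // i _; apply: subringM.
Qed.

Lemma adjoin_incl S t x : is_subring S -> S x -> adjoin S t x.
Proof.
move=> hS hx; exists x%:P; last by rewrite hornerC.
by move=> k; rewrite coefC; case: eqP => // _; apply: subring0.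
Qed.

Lemma adjoin_gen S t : is_subring S -> adjoin S t t.
Proof.
by move=> hS; exists 'X; [move=> k; rewrite coefX; apply: subring_nat|rewrite hornerX].
Qed.

(** The elements of R that lie in S once odd integers are inverted. *)
Definition loc2 S : R -> Prop := fun x => exists2 k, odd k & S (k%:R * x).

Lemma loc2_subring S : is_subring S -> is_subring (loc2 S).
Proof.
move=> hS; split.
- by exists 1%N => //; apply: subringM => //; [apply: subring_nat|apply: subring1].
- move=> x y [k ok hx] [l ol hy]; exists (k * l)%N; first by rewrite oddM ok.
  have -> : (k * l)%:R * (x - y) = l%:R * (k%:R * x) - k%:R * (l%:R * y) by rewrite natrM; ring.
  by apply: subringB => //; apply: subringM => //; apply: subring_nat.
- move=> x y [k ok hx] [l ol hy]; exists (k * l)%N; first by rewrite oddM ok.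
  have -> : (k * l)%:R * (x * y) = (k%:R * x) * (l%:R * y) by rewrite natrM; ring.
  exact: subringM.
Qed.

Lemma loc2_incl S x : S x -> loc2 S x.
Proof. by exists 1%N => //; rewrite mul1r. Qed.

Lemma loc2_odd S k x : odd k -> loc2 S (k%:R * x) -> loc2 S x.
Proof.
by move=> ok [l ol h]; exists (l * k)%N; [rewrite oddM ol|rewrite natrM -mulrA].
Qed.

Lemma loc2_mono S T x : (forall y, S y -> T y) -> loc2 S x -> loc2 T x.
Proof. by move=> hST [k ok h]; exists k => //; apply: hST. Qed.

Definition integers : R -> Prop := fun x => exists k : int, x = k%:~R.

Lemma integers_subring : is_subring integers.
Proof.
split; first by exists 1.
  by move=> _ _ [k ->] [l ->]; exists (k - l); rewrite rmorphB.
by move=> _ _ [k ->] [l ->]; exists (k * l); rewrite rmorphM.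
Qed.

Lemma coef_in_mul n (S : R -> Prop) D (f g : mps n R) : is_subring S ->
  (forall m, (mdeg m <= D)%N -> S (f m)) -> (forall m, (mdeg m <= D)%N -> S (g m)) ->
  forall m, (mdeg m <= D)%N -> S ((f * g) m).
Proof.
move=> hS hf hg m le; rewrite mps_coefM; apply: subring_sum => // -[k1 k2] _ /=.
by apply: subringM => //; [apply: hf|apply: hg]; apply: leq_trans le; rewrite -ltnS bmdeg.
Qed.

Lemma coef_in_exp n (S : R -> Prop) D (f : mps n R) e : is_subring S ->
  (forall m, (mdeg m <= D)%N -> S (f m)) -> forall m, (mdeg m <= D)%N -> S ((f ^+ e) m).
Proof.
move=> hS hf; elim: e => [|e IH] m le; last by rewrite exprS; apply: coef_in_mul le.
by rewrite mps_coef1; apply: subring_nat.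
Qed.
End Subrings.

Section Generation.
Variables (L : comNzRingType) (F : mps 2 L) (S : L -> Prop).

Definition subring_pred of is_subring S : {pred L} := fun x => `[< S x >].

Hypothesis hS : is_subring S.

Fact subring_pred_closed : subring_closed (subring_pred hS).
Proof.
split; first by apply/asboolP; apply: subring1.
  by move=> x y /asboolP hx /asboolP hy; apply/asboolP; apply: subringB.
by move=> x y /asboolP hx /asboolP hy; apply/asboolP; apply: subringM.
Qed.

HB.instance Definition _ := GRing.isSubringClosed.Build L (subring_pred hS) subring_pred_closed.

Definition subring_type := {x : L | x \in subring_pred hS}.
HB.instance Definition _ := SubChoice.on subring_type.
HB.instance Definition _ := [SubChoice_isSubComNzRing of subring_type by <:].

(** The law restricts to the subring, so universality gives a morphism from L to it. Composed with
    the inclusion it preserves F, hence is the identity of L. *)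
Lemma lazard_generated : is_lazard F -> (forall m, S (F m)) -> forall x, S x.
Proof.
move=> [hF univ] SF x.
pose F' : mps 2 subring_type := Mps (fun m => exist (fun x => x \in subring_pred hS) (F m) (asboolT (SF m))).
pose incl : {rmorphism subring_type -> L} := val.
have F'F : mps_map incl F' = F by apply: mpsP => m.
have hF' : is_fgl F'.
  by apply: (@mps_map_fgl_inj _ _ incl val_inj); rewrite F'F.
have [phi [phiF _]] := univ _ _ hF'.
have [psi [_ uniq]] := univ _ _ hF.
pose id1 : {rmorphism L -> L} := idfun.
pose id2 : {rmorphism L -> L} := incl \o phi.
have h1 : mps_map id1 F = F by apply: mpsP.
have h2 : mps_map id2 F = F by rewrite -[RHS]F'F -phiF; apply: mpsP.
have -> : x = incl (phi x) by rewrite -[RHS]/(id2 x) (uniq _ h2) -(uniq _ h1).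
by case: (phi x) => y /= /asboolP.
Qed.
End Generation.

Section Parity.

(** A case of Lucas' theorem: (1 + X)^2 = 1 + X^2 modulo 2, which is the double Pascal rule
    [pascal2]. *)
Lemma odd_bin_double n k (e : bool) : odd 'C(e + n.*2, k.*2) = odd 'C(n, k).
Proof.
elim: n k => [|n IH] [|k]; rewrite ?double0 ?bin0 //.
  by rewrite !bin_small // doubleS; case: e => /=; lia.
rewrite [in RHS]binS oddD -(IH k) -(IH k.+1).
have pascal2 a b : odd 'C(a.+2, b.+2) = odd 'C(a, b.+2) (+) odd 'C(a, b).
  by rewrite binS binS [X in (_ + X)%N]binS !oddD; do 3!case: (odd 'C(_, _)).
by rewrite !doubleS !addnS pascal2.
Qed.

(** The right side is the binary digit of [i] at position [s], so the binomial tests that digit. *)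
Lemma odd_bin_pow2 i s : odd 'C(i, 2 ^ s) = odd (i %/ 2 ^ s).
Proof.
elim: s i => [|s IH] i; first by rewrite expn0 bin1 divn1.
have -> : 'C(i, 2 ^ s.+1) = 'C(odd i + i./2.*2, (2 ^ s).*2).
  by rewrite odd_double_half expnS mul2n.
by rewrite odd_bin_double IH expnS divnMA divn2.
Qed.
End Parity.

(* 'C(N, gen_index N) has the least 2-adic valuation among the 'C(N, i) with
   0 < i < N *)
Definition gen_index N : nat :=
  if (N == 2 ^ logn 2 N)%N then (2 ^ (logn 2 N).-1)%N else (2 ^ logn 2 N)%N.

Lemma gen_index_gt0 N : (0 < gen_index N)%N.
Proof. by rewrite /gen_index; case: ifP => _; rewrite expn_gt0. Qed.

Lemma gen_index_lt N : (2 <= N)%N -> (gen_index N < N)%N.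
Proof.
move=> N2; rewrite /gen_index; case: eqP => [E|ne].
  rewrite [X in (_ < X)%N]E ltn_exp2l // prednK //.
  by case: (logn 2 N) E => //; lia.
rewrite ltn_neqAle; apply/andP; split; first by apply/eqP => h; apply: ne.
by apply: dvdn_leq; [lia|apply: pfactor_dvdnn].
Qed.

(** * Symmetric 2-cocycles at the prime 2 *)

Section TwoLocalCocycle.
Variables (R : comNzRingType) (S S' : R -> Prop) (N : nat) (b : nat -> R).
Hypotheses (hS' : is_subring S') (SS' : forall x, S x -> S' x).
Hypothesis odd_closed : forall k x, odd k -> S' (k%:R * x) -> S' x.
Hypothesis N2 : (2 <= N)%N.
Hypothesis b_sym : forall i, (0 < i < N)%N -> b (N - i) = b i.
Hypothesis cocycle : forall i j k, (0 < i)%N -> (0 < j)%N -> (0 < k)%N ->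
  (i + j + k = N)%N -> S (b (i + j)%N *+ 'C(i + j, i) - b i *+ 'C(j + k, j)).

(** The relation for the triple (q, i - q, N - i) expresses 'C(i, q) b_i through b_q modulo S; an
    odd factor can then be removed. *)
Lemma cocycle_step q i : (0 < q <= i)%N -> (i < N)%N -> odd 'C(i, q) -> S' (b q) -> S' (b i).
Proof.
move=> /andP[q0]; rewrite leq_eqVlt => /orP[/eqP-> //|lt_qi] lt_i oC hq.
apply: odd_closed oC _.
have h : S' (b (q + (i - q))%N *+ 'C(q + (i - q), q) - b q *+ 'C((i - q) + (N - i), i - q)).
  by apply: SS'; apply: cocycle; lia.
rewrite subnKC in h; last exact: ltnW.
have -> : ('C(i, q))%:R * b i = (b i *+ 'C(i, q) - b q *+ 'C(i - q + (N - i), i - q))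
   + ('C(i - q + (N - i), i - q))%:R * b q by rewrite !mulr_natl subrK.
by apply: subringD => //; apply: subringM => //; apply: subring_nat.
Qed.

Lemma cocycle_bit s i : (0 < i < N)%N -> odd (i %/ 2 ^ s) -> S' (b (2 ^ s)%N) -> S' (b i).
Proof.
move=> /andP[i0 iN] o; apply: cocycle_step => //; last by rewrite odd_bin_pow2.
rewrite expn_gt0 /= leqNgt; apply/negP => lt; by rewrite divn_small in o.
Qed.

Lemma cocycle_generator : S' (b (gen_index N)) ->
  forall i, (0 < i < N)%N -> S' (b i).
Proof.
rewrite /gen_index; set v := logn 2 N; case: eqP => [E|ne] hb i /andP[i0 iN].
  have v0 : (0 < v)%N by case: (v) E => //; lia.
  have E2 : (N = 2 ^ v.-1 + 2 ^ v.-1)%N by rewrite E -{1}(prednK v0) expnS mul2n addnn.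
  (* For N = 2^v every index in the upper half has digit v - 1 equal to 1, so the generator reaches
     it; the lower half follows by symmetry. *)
  have big j : (2 ^ v.-1 <= j)%N -> (j < N)%N -> S' (b j).
    move=> le lt; apply: (@cocycle_bit v.-1) => //.
      by rewrite (leq_trans _ le) ?expn_gt0.
    have -> : (j %/ 2 ^ v.-1 = 1)%N; last by [].
    apply/eqP; rewrite eqn_leq; apply/andP; split.
      by rewrite -ltnS ltn_divLR ?expn_gt0 // mul2n -addnn -E2.
    by rewrite leq_divRL ?expn_gt0 // mul1n.
  have [le|lt] := leqP (2 ^ v.-1) i; first exact: big.
  rewrite -b_sym ?i0 //; apply: big; lia.
have N0 : (0 < N)%N by lia.
have [o oo No] : exists2 o, odd o & N = (2 ^ v * o)%N.
  have [o co No] := pfactor_coprime (isT : prime 2) N0.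
  by exists o; [rewrite coprime2n in co|rewrite mulnC].
have o3 : (3 <= o)%N.
  by case: o oo No => [|[|[|o]]] // _; rewrite muln1.
pose u := trunc_log 2 N.
have uN : (2 ^ u <= N < 2 ^ u.+1)%N by apply: trunc_log_bounds.
have vu : (v < u)%N.
  rewrite -ltnS -(@ltn_exp2l 2) //; apply: leq_trans (_ : N < _)%N; last by case/andP: uN.
  rewrite ltnS No mulnC expnS leq_mul //; lia.
have dvu : (2 ^ u = 2 ^ v * 2 ^ (u - v))%N by rewrite -expnD subnKC // ltnW.
have euv : ~~ odd (2 ^ (u - v)) by rewrite oddX orbF subn_eq0 -ltnNge.
have v_pos : (0 < 2 ^ v)%N by rewrite expn_gt0.
have u_pos : (0 < 2 ^ u)%N by rewrite expn_gt0.
have ltuN : (2 ^ u < N)%N.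
  rewrite ltn_neqAle; case/andP: uN => -> _; rewrite andbT; apply/eqP => E.
  move: oo; suff -> : o = (2 ^ (u - v))%N by rewrite (negPf euv).
  by apply/eqP; rewrite -(eqn_pmul2l v_pos) -dvu -No E.
have huv : (2 ^ u + 2 ^ v <= N)%N.
  have : (2 ^ (u - v) < o)%N by rewrite -(ltn_pmul2l v_pos) -dvu -No.
  by rewrite dvu No -mulnSr leq_pmul2l.
(* From here on N has lowest digit v and highest digit u > v. Removing the highest digit keeps digit
   v, so the generator reaches N - 2^u, and symmetry reaches 2^u. *)
have hu : S' (b (2 ^ u)%N).
  rewrite -b_sym ?u_pos // ; apply: (@cocycle_bit v) => //; first lia.
  have -> : (N - 2 ^ u = (o - 2 ^ (u - v)) * 2 ^ v)%N by rewrite dvu No mulnBl; lia.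
  rewrite mulnK // oddB ?oo ?(negPf euv) //.
  by apply: ltnW; rewrite -(ltn_pmul2l v_pos) -dvu -No.
(* For r < v the index N - 2^r still has digit u, so it is reached from 2^u; symmetry gives 2^r. *)
have hr r : (r < v)%N -> S' (b (2 ^ r)%N).
  move=> rv; have ltr : (2 ^ r < 2 ^ v)%N by rewrite ltn_exp2l.
  have r_pos : (0 < 2 ^ r)%N by rewrite expn_gt0.
  have ltr' : (2 ^ v < 2 ^ u)%N by rewrite ltn_exp2l.
  rewrite -b_sym; last lia.
  apply: (@cocycle_bit u) => //; first lia.
  have -> : ((N - 2 ^ r) %/ 2 ^ u = 1)%N; last by [].
  apply/eqP; rewrite eqn_leq; apply/andP; split.
    rewrite -ltnS ltn_divLR //; case/andP: uN => _; rewrite expnS; lia.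
  by rewrite leq_divRL // mul1n; lia.
(* The lowest digit of such a [j] is at a position r <= v, and b at 2^r is already known. *)
have val j : (0 < j < N)%N -> (logn 2 j <= v)%N -> S' (b j).
  move=> /andP[j0 jN]; set r := logn 2 j => le; apply: (@cocycle_bit r); rewrite ?j0 //.
    have [q cq jq] := pfactor_coprime (isT : prime 2) j0.
    by rewrite jq mulnK ?expn_gt0 //; rewrite coprime2n in cq.
  by move: le; rewrite leq_eqVlt => /orP[/eqP->|/hr].
have [le|lt] := leqP (logn 2 i) v; first by apply: val; rewrite ?i0.
rewrite -b_sym ?i0 //; apply: val; first lia.
rewrite leqNgt; apply/negP => lt'.
suff : (2 ^ v.+1 %| N)%N.
  by rewrite pfactor_dvdn // ltnn.
rewrite -(subnK (ltnW iN)) dvdn_add //.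
  by rewrite pfactor_dvdn // ; lia.
by rewrite pfactor_dvdn.
Qed.
End TwoLocalCocycle.

Section CocycleCoefficient.
Variables (R : comNzRingType) (F : mps 2 R) (S : R -> Prop) (N : nat).
Hypotheses (hF : is_fgl F) (hS : is_subring S).
Hypothesis F_low : forall m, (mdeg m < N)%N -> S (F m).

(** The variables are arbitrary so that, after commutativity, both bracketings of the associativity
    axiom are instances. *)
Lemma assoc_coef_mod (p q r : 'I_3) i j k :
  p != q -> p != r -> q != r -> (0 < i)%N -> (0 < j)%N -> (0 < k)%N -> (i + j + k = N)%N ->
  S (fgl_add F (fgl_add F (mps_var R p) (mps_var R q)) (mps_var R r)
       (U_(p) *+ i + U_(q) *+ j + U_(r) *+ k)%MM
     - F (mnm2 (i + j) k) *+ 'C(i + j, i)).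
Proof.
move=> pq pr qr i0 j0 k0 ijk; set P := fgl_add F (mps_var R p) _; set m := (_ + _)%MM.
have P1 : ordge 1 P by apply: (ordge_fgl_add hF); apply: ordge_var.
have mdegm : mdeg m = N by rewrite !mdegD !mdegMn !mdeg1; lia.
have r1 : ordge 1 (mps_var R r) by apply: ordge_var.
have h (l : 'I_2) : ordge 1 (if l == ord0 then P else mps_var R r) by case: ifP.
have P_low m' : (mdeg m' < N)%N -> S (P m').
  move=> lt; rewrite /P /fgl_add (mps_substE _ _ (ltnSn _)) => [|l]; last by case: ifP => _; apply: ordge_var.
  apply: subring_sum => // e _; apply: subringM => //.
    apply: F_low; apply: leq_trans lt; exact: bmdeg.
  rewrite big_ord_recl big_ord1 /= !mps_varE -!monomMn -monomD monomE; exact: subring_nat.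
have Pr (m' : 'X_{1..3}) e : (0 < m' r)%N -> (P ^+ e) m' = 0.
  move=> m'r; pose z (l : 'I_3) := if l == r then 0 else mps_var R l.
  have z1 l : ordge 1 (z l) by rewrite /z; case: ifP => // _; apply: ordge_var.
  have -> : P ^+ e = mps_subst z (P ^+ e).
    rewrite mps_substXn // mps_subst_fgl_add //; try apply: ordge_var.
    by rewrite !mps_subst_var // /z (negPf pr) (negPf qr).
  rewrite mps_subst_zeroing; case: ifPn => // /forallP/(_ r).
  by rewrite eqxx /= => /eqP E; rewrite E in m'r.
have mr : m r = k by rewrite !mnmDE !mulmnE !mnm1E (negPf pr) (negPf qr) eqxx; lia.
have m_sub : (m - U_(r) *+ k = U_(p) *+ i + U_(q) *+ j)%MM by rewrite /m addmK.
(* The inner sum [P] is free of x_r, so the whole power x_r^k comes from the second argument of the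
   outer sum. *)
have termE (e : 'X_{1..2}) : (\prod_(l < 2) (if l == ord0 then P else mps_var R r) ^+ e l) m =
    if e ord_max == k then (P ^+ e ord0) (U_(p) *+ i + U_(q) *+ j)%MM else 0.
  rewrite big_ord_recl big_ord1 /= (_ : lift ord0 ord0 = ord_max); last exact: val_inj.
  rewrite mulrC mps_varE -monomMn monom_coefM.
  case: eqP => [->|ne]; first by rewrite -m_sub /m lem_addl.
  case: ifP => // /mnm_lepP/(_ r); rewrite mr mulmnE mnm1E eqxx mul1n => le.
  by apply: Pr; rewrite mnmBE mr mulmnE mnm1E eqxx mul1n; lia.
have lead : (P ^+ (i + j)) (U_(p) *+ i + U_(q) *+ j)%MM = ('C(i + j, i))%:R.
  have : ordge (i + j).+1 (P ^+ (i + j) - (mps_var R p + mps_var R q) ^+ (i + j)).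
    apply: ordge_exprB => //; first by apply: ordgeD; apply: ordge_var.
    rewrite /P fgl_addE //; try exact: ordge_var.
    rewrite addrAC subrr add0r; apply: ordgeMr; apply: (@ordgeM _ _ 1 1); exact: ordge_var.
  move=> /(_ (U_(p) *+ i + U_(q) *+ j)%MM); rewrite !mdegD !mdegMn !mdeg1 !mul1n ltnSn.
  move=> /(_ isT) /eqP; rewrite mps_coefB subr_eq0 => /eqP->.
  rewrite addrC exprDn mps_coef_sum.
  have lti : (i < (i + j).+1)%N by lia.
  rewrite (bigD1 (Ordinal lti)) //= big1 ?addr0 => [|l /eqP ne].
    by rewrite mps_coefMn !mps_varE -!monomMn -monomD monomE addKn addmC eqxx.
  rewrite mps_coefMn !mps_varE -!monomMn -monomD monomE.
  case: eqP => [E|_]; last by rewrite mul0rn.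
  case: ne; apply: val_inj; have := congr1 (fun k : 'X_{1..3} => k p) E.
  by rewrite /= !mnmDE !mulmnE !mnm1E eqxx eq_sym (negPf pq); lia.
rewrite /fgl_add (mps_substE h _ (ltnSn _)) mdegm.
have lt : (mdeg (mnm2 (i + j) k) < N.+1)%N by rewrite mdeg_mnm2 ijk.
rewrite (bigD1 (BMultinom lt)) //= termE mnm2_0 mnm2_1 eqxx lead mulr_natr addrAC subrr add0r.
apply: subring_sum => // e ne; rewrite termE; case: eqP => [ek|_]; last by rewrite mulr0; apply: subring0.
(* In degree below N both factors are built from lower coefficients of F; degree N with second
   exponent k is the term already split off. *)
have [lte|gee] := ltnP (mdeg e) N.
  apply: subringM; [by []|exact: F_low|].
  apply: (@coef_in_exp _ _ S (i + j) P) => // [m' le|].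
    by apply: P_low; lia.
  by rewrite mdegD !mdegMn !mdeg1; lia.
case/negP: ne; rewrite bmeqP /=; apply/eqP; apply: mnm2P; rewrite ?mnm2_0 ?mnm2_1 //.
have := bmdeg e; move: gee; rewrite mdeg2 ek; lia.
Qed.

Lemma fgl_cocycle i j k : (0 < i)%N -> (0 < j)%N -> (0 < k)%N -> (i + j + k = N)%N ->
  S (F (mnm2 (i + j) k) *+ 'C(i + j, i) - F (mnm2 i (j + k)) *+ 'C(j + k, j)).
Proof.
move=> i0 j0 k0 ijk; pose p : 'I_3 := ord0; pose q : 'I_3 := inord 1; pose r : 'I_3 := ord_max.
have pq : p != q by rewrite -val_eqE /= inordK.
have pr : p != r by rewrite -val_eqE.
have qr : q != r by rewrite -val_eqE /= inordK.
have h1 := @assoc_coef_mod p q r i j k pq pr qr i0 j0 k0 ijk.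
have qp : q != p by rewrite eq_sym.
have rp : r != p by rewrite eq_sym.
have h2 := @assoc_coef_mod q r p j k i qr qp rp j0 k0 i0.
have jki : (j + k + i = N)%N by lia.
have := h2 jki.
have -> : (U_(q) *+ j + U_(r) *+ k + U_(p) *+ i = U_(p) *+ i + U_(q) *+ j + U_(r) *+ k)%MM.
  by rewrite addmC addmA.
have hp : ordge 1 (mps_var R p) by apply: ordge_var.
have hq : ordge 1 (mps_var R q) by apply: ordge_var.
have hr : ordge 1 (mps_var R r) by apply: ordge_var.
rewrite -(fgl_addC hF hp (ordge_fgl_add hF hq hr)) (fgl_addA hF hp hq hr).
rewrite (fgl_coef_sym hF (j + k)) => h3.
have := subringB hS h3 h1; set X := mps_coef _ _; set A := _ *+ _; set B := _ *+ _.
by have -> : X - A - (X - B) = B - A by ring.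
Qed.
End CocycleCoefficient.

Section LazardAtTwo.
Variables (L : idomainType) (F : mps 2 L).
Hypothesis hL : is_lazard F.
Let hF : is_fgl F := proj1 hL.

Definition lazard_gen N : L := F (mnm2 (gen_index N) (N - gen_index N)).

(** The ring Z[t_2, ..., t_(n+1)], with t_N = [lazard_gen N]: one generator for each degree up to n
    + 1, and the next is t_(n+2). *)
Fixpoint lazard_sub n : L -> Prop :=
  if n is n'.+1 then adjoin (lazard_sub n') (lazard_gen n'.+2) else @integers L.

Lemma lazard_sub_subring n : is_subring (lazard_sub n).
Proof. by elim: n => [|n IH]; [apply: integers_subring|apply: adjoin_subring]. Qed.
Hint Resolve lazard_sub_subring : core.

Lemma lazard_sub_mono m n x : (m <= n)%N -> lazard_sub m x -> lazard_sub n x.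
Proof.
move=> /subnK <-; elim: (n - m)%N => // k IH /IH; exact: adjoin_incl.
Qed.

(** Induction on the degree: the coefficients of total degree n + 2 form a cocycle modulo those of
    lower degree, so the single generator t_(n+2) gives them all up to odd factors. *)
Lemma lazard_coef_loc2 n m : (mdeg m <= n.+1)%N -> loc2 (lazard_sub n) (F m).
Proof.
elim: n m => [|n IH] m le.
  by rewrite fgl_coef_mdeg1 //; apply: loc2_incl; exists (mdeg m); rewrite pmulrn.
have [le'|gt] := leqP (mdeg m) n.+1.
  by apply: loc2_mono (IH _ le') => y; apply: adjoin_incl.
have hT := loc2_subring (lazard_sub_subring n.+1).
have [low|high] := boolP ((m ord0 == 0)%N || (m ord_max == 0)%N).
  by rewrite fgl_coef_low // -natrD; apply: subring_nat.
have mN : mdeg m = n.+2 by apply/eqP; rewrite eqn_leq le gt.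
move: high; rewrite negb_or -!lt0n => /andP[m0 m1].
rewrite (mnm2_eta m); rewrite mdeg2 in mN.
have -> : m ord_max = (n.+2 - m ord0)%N by lia.
have lt : (0 < m ord0 < n.+2)%N by lia.
move: (m ord0) lt => i; pose b i := F (mnm2 i (n.+2 - i)); rewrite -/(b i).
apply: (cocycle_generator (S := loc2 (lazard_sub n)) hT) => //.
- by move=> x; apply: loc2_mono => y; apply: adjoin_incl.
- exact: loc2_odd.
- by move=> {}i /andP[i0 iN]; rewrite /b fgl_coef_sym // subKn // ltnW.
- move=> {}i j k i0 j0 k0 ijk; rewrite /b.
  have -> : (n.+2 - (i + j) = k)%N by lia.
  have -> : (n.+2 - i = j + k)%N by lia.
  by apply: (fgl_cocycle (N := n.+2)) => //; apply: loc2_subring.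
- exact: (loc2_incl (adjoin_gen (lazard_gen n.+2) (lazard_sub_subring n))).
Qed.

(** [sigma] classifies the conjugate of F over L[X] by x + X x^N, with the indeterminate as
    parameter. *)
Lemma lazard_shift N : (2 <= N)%N -> exists sigma : {rmorphism L -> {poly L}},
  (forall m, (mdeg m < N)%N -> sigma (F m) = (F m)%:P) /\
  sigma (lazard_gen N) = (lazard_gen N)%:P + 'X *+ 'C(N, gen_index N).
Proof.
move=> N2; have [_ univ] := hL.
pose F' := mps_map (@polyC L) F.
have hF' : is_fgl F' by apply: (mps_map_fgl _ hF).
have [sigma [sigmaF _]] := univ _ _ (fgl_conjP hF' 'X N2).
exists sigma; split => [m lt|].
  rewrite -[LHS]/(mps_map sigma F m) sigmaF.
  exact: (fgl_conj_coef_lt hF' 'X N2 lt).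
rewrite -[LHS]/(mps_map sigma F (mnm2 _ _)) sigmaF.
have lt := gen_index_lt N2.
rewrite (fgl_conj_coef_eq hF' 'X N2) ?gen_index_gt0 //; lia.
Qed.

(** The shift [sigma] fixes the coefficients of [p], so p(t) = 0 becomes p(t + c X) = 0 in L[X],
    with c a nonzero integer; composition with a polynomial of degree 1 over a domain kills only
    0. *)
Lemma lazard_gen_transcendental n (p : {poly L}) :
  (forall k, lazard_sub n p`_k) -> p.[lazard_gen n.+2] = 0 -> p = 0.
Proof.
move=> hp p0; have N2 : (2 <= n.+2)%N by [].
have [sigma [sigma_low sigma_t]] := lazard_shift N2.
set t := lazard_gen n.+2 in p0 sigma_t; set c := 'C(_, _) in sigma_t.
have fixed k x : (k <= n)%N -> lazard_sub k x -> sigma x = x%:P.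
  elim: k x => [|k IH] x le /=; first by case=> z ->; rewrite !rmorph_int.
  case=> q hq ->; have -> : sigma (lazard_gen k.+2) = (lazard_gen k.+2)%:P -> 
      sigma q.[lazard_gen k.+2] = (q.[lazard_gen k.+2])%:P.
    move=> E; rewrite -horner_map /= E -horner_map /=; congr (_.[_]).
    by apply/polyP => l; rewrite !coef_map /= IH // ltnW.
  by [].
  rewrite /lazard_gen sigma_low // mdeg_mnm2 subnKC ?(ltnW (gen_index_lt _)) //.
have c0 : c%:R != 0 :> L.
  apply: (lazard_natr_neq0 hL); rewrite -lt0n bin_gt0; exact/ltnW/gen_index_lt.
have size_q : size (t%:P + 'X *+ c : {poly L}) = 2.
  have -> : 'X *+ c = c%:R *: 'X :> {poly L} by rewrite scaler_nat.
  rewrite addrC size_polyDl size_scale ?size_polyX //.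
  by apply: leq_ltn_trans (size_polyC_leq1 _) _.
apply/eqP; rewrite -(comp_poly2_eq0 p size_q).
have := congr1 sigma p0; rewrite -horner_map /= sigma_t rmorph0 => <-.
rewrite /comp_poly; apply/eqP; congr (_.[_]).
by apply/polyP => l; rewrite !coef_map /= (fixed n).
Qed.

(** By transcendence the equation holds between polynomials in the last generator. In Z[t_2] it says
    that X p = 2 r, so each coefficient of [p] is twice the next one of [r]; with further generators
    it holds coefficientwise and induction applies. *)
Lemma lazard_sub_regular n b c : (0 < n)%N -> lazard_sub n b -> lazard_sub n c ->
  lazard_gen 2 * b = 2%:R * c -> exists2 d, lazard_sub n d & b = 2%:R * d.
Proof.
elim: n b c => [//|[_|n IH]] b c _ /=.
  case=> p hp -> [r hr ->]; set t := lazard_gen 2 => E.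
  have : 'X * p - 2%:R *: r = 0.
    apply: (@lazard_gen_transcendental 0) => [k|].
      rewrite /= coefB coefZ coefXM; apply: subringB; [exact: integers_subring| |].
        by case: eqP => _ //; apply: subring0; apply: integers_subring.
      by apply: subringM => //; [apply: integers_subring|apply: subring_nat; apply: integers_subring].
    by rewrite hornerD hornerN hornerZ hornerM hornerX E subrr.
  move/polyP=> H; have pE k : p`_k = 2%:R * r`_k.+1.
    by have := H k.+1; rewrite coefB coefZ coefXM coef0 => /eqP; rewrite subr_eq0 => /eqP.
  pose d := \poly_(k < size r) r`_k.+1.
  exists d.[t].
    exists d => // k; rewrite coef_poly; case: ifP => // _; apply: subring0; exact: integers_subring.
  rewrite -hornerZ; congr (_.[_]); apply/polyP => k; rewrite pE coefZ coef_poly.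
  by case: ltnP => // le; rewrite nth_default // ltnW.
have hS := lazard_sub_subring n.+1; have hS' := hS; rewrite /= in hS'.
case=> p hp -> [r hr ->]; set t := lazard_gen n.+3 => E.
have sub2 : lazard_sub n.+1 (lazard_gen 2).
  apply: (@lazard_sub_mono 1) => //; apply: adjoin_gen; exact: integers_subring.
have : lazard_gen 2 *: p - 2%:R *: r = 0.
  apply: (@lazard_gen_transcendental n.+1) => [k|].
    rewrite coefB !coefZ; apply: (subringB hS).
      exact: (subringM hS sub2 (hp k)).
    exact: (subringM hS (subring_nat 2 hS) (hr k)).
  by rewrite hornerD hornerN !hornerZ E subrr.
move/polyP=> H.
have pE k : exists2 d, lazard_sub n.+1 d & p`_k = 2%:R * d.
  apply: (IH _ r`_k (ltn0Sn n) (hp k) (hr k)).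
  by have := H k; rewrite coefB !coefZ coef0 => /eqP; rewrite subr_eq0 => /eqP.
pose dk k := s2val (cid2 (pE k)).
pose d := \poly_(k < size p) dk k.
exists d.[t].
  exists d => // k; rewrite coef_poly; case: ifP => _; last exact: subring0.
  by rewrite /dk; case: cid2.
rewrite -hornerZ; congr (_.[_]); apply/polyP => k; rewrite coefZ coef_poly.
case: ltnP => [_|le]; last by rewrite nth_default // mulr0.
by rewrite /dk; case: cid2.
Qed.

Lemma lazard_two_regular b c : F (mnm2 1 1) * b = 2%:R * c -> exists d, b = 2%:R * d.
Proof.
have all_loc x : exists n, loc2 (lazard_sub n.+1) x.
  apply: (lazard_generated (F := F) (S := fun x => exists n, loc2 (lazard_sub n.+1) x)) => //; last first.
    by move=> m; exists (mdeg m); apply: lazard_coef_loc2; rewrite ltnW.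
  have join a a' y z : loc2 (lazard_sub a.+1) y -> loc2 (lazard_sub a'.+1) z ->
      loc2 (lazard_sub (maxn a a').+1) y /\ loc2 (lazard_sub (maxn a a').+1) z.
    move=> hx hy; split; [apply: loc2_mono hx|apply: loc2_mono hy] => c';
      by apply: lazard_sub_mono; rewrite ltnS ?leq_maxl ?leq_maxr.
  have hT n := loc2_subring (lazard_sub_subring n.+1).
  split; first by exists 0%N; apply: subring1.
    move=> y z [n hy] [m hz]; have [hy' hz'] := join _ _ _ _ hy hz.
    by exists (maxn n m); apply: subringB.
  move=> y z [n hy] [m hz]; have [hy' hz'] := join _ _ _ _ hy hz.
  by exists (maxn n m); apply: subringM.
move=> E; have [n1 [k ok hb]] := all_loc b; have [n2 [l ol hc]] := all_loc c.
pose n := maxn n1 n2.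
have {}hb : lazard_sub n.+1 ((l * k)%:R * b).
  rewrite natrM -mulrA; apply: subringM => //; first exact: subring_nat.
  by apply: lazard_sub_mono hb; rewrite ltnS leq_maxl.
have {}hc : lazard_sub n.+1 ((l * k)%:R * c).
  rewrite mulnC natrM -mulrA; apply: subringM => //; first exact: subring_nat.
  by apply: lazard_sub_mono hc; rewrite ltnS leq_maxr.
have t2 : lazard_gen 2 = F (mnm2 1 1) by [].
have [|d _ hd] := lazard_sub_regular (ltn0Sn n) hb hc; first by rewrite t2 mulrCA E mulrCA.
have olk : odd (l * k) by rewrite oddM ol.
(* The odd number l k is 1 + 2 h and l k b = 2 d, so b = 2 (d - h b). *)
exists (d - (l * k)./2%:R * b).
have bE : b = (l * k)%:R * b - 2%:R * ((l * k)./2%:R * b).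
  have -> : (l * k)%:R = 1 + (l * k)./2%:R * 2%:R :> L.
    by rewrite -{1}(odd_double_half (l * k)) olk -muln2 natrD natrM.
  set h := _./2%:R; ring.
by rewrite {1}bE hd mulrBr.
Qed.

End LazardAtTwo.

(** * Triangular formal bases *)

Lemma eq_sum_support (V : nmodType) (I : eqType) (s t : seq I) (G : I -> V) :
  uniq s -> uniq t -> (forall i, i \notin s -> G i = 0) ->
  (forall i, i \notin t -> G i = 0) -> \sum_(i <- s) G i = \sum_(i <- t) G i.
Proof.
move=> us ut Gs Gt.
have restrict (r r' : seq I) : (forall i, i \notin r' -> G i = 0) ->
    \sum_(i <- r) G i = \sum_(i <- [seq i <- r | i \in r']) G i.
  move=> G0; rewrite (bigID (mem r')) /= [X in _ + X]big1 ?addr0 ?big_filter //.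
rewrite (restrict s t Gt) (restrict t s Gs).
apply: perm_big; apply: uniq_perm.
- exact: filter_uniq.
- exact: filter_uniq.
by move=> i; rewrite !mem_filter andbC.
Qed.

Section Triangular.
Variables (n : nat) (L : idomainType) (Gamma : mps n L -> Prop) (I : eqType).
Variables (b : I -> mps n L) (B : I -> {fraction mps n L}).
Variables (mu : I -> 'X_{1..n}) (d : I -> L).
Hypothesis bB : forall i, tofrac (b i) = B i.
Hypothesis Gamma_b : forall i, Gamma (b i).
Hypothesis Gamma_sub : forall f g c, Gamma f -> Gamma g -> Gamma (f - c *: g).
Hypothesis mu_inj : injective mu.
Hypothesis d_neq0 : forall i, d i != 0.
Hypothesis b_low : forall i (m : 'X_{1..n}), (m < mu i)%O -> b i m = 0.
Hypothesis b_lead : forall i, b i (mu i) = d i.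
Hypothesis Gamma_lead : forall h (m : 'X_{1..n}), Gamma h -> (forall k : 'X_{1..n}, (k < m)%O -> h k = 0) ->
  h m != 0 -> exists2 i, mu i = m & exists x, h m = x * d i.

(** The partial inverse of [mu]; it lists the finitely many indices with leading monomial at most
    [m], the only ones that can contribute to the coefficient at [m]. *)
Let index (k : 'X_{1..n}) : option I := 
  if pselect (exists i, mu i = k) is left ex then Some (projT1 (cid ex)) else None.

Let S (m : 'X_{1..n}) : seq I := pmap index
  [seq k <- [seq (val k : 'X_{1..n}) | k <- enum {: 'X_{1..n < (mdeg m).+1}}] | (k <= m)%O].

Let mem_S m i : (i \in S m) = (mu i <= m)%O.
Proof.
have indexE k : index k = Some i <-> k = mu i.
  rewrite /index; case: pselect => [ex|no].
    case: cid => j /= jk; split=> [[<-]//|km].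
    by congr Some; apply: mu_inj; rewrite jk.
  by split=> // E; case: no; exists i.
rewrite mem_pmap; apply/mapP/idP => [[k]|le].
  by rewrite mem_filter => /andP[le _] /esym/indexE <-.
exists (mu i); last by apply/esym/indexE.
rewrite mem_filter le /=; have lt : (mdeg (mu i) < (mdeg m).+1)%N.
  by rewrite ltnS; apply: lemc_mdeg.
by apply/mapP; exists (BMultinom lt) => //; rewrite mem_enum.
Qed.

Let uniq_S m : uniq (S m).
Proof.
apply: (@pmap_uniq _ _ index mu) => [k|].
  by rewrite /index; case: pselect => //= ex; case: cid.
by rewrite filter_uniq // map_inj_uniq ?enum_uniq //; apply: val_inj.
Qed.

Let b_supp m i : i \notin S m -> b i m = 0.
Proof. by rewrite mem_S -ltNge => /b_low. Qed.

Let lt_wf : well_founded (fun i j => (mu i < mu j)%O).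
Proof.
move=> i; move: {2}(mu i) (erefl (mu i)) => m.
move: m i; apply: ltmwf => m IH i im; constructor=> j lt.
by apply: (IH (mu j)) => //; rewrite -im.
Qed.

Let quotient (x y : L) : L :=
  if pselect (exists z, y = z * x) is left ex then projT1 (cid ex) else 0.

Let quotientK x y : (exists z, y = z * x) -> quotient x y * x = y.
Proof. by move=> ex; rewrite /quotient; case: pselect => // ex'; case: cid. Qed.

Section Expansion.
Variable f : mps n L.

(** The coefficient is the one at [mu i] left over by all smaller indices, divided by [d i]. As
    [S (mu i)] contains [i] itself, the comparison guards the recursive call and sends that term to
    0. *)
Let step i (rec : forall j, (mu j < mu i)%O -> L) : L :=
  quotient (d i) ((f - \sum_(j <- S (mu i))
    (if pselect (mu j < mu i)%O is left lt then rec j lt else 0) *: b j) (mu i)).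

Let c : I -> L := Fix lt_wf (fun _ => L) step.

Let cE i : c i = quotient (d i)
  ((f - \sum_(j <- S (mu i) | (mu j < mu i)%O) c j *: b j) (mu i)).
Proof.
rewrite /c Fix_eq => [|j g h gh].
  rewrite /step [in RHS]big_mkcond /=; congr (quotient _ (mps_coef (f - _) _)).
  by apply: eq_bigr => j _; case: pselect => [->|/negP/negPf->] //; rewrite scale0r.
congr step; apply: functional_extensionality_dep => k.
by apply: functional_extensionality_dep => lt; apply: gh.
Qed.

Lemma triangular_expansion : Gamma f -> is_formal_sum (fun i => c i *: b i) f.
Proof.
move=> Gf m; exists (S m); split=> // [i|].
  by move=> /b_supp E; rewrite mps_coefZ E mulr0.
move: m; apply: ltmwf => m IH.
(* A finite partial remainder: it stays in Gamma and by induction vanishes below [m], so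
   [Gamma_lead] makes its coefficient at [m] a multiple of some [d i], or zero. *)
pose h := f - \sum_(j <- [seq j <- S m | (mu j < m)%O]) c j *: b j.
have Gh : Gamma h.
  rewrite /h; elim: [seq _ <- _ | _] => [|j s IHs]; first by rewrite big_nil subr0.
  by rewrite big_cons opprD addrCA addrC; apply: Gamma_sub.
have h_low k : (k < m)%O -> h k = 0.
  move=> km; rewrite mps_coefB (IH k km) mps_coef_sum.
  apply/eqP; rewrite subr_eq0; apply/eqP; apply: eq_sum_support => //.
  - exact: filter_uniq.
  - by move=> i /b_supp E; rewrite mps_coefZ E mulr0.
  move=> i; rewrite mem_filter mem_S negb_and => out.
  rewrite mps_coefZ b_low ?mulr0 //; apply: lt_le_trans km _.
  by case/orP: out; rewrite -?leNgt // -ltNge => /ltW.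
have fE : f m = h m + \sum_(j <- S m | (mu j < m)%O) c j * b j m.
  by rewrite /h mps_coefB mps_coef_sum big_filter subrK.
have [[i im]|no] := pselect (exists i, mu i = m).
  have ci : c i * d i = h m.
    rewrite cE im /h big_filter; apply: quotientK.
    rewrite -big_filter -/h; have [->|hm] := eqVneq (h m) 0; first by exists 0; rewrite mul0r.
    have [j jm ex] := Gamma_lead Gh h_low hm.
    by have -> : i = j by apply: mu_inj; rewrite im.
  rewrite fE -ci -(b_lead i) im (bigD1_seq i) //=; last by rewrite mem_S im.
  congr (_ + _); rewrite big_seq_cond [RHS]big_seq_cond; apply: eq_bigl => j.
  rewrite mem_S le_eqVlt -im (inj_eq mu_inj).
  by case: eqP => [->|_] /=; rewrite ?ltxx ?andbF //= andbT andbb.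
have h0 : h m = 0.
  apply/eqP; apply: contrapT => /negP hm; have [i im _] := Gamma_lead Gh h_low hm.
  by apply: no; exists i.
rewrite fE h0 add0r big_seq_cond [RHS]big_seq_cond; apply: eq_bigl => j.
rewrite mem_S andbT; case: ltgtP => //= E; by case: no; exists j.
Qed.

End Expansion.

(** At [mu i] only indices with smaller or equal leading monomial contribute; the smaller ones agree
    by induction, and [d i] is cancelled. *)
Lemma triangular_unique f c c' : is_formal_sum (fun i => c i *: b i) f ->
  is_formal_sum (fun i => c' i *: b i) f -> c =1 c'.
Proof.
have sumE e : is_formal_sum (fun i => e i *: b i) f -> forall m,
    f m = \sum_(i <- S m) e i * b i m.
  move=> he m; have [s [us supp ->]] := he m.
  by apply: eq_sum_support => // i /b_supp E; rewrite mps_coefZ E mulr0.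
move=> /sumE hc /sumE hc' i; elim/(well_founded_ind lt_wf): i => i IH.
have := etrans (esym (hc (mu i))) (hc' (mu i)).
rewrite (bigD1_seq i) ?mem_S //= [RHS](bigD1_seq i) ?mem_S //=.
rewrite b_lead [X in _ + X = _]big_seq_cond [X in _ = _ + X]big_seq_cond.
rewrite (eq_bigr (fun j => c' j * b j (mu i))) => [/addIr/(mulIf (d_neq0 i))//|j].
rewrite mem_S le_eqVlt (inj_eq mu_inj) => /andP[/orP[/eqP->|lt _]]; first by rewrite eqxx.
by rewrite IH.
Qed.

Lemma triangular_formal_basis : is_formal_basis Gamma B.
Proof.
exists b; split=> [i|f Gf]; first by split.
exists (Fix lt_wf (fun _ => L) (fun i rec => quotient (d i) ((f - \sum_(j <- S (mu i))
    (if pselect (mu j < mu i)%O is left lt then rec j lt else 0) *: b j) (mu i)))).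
split=> [|c' hc']; first exact: triangular_expansion.
apply: functional_extensionality_dep; apply: triangular_unique hc'.
exact: triangular_expansion.
Qed.
End Triangular.

(** * Leading monomials and difference products *)

Section Lead.
Variables (n : nat) (R : comNzRingType).
Implicit Types (f g : mps n R) (m : 'X_{1..n}).

(** [c] may be zero, so that summands whose least monomial is larger than [m] can be added at [m] as
    well. *)
Definition lead f m c := (forall k : 'X_{1..n}, (k < m)%O -> f k = 0) /\ f m = c.

Lemma leadM f g m m' c c' : lead f m c -> lead g m' c' -> lead (f * g) (m + m')%MM (c * c').
Proof.
move=> [lf cf] [lg cg]; split.
  move=> k lt; rewrite mps_coefM big1 // => -[k1 k2] /= /eqP def_k.
  have [lt1|ge1] := ltP (k1 : 'X_{1..n}) m; first by rewrite lf ?mul0r.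
  have [lt2|ge2] := ltP (k2 : 'X_{1..n}) m'; first by rewrite lg ?mulr0.
  by have := lem_add ge1 ge2; rewrite -def_k leNgt lt.
have lt1 : (mdeg m < (mdeg (m + m')).+1)%N by rewrite mdegD ltnS leq_addr.
have lt2 : (mdeg m' < (mdeg (m + m')).+1)%N by rewrite mdegD ltnS leq_addl.
rewrite mps_coefM (bigD1 (BMultinom lt1, BMultinom lt2)) //= cf cg big1 ?addr0 //.
move=> -[k1 k2] /= /andP[/eqP def_k ne].
have [lt|ge1] := ltP (k1 : 'X_{1..n}) m; first by rewrite lf ?mul0r.
have [lt|ge2] := ltP (k2 : 'X_{1..n}) m'; first by rewrite lg ?mulr0.
case/negP: ne; have eq1 : (k1 : 'X_{1..n}) = m.
  apply/eqP; move: ge1; rewrite le_eqVlt => /orP[|gt1]; first by rewrite eq_sym.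
  by have := ltmc_le_add gt1 ge2; rewrite -def_k ltxx.
have eq2 : (k2 : 'X_{1..n}) = m'.
  by apply: (@addmI _ k1); rewrite -def_k eq1.
by rewrite xpair_eqE !bmeqP /= eq1 eq2 !eqxx.
Qed.

Lemma lead1 : lead 1 0%MM 1.
Proof.
split; last by rewrite mps_coef1 eqxx.
by move=> k; rewrite ltNge le0m.
Qed.

Lemma lead_prod (I : Type) (r : seq I) (P : pred I) (f : I -> mps n R) (m : I -> 'X_{1..n}) c :
  (forall i, P i -> lead (f i) (m i) (c i)) ->
  lead (\prod_(i <- r | P i) f i) (\sum_(i <- r | P i) m i)%MM (\prod_(i <- r | P i) c i).
Proof.
move=> h; elim: r => [|i r IH]; first by rewrite !big_nil; apply: lead1.
by rewrite !big_cons; case: ifP => // Pi; apply: leadM => //; apply: h.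
Qed.

Lemma leadX f m c k : lead f m c -> lead (f ^+ k) (m *+ k)%MM (c ^+ k).
Proof.
move=> h; elim: k => [|k IH]; first exact: lead1.
by rewrite !exprS mulmS; apply: leadM.
Qed.

Lemma lead_lt f m c m' : lead f m c -> (m' < m)%O -> lead f m' 0.
Proof. by case=> low _ lt; split=> [k lt'|]; apply: low => //; apply: lt_trans lt. Qed.

Lemma lead_uniq f m c c' : lead f m c -> lead f m c' -> c = c'.
Proof. by case=> _ <- [_ <-]. Qed.

Lemma lead_sum (I : Type) (r : seq I) (P : pred I) (f : I -> mps n R) m c :
  (forall i, P i -> lead (f i) m (c i)) ->
  lead (\sum_(i <- r | P i) f i) m (\sum_(i <- r | P i) c i).
Proof.
move=> h; split=> [k lt|]; rewrite mps_coef_sum.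
  by apply: big1 => i Pi; case: (h i Pi) => low _; apply: low.
by apply: eq_bigr => i Pi; case: (h i Pi).
Qed.

Lemma leadZsign f m c (e : bool) : lead f m c -> lead ((-1) ^+ e * f) m ((-1) ^+ e * c).
Proof.
case: e; rewrite ?expr0 ?mul1r // expr1 !mulN1r => -[l <-].
by split=> [k lt|]; rewrite mps_coefN // l ?oppr0.
Qed.

(** In equal degree the first differing exponent decides, so later variables are smaller; this is
    why partitions appear reversed. *)
Lemma ltmc_mnm1 (c d : 'I_n) : (U_(c)%MM < U_(d)%MM :> 'X_{1..n})%O = (d < c)%N.
Proof.
apply/ltmcP/idP => [|[i eq lt]|lt]; first by rewrite !mdeg1.
  move: lt; rewrite !mnm1E; case: (d =P i) => [di|_]; last by rewrite ltn0.
  case: (c =P i) => // ci _; rewrite ltnNge leq_eqVlt; apply/negP => /orP[/eqP/val_inj cd|lt].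
    by apply: ci; rewrite cd.
  have := eq c; rewrite -di !mnm1E eqxx => /(_ lt).
  by case: eqP => // dc; rewrite dc ltnn in lt.
exists d => [j lt'|]; rewrite !mnm1E.
  have -> : (d == j) = false by rewrite -val_eqE /= gtn_eqF.
  by have -> : (c == j) = false by rewrite -val_eqE /= gtn_eqF // (ltn_trans lt').
by rewrite eqxx -val_eqE /= gtn_eqF.
Qed.

Lemma lead_linear f (c : 'I_n) a : f 0%MM = 0 ->
  (forall c' : 'I_n, (c < c')%N -> f U_(c')%MM = 0) -> f U_(c)%MM = a -> lead f U_(c)%MM a.
Proof.
move=> f0 low fc; split=> // k lt; have := lemc_mdeg (ltW lt); rewrite mdeg1.
rewrite leq_eqVlt => /orP[/mdeg1P[c' /eqP kc']|].
  by rewrite kc'; apply: low; rewrite -ltmc_mnm1 -kc'.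
by rewrite ltnS leqn0 mdeg_eq0 => /eqP->.
Qed.

Lemma lead_var i : lead (mps_var R i) U_(i)%MM 1.
Proof.
apply: lead_linear; rewrite mps_varE ?monomE ?mnm1_eq0 ?eqxx //.
by move=> c lt; rewrite monomE eq_mnm1 -val_eqE /= ltn_eqF.
Qed.

Lemma lead_varB i j : i != j ->
  lead (mps_var R i - mps_var R j) U_(if (i < j)%N then j else i)%MM (if (i < j)%N then -1 else 1).
Proof.
move=> ne; apply: lead_linear; rewrite ?mps_coefB !mps_varE ?monomE ?mnm1_eq0 ?subrr //.
  move=> c lt; rewrite mps_coefB !monomE !eq_mnm1.
  rewrite -!val_eqE /= !ltn_eqF ?subrr //; move: lt; case: ifP; lia.
rewrite !eq_mnm1; case: ltnP => h; first by rewrite eqxx (negPf ne) sub0r.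
by rewrite eqxx [j == i]eq_sym (negPf ne) subr0.
Qed.
End Lead.

Section LeadFgl.
Variables (n : nat) (R : comNzRingType) (F : mps 2 R).
Hypothesis hF : is_fgl F.

(** The coefficient 2 on the diagonal is the source of the powers of 2 in Q. *)
Lemma lead_fgl_add (i j : 'I_n) :
  lead (fgl_add F (mps_var R i) (mps_var R j)) U_(if (i < j)%N then j else i)%MM
    (if i == j then 2%:R else 1).
Proof.
have coef1 (m : 'X_{1..n}) : (mdeg m <= 1)%N -> 
    fgl_add F (mps_var R i) (mps_var R j) m = (U_(i)%MM == m)%:R + (U_(j)%MM == m)%:R.
  move=> le; rewrite fgl_addE // !mps_coefD !mps_varE !monomE.
  rewrite [X in _ + X](_ : _ = 0) ?addr0 //.
  have : ordge 2 (monom R U_(i)%MM * monom R U_(j)%MM * fgl_add (fgl_cross F) (monom R U_(i)%MM) (monom R U_(j)%MM)).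
    apply: ordgeMr; apply: (@ordgeM _ _ 1 1); rewrite -mps_varE; exact: ordge_var.
  by apply.
apply: lead_linear; first by rewrite coef1 ?mdeg0 // !mnm1_eq0 addr0.
  move=> c lt; rewrite coef1 ?mdeg1 // !eq_mnm1.
  by rewrite -!val_eqE /= !ltn_eqF ?addr0 //; move: lt; case: ifP; lia.
rewrite coef1 ?mdeg1 // !eq_mnm1; have [->|ne] := eqVneq i j; first by rewrite ltnn eqxx.
by case: ifP => _; rewrite eqxx ?(negPf ne) ?[j == i]eq_sym ?(negPf ne) ?add0r ?addr0.
Qed.

Lemma lead_sub_ratio (a b : mps n R) : ordge 1 a -> ordge 1 b -> lead (sub_ratio F a b) 0%MM 1.
Proof.
move=> ha hb; split; first by move=> k; rewrite ltNge le0m.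
rewrite /sub_ratio mps_coefD mps_coef1 eqxx.
by rewrite (@ordgeMr _ _ 1 b) ?addr0 // mdeg0.
Qed.
End LeadFgl.

Lemma eq_mps_subst_supp n k (R : comNzRingType) (s s' : 'I_n -> mps k R) (f : mps n R) :
  (forall i, ordge 1 (s i)) -> (forall i, ordge 1 (s' i)) ->
  (forall (e : 'X_{1..n}) i, f e != 0 -> e i != 0%N -> s i = s' i) ->
  mps_subst s f = mps_subst s' f.
Proof.
move=> h h' eqs; apply: mpsP => m; rewrite !(mps_substE _ _ (ltnSn _)) //.
apply: eq_bigr => e _; have [->|fe] := eqVneq (f e) 0; first by rewrite !mul0r.
congr (_ * mps_coef _ _); apply: eq_bigr => i _.
have [->|ei] := eqVneq ((e : 'X_{1..n}) i) 0%N; first by rewrite !expr0.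
by rewrite (eqs _ _ fe ei).
Qed.

Section Identify.
Variables (n : nat) (R : comNzRingType).
Local Notation x := (mps_var R).

Definition identify (i j : 'I_n) (k : 'I_n) : mps n R := if k == i then x j else x k.

Lemma ordge_identify i j k : ordge 1 (identify i j k).
Proof. by rewrite /identify; case: ifP => _; apply: ordge_var. Qed.

(** Division by x_i - x_j, possible because the substitution x_i := x_j kills [f]. *)
Lemma identify_ker i j f : i != j -> mps_subst (identify i j) f = 0 ->
  exists g, f = (x i - x j) * g.
Proof.
move=> ij f0; have hi := ordge_identify i j.
(* The expansion of f / (x_i - x_j) as the sum of x_i^(-l-1) x_j^l f, keeping the monomials with
   nonnegative exponents. *)
pose g : mps n R := Mps (fun m => \sum_(l < (m j).+1) f (m + U_(i) *+ l.+1 - U_(j) *+ l)%MM).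
exists g; apply/eqP; rewrite -subr_eq0; set f' := f - _; apply/eqP.
have ji : (j == i) = false by rewrite eq_sym (negPf ij).
(* The remainder has no monomial containing x_i, so the identification fixes it; it also kills
   it. *)
suff <- : mps_subst (identify i j) f' = f'.
  rewrite mps_substB // f0 mps_substM // mps_substB // !mps_subst_var //.
  by rewrite /identify eqxx ji subrr mul0r subr0.
rewrite -[RHS]mps_subst_id; apply: eq_mps_subst_supp => //.
move=> m k f'm mk; rewrite /identify; case: eqP => // ki; case/eqP: f'm.
rewrite {k}ki in mk; rewrite /f' mps_coefB mulrBl mps_coefB !mps_varE !monom_coefM.
have le_i : (U_(i) <= m)%MM by rewrite lep1mP.
rewrite le_i lep1mP /g /= mnmBE mnm1E (negPf ij) subn0 big_ord_recl.
have -> : (m - U_(i) + U_(i) *+ 1 - U_(j) *+ 0 = m)%MM.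
  by rewrite mulm1n mulm0n subm0 submK.
have -> : \sum_(l < m j) f (m - U_(i) + U_(i) *+ (bump 0 l).+1 - U_(j) *+ (bump 0 l))%MM =
          if m j != 0%N then \sum_(l < ((m - U_(j))%MM j).+1) f (m - U_(j) + U_(i) *+ l.+1 - U_(j) *+ l)%MM else 0.
  case: ifPn => [mj|/negbNE/eqP->]; last by rewrite big_ord0.
  rewrite mnmBE mnm1E eqxx subn1 prednK ?lt0n //.
  apply: eq_bigr => l _; congr (f _); apply/mnmP => k; have lt := ltn_ord l.
  rewrite !(mnmBE, mnmDE, mulmnE, mnm1E) /bump /=.
  have [<-|ki] := eqVneq i k; first by rewrite ji /=; lia.
  by have [<-|kj] := eqVneq j k; lia.
by rewrite addrK subrr.
Qed.

Lemma mps_varB_neq0 (i j : 'I_n) : i != j -> x i - x j != 0.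
Proof.
move=> ij; apply/eqP => /(congr1 (fun f : mps n R => f U_(i)%MM)).
rewrite mps_coefB !mps_varE !monomE eqxx eq_mnm1 [j == i]eq_sym (negPf ij) subr0 mps_coef0.
by move/eqP; rewrite oner_eq0.
Qed.
End Identify.

Section DifferenceProducts.
Variables (n : nat) (L : idomainType).
Local Notation x := (mps_var L).

Definition diff_prod (s : seq ('I_n * 'I_n)) : mps n L := \prod_(p <- s) (x p.1 - x p.2).

Lemma identify_varB (p : 'I_n * 'I_n) : mps_subst (identify L p.1 p.2) (x p.1 - x p.2) = 0.
Proof.
have hi := @ordge_identify n L p.1 p.2.
by rewrite mps_substB // !mps_subst_var // /identify eqxx if_same subrr.
Qed.

(** Each difference divides q H while q stays nonzero when the two variables are identified, so it
    divides H; the domain property then lets the next difference be treated. *)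
Lemma diff_dvd_cancel (s : seq ('I_n * 'I_n)) (c q H : mps n L) :
  (forall p, p \in s -> p.1 != p.2) ->
  (forall p, p \in s -> mps_subst (identify L p.1 p.2) q != 0) ->
  diff_prod s * c = q * H -> exists H', H = diff_prod s * H'.
Proof.
rewrite /diff_prod; elim: s c H => [|p s IH] c H ne q0 E; first by exists H; rewrite big_nil mul1r.
have p_s : p \in p :: s by rewrite mem_head.
have hi := @ordge_identify n L p.1 p.2.
have := congr1 (mps_subst (identify L p.1 p.2)) E.
rewrite big_cons !mps_substM // identify_varB !mul0r.
move=> /esym/eqP; rewrite mulf_eq0 (negPf (q0 _ p_s)) /= => /eqP /(identify_ker (ne _ p_s))[H1 H1E].
have nz : x p.1 - x p.2 != 0 by apply: mps_varB_neq0; apply: ne.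
have ne' k : k \in s -> k.1 != k.2 by move=> ks; apply: ne; rewrite inE ks orbT.
have q0' k : k \in s -> mps_subst (identify L k.1 k.2) q != 0.
  by move=> ks; apply: q0; rewrite inE ks orbT.
have E' : \prod_(p <- s) (x p.1 - x p.2) * c = q * H1.
  by apply: (mulfI nz); rewrite mulrA; move: E; rewrite big_cons H1E mulrCA.
by have [H2 H2E] := IH c H1 ne' q0' E'; exists H2; rewrite H1E H2E mulrA.
Qed.

(** Ordering each pair makes distinct pairs give differences that remain nonzero under the
    identification belonging to another pair. *)
Lemma diff_dvd_vanish (s : seq ('I_n * 'I_n)) (A : mps n L) :
  uniq s -> (forall p, p \in s -> (p.1 < p.2)%N) ->
  (forall p, p \in s -> mps_subst (identify L p.1 p.2) A = 0) ->
  exists B, A = diff_prod s * B.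
Proof.
rewrite /diff_prod; elim: s => [|p s IH] /=; first by exists A; rewrite big_nil mul1r.
move=> /andP[pNs us] lt A0.
have [k ks|k ks|B AE] := IH us.
- by apply: lt; rewrite inE ks orbT.
- by apply: A0; rewrite inE ks orbT.
have p_s : p \in p :: s by rewrite mem_head.
have hi := @ordge_identify n L p.1 p.2.
have ltp := lt _ p_s; have nep : p.1 != p.2 by rewrite -val_eqE /= ltn_eqF.
have := A0 _ p_s; rewrite AE mps_substM // mps_subst_prod //.
move/eqP; rewrite mulf_eq0 (_ : (_ == 0) = false) /=; last first.
  apply/negP; rewrite prodf_seq_eq0 => /hasP[k ks /=].
  rewrite mps_substB // !mps_subst_var // /identify => /eqP.
  have ltk : (k.1 < k.2)%N by apply: lt; rewrite inE ks orbT.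
  have nkp : k != p by apply: contraNneq pNs => <-.
  case: (k.1 =P p.1) => [k1|k1]; case: (k.2 =P p.1) => [k2|k2] E.
  - by rewrite k1 k2 ltnn in ltk.
  - suff : x p.2 - x k.2 != 0 by rewrite E eqxx.
    apply: mps_varB_neq0; apply: contraNneq nkp => pk2.
    by rewrite (surjective_pairing k) (surjective_pairing p) k1 pk2.
  - suff : x k.1 - x p.2 != 0 by rewrite E eqxx.
    apply: mps_varB_neq0; rewrite -val_eqE /= ltn_eqF // (ltn_trans ltk) // k2 //.
  - suff : x k.1 - x k.2 != 0 by rewrite E eqxx.
    by apply: mps_varB_neq0; rewrite -val_eqE /= ltn_eqF.
move/eqP/(identify_ker nep)=> [B' BE]; exists B'.
by rewrite BE big_cons mulrA; congr (_ * _); rewrite mulrC.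
Qed.
End DifferenceProducts.

Section Vandermonde.
Variables (n : nat) (R : comNzRingType).

Definition vdm (y : 'I_n -> R) : R := \prod_(i < n) \prod_(j < n | (i < j)%N) (y i - y j).

Lemma vdm_perm (y : 'I_n -> R) (w : 'S_n) : vdm (fun i => y (w i)) = (-1) ^+ w * vdm y.
Proof.
have vdmE z : vdm z = \det (Vandermonde n (\row_j - z j)).
  rewrite det_Vandermonde; apply: eq_bigr => i _; apply: eq_bigr => j _.
  by rewrite !mxE opprK addrC.
rewrite !vdmE -det_perm mulrC -det_mulmx.
have -> : Vandermonde n (\row_j - y (w j)) = col_perm w (Vandermonde n (\row_j - y j)).
  by apply/matrixP => i j; rewrite !mxE.
by rewrite col_permE !det_mulmx !det_perm odd_permV.
Qed.
End Vandermonde.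

(** * The Hall-Littlewood series *)

Section StabilizerSums.
Variables (n r : nat).
Hypothesis le_rn : (r <= n)%N.

Definition tail_set : {set 'I_n} := [set i : 'I_n | (r <= i)%N].

Lemma card_tail_set : #|tail_set| = (n - r)%N.
Proof.
have := cardsC tail_set; rewrite card_ord.
have -> : #|~: tail_set| = r; last by lia.
have E : ~: tail_set = [set widen_ord le_rn k | k : 'I_r].
  apply/setP => i; rewrite !inE -ltnNge; apply/idP/imsetP => [lt|[k _ ->]]; last exact: (ltn_ord k).
  by exists (Ordinal lt) => //; apply: val_inj.
by rewrite E card_imset ?card_ord // => a b /(congr1 val) /= /val_inj.
Qed.

Lemma tail_fix v (i : 'I_n) : v \in Sym tail_set -> (i < r)%N -> v i = i.
Proof. by rewrite inE => on lt; apply: (out_perm on); rewrite inE -ltnNge. Qed.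

Lemma tail_stable v (i : 'I_n) : v \in Sym tail_set -> (r <= v i)%N = (r <= i)%N.
Proof. by rewrite inE => on; have := perm_closed i on; rewrite !inE. Qed.

Lemma tail_lt v (i j : 'I_n) : v \in Sym tail_set -> (i < r)%N -> (i < v j)%N = (i < j)%N.
Proof.
move=> hv lt; have [ltj|lej] := ltnP j r; first by rewrite tail_fix.
have lej' : (r <= v j)%N by rewrite tail_stable.
by rewrite (leq_trans lt lej) (leq_trans lt lej').
Qed.

(** The permutations fixing the first r indices number (n - r)!, and [G] is constant on their
    cosets. *)
Lemma sum_tail_invariant (V : zmodType) (G : 'S_n -> V) :
  (forall v w, v \in Sym tail_set -> G (v * w)%g = G w) ->
  exists A, \sum_w G w = A *+ (n - r)`!.
Proof.
move=> inv; exists (\sum_(C in rcosets (Sym tail_set) [set: 'S_n]) G (repr C)).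
have -> : \sum_w G w = \sum_(w in [set: 'S_n]) G w.
  by apply: eq_bigl => w; rewrite inE.
have part : partition (rcosets (Sym tail_set) [set: 'S_n]) [set: 'S_n].
  exact: (@rcosets_partition _ _ (Sym_group tail_set) (subsetT _)).
rewrite (set_partition_big _ part) /= -sumrMnl.
apply: eq_bigr => _ /rcosetsP[w _ ->].
rewrite -card_tail_set -card_Sym -(card_rcoset _ w) -sumr_const.
apply: eq_bigr => _ /rcosetP[h hh ->].
by have [h' hh'] := repr_rcosetP (Sym_group tail_set) w; rewrite !inv.
Qed.
End StabilizerSums.

Lemma tofrac_inj (D : idomainType) : injective (@tofrac D).
Proof. by move=> a b /eqP; rewrite tofrac_eq => /eqP. Qed.

Section HallLittlewoodTerms.
Variables (L : idomainType) (F : mps 2 L) (n r : nat) (g : 'I_n -> mps 1 L).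
Hypothesis hF : is_fgl F.
Local Notation "x %:F" := (@tofrac (mps n L) x).
Local Notation "a +_F b" := (fgl_add F a b) (at level 50).
Local Notation x := (mps_var L).
Implicit Types (z y s : 'I_n -> mps n L) (w v : 'S_n).

(** The series [g i] is t^lam_i for P and [2](t) t^(lam_i - 1) for Q, which treats both families at
    once; [z] stands for permuted or substituted variables. *)
Definition hl_head z : mps n L := \prod_(i < n | (i < r)%N) mps_subst (fun _ => z i) (g i).

Definition hl_ratio z (i j : 'I_n) : {fraction mps n L} :=
  (z i +_F z j)%:F / (z i +_F fgl_opp F (z j))%:F.

Definition hl_term z : {fraction mps n L} := (hl_head z)%:F *
  \prod_(i < n | (i < r)%N) \prod_(j < n | (i < j)%N) hl_ratio z i j.

(** The product of the Vandermonde product and [hl_term], with the denominators cancelled: for i < r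
    the factor z_i - z_j absorbs the denominator and leaves [sub_ratio]. *)
Definition hl_num z : mps n L := hl_head z *
  (\prod_(i < n | (i < r)%N) \prod_(j < n | (i < j)%N) ((z i +_F z j) * sub_ratio F (z i) (z j)) *
   \prod_(i < n | ~~ (i < r)%N) \prod_(j < n | (i < j)%N) (z i - z j)).

Lemma hl_numE z : (forall i, ordge 1 (z i)) -> (forall i j, i != j -> z i - z j != 0) ->
  (hl_num z)%:F = (vdm z)%:F * hl_term z.
Proof.
move=> z1 zd; have -> : vdm z = \prod_(i < n | (i < r)%N) \prod_(j < n | (i < j)%N) (z i - z j) *
    \prod_(i < n | ~~ (i < r)%N) \prod_(j < n | (i < j)%N) (z i - z j).
  by rewrite /vdm (bigID (fun i : 'I_n => i < r)%N).
rewrite /hl_num /hl_term.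
rewrite !rmorphM /= [RHS]mulrCA; congr (_ * _).
rewrite [RHS]mulrAC; congr (_ * _); rewrite !rmorph_prod -big_split /=.
apply: eq_bigr => i _; rewrite !rmorph_prod -big_split /=; apply: eq_bigr => j lt.
have ij : i != j by rewrite -val_eqE /= ltn_eqF.
have := zd _ _ ij; rewrite (fgl_subE hF) // mulf_eq0 negb_or => /andP[e0 _].
by rewrite /hl_ratio !rmorphM /= [RHS]mulrC -mulrA mulKf // tofrac_eq0.
Qed.

Lemma mps_subst_hl_num s z : (forall i, ordge 1 (s i)) -> (forall i, ordge 1 (z i)) ->
  mps_subst s (hl_num z) = hl_num (fun i => mps_subst s (z i)).
Proof.
move=> s1 z1; rewrite /hl_num /hl_head !mps_substM // !mps_subst_prod //.
congr (_ * (_ * _)).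
- by apply: eq_bigr => i _; rewrite mps_subst_comp.
- apply: eq_bigr => i _; rewrite mps_subst_prod //; apply: eq_bigr => j _.
  by rewrite mps_substM // mps_subst_fgl_add // mps_subst_sub_ratio.
- apply: eq_bigr => i _; rewrite mps_subst_prod //; apply: eq_bigr => j _.
  by rewrite mps_substB.
Qed.

Lemma hl_head_tail z v : v \in Sym (tail_set n r) -> hl_head (fun i => z (v i)) = hl_head z.
Proof. by move=> hv; apply: eq_bigr => i lt; rewrite (tail_fix hv). Qed.

Lemma hl_term_tail z v : v \in Sym (tail_set n r) -> hl_term (fun i => z (v i)) = hl_term z.
Proof.
move=> hv; rewrite /hl_term hl_head_tail //; congr (_ * _).
apply: eq_bigr => i lt; rewrite [RHS](reindex_inj (@perm_inj _ v)) /=.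
apply: eq_big => [j|j _]; first by rewrite (tail_lt _ hv).
by rewrite /hl_ratio (tail_fix hv lt).
Qed.

Let x1 (i : 'I_n) : ordge 1 (x i). Proof. exact: ordge_var. Qed.
Let xw w := fun i : 'I_n => x (w i).
Let xw1 w i : ordge 1 (xw w i). Proof. exact: ordge_var. Qed.
Let xd (i j : 'I_n) : i != j -> x i - x j != 0. Proof. exact: mps_varB_neq0. Qed.

Lemma vdm_subst s (y : 'I_n -> mps n L) : (forall i, ordge 1 (s i)) ->
  mps_subst s (vdm y) = vdm (fun i => mps_subst s (y i)).
Proof.
move=> s1; rewrite /vdm mps_subst_prod //; apply: eq_bigr => i _.
by rewrite mps_subst_prod //; apply: eq_bigr => j _; rewrite mps_substB.
Qed.

Lemma vdm_neq0 (y : 'I_n -> mps n L) : (forall i j, i != j -> y i - y j != 0) -> vdm y != 0.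
Proof.
move=> yd; apply/prodf_neq0 => i _; apply/prodf_neq0 => j lt.
by apply: yd; rewrite -val_eqE /= ltn_eqF.
Qed.

Definition ord_pairs : seq ('I_n * 'I_n) := [seq p : 'I_n * 'I_n <- enum {: 'I_n * 'I_n} | (p.1 < p.2)%N].

Lemma vdm_diff_prod : vdm x = diff_prod L ord_pairs.
Proof.
rewrite /vdm pair_big_dep /diff_prod big_filter big_enum_cond /=.
by [].
Qed.

Lemma ord_pairs_lt (p : 'I_n * 'I_n) : p \in ord_pairs -> (p.1 < p.2)%N.
Proof. by rewrite mem_filter => /andP[]. Qed.

Lemma uniq_ord_pairs : uniq ord_pairs.
Proof. by rewrite filter_uniq // enum_uniq. Qed.

Hypothesis le_rn : (r <= n)%N.
Hypothesis char0 : forall k : nat, k != 0%N -> k%:R != 0 :> L.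

Lemma mps_mulrn_inj k : k != 0%N -> injective (fun f : mps n L => f *+ k).
Proof.
move=> k0 f f' E; apply: mpsP => m; have := congr1 (fun h : mps n L => h m) E.
rewrite !mps_coefMn => /eqP; rewrite -subr_eq0 -mulrnBl -mulr_natr mulf_eq0.
by rewrite (negPf (char0 k0)) orbF subr_eq0 => /eqP.
Qed.

Lemma signed_num_term z w : (forall i, ordge 1 (z i)) -> (forall i j, i != j -> z i - z j != 0) ->
  ((-1) ^+ w * hl_num (fun i => z (w i)))%:F = (vdm z)%:F * hl_term (fun i => z (w i)).
Proof.
move=> z1 zd; rewrite rmorphM /= hl_numE => [|//|i j ij]; last first.
  by apply: zd; rewrite (inj_eq (@perm_inj _ w)).
by rewrite vdm_perm mulrA -rmorphM /= signrMK.
Qed.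

Lemma fact_neq0 k : k`! != 0%N. Proof. by rewrite -lt0n fact_gt0. Qed.

(* grouping the permutations by cosets of the stabilizer of the first r indices
   makes the sum [(n - r)!] times an alternating series *)
Lemma hl_integral : exists P : mps n L,
  (vdm x * P) *+ (n - r)`! = \sum_(w : 'S_n) (-1) ^+ w * hl_num (xw w).
Proof.
pose N w := (-1) ^+ w * hl_num (xw w).
have Nt w : (N w)%:F = (vdm x)%:F * hl_term (xw w) := signed_num_term w x1 xd.
have [v w hv|A AE] := @sum_tail_invariant n r le_rn _ N.
  have xwM : xw (v * w)%g = fun i => xw w (v i).
    by apply: funext => i; rewrite /xw permM.
  apply: tofrac_inj; apply: etrans (Nt _) (etrans _ (esym (Nt w))).
  by rewrite xwM (hl_term_tail (xw w) hv).
have altN (s : 'S_n) w : mps_subst (xw s) (N w) = (-1) ^+ s * N (w * s)%g.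
  rewrite /N mps_substM // mps_substXn // mps_substN // mps_subst1 //.
  rewrite mps_subst_hl_num // odd_permM addbC signr_addb -mulrA signrMK.
  congr (_ * hl_num _); apply: funext => i.
  by rewrite /xw mps_subst_var // permM.
have altA (s : 'S_n) : mps_subst (xw s) A = (-1) ^+ s * A.
  apply: (mps_mulrn_inj (fact_neq0 (n - r))); rewrite /= -mps_substMn // -AE.
  rewrite mps_subst_sum // -mulrnAr -AE mulr_sumr [RHS](reindex_inj (mulIg s)) /=.
  by apply: eq_bigr => w _; rewrite altN.
have [||B AB] := @diff_dvd_vanish n L ord_pairs A uniq_ord_pairs.
- exact: ord_pairs_lt.
(* Under x_i = x_j the transposition acts trivially, so alternation gives A = - A there, and 2 is
   cancelled. *)
- move=> [i j] /ord_pairs_lt /= lt; have ij : i != j by rewrite -val_eqE /= ltn_eqF.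
  have hi := @ordge_identify n L i j.
  have := congr1 (mps_subst (identify L i j)) (altA (tperm i j)).
  rewrite mps_subst_comp // odd_tperm ij expr1 mulN1r mps_substN //.
  have -> : mps_subst (fun k => mps_subst (identify L i j) (xw (tperm i j) k)) A =
      mps_subst (identify L i j) A.
    apply: eq_mps_subst => k; rewrite mps_subst_var // /identify.
    case: tpermP => [->|->|/eqP/negPf-> _]; rewrite ?eqxx // eq_sym (negPf ij) //.
  move/eqP; rewrite -subr_eq0 opprK -mulr2n => /eqP E.
  by apply: (@mps_mulrn_inj 2) => //; rewrite /= E mul0rn.
by exists B; rewrite vdm_diff_prod -AB -AE.
Qed.

Definition hl_series : mps n L := projT1 (cid hl_integral).

Lemma hl_seriesE : (vdm x * hl_series) *+ (n - r)`! = \sum_(w : 'S_n) (-1) ^+ w * hl_num (xw w).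
Proof. by rewrite /hl_series; case: cid. Qed.

(** Distinct arguments keep the Vandermonde product nonzero, so the identity multiplied by it can be
    substituted and then divided again. *)
Lemma mps_subst_hl_series s : (forall i, ordge 1 (s i)) -> (forall i j, i != j -> s i - s j != 0) ->
  (mps_subst s hl_series)%:F = ((n - r)`!)%:R^-1 * \sum_(w : 'S_n) hl_term (fun i => s (w i)).
Proof.
move=> s1 sd; have k0 : ((n - r)`!)%:R != 0 :> {fraction mps n L}.
  rewrite -(rmorph_nat (@tofrac (mps n L))) tofrac_eq0; apply/eqP => E.
  have := mps_mulrn_inj (fact_neq0 (n - r)) (_ : 1 *+ _ = 0 *+ _).
  by rewrite E mul0rn => /(_ erefl)/eqP; rewrite oner_eq0.
have v0 : (vdm s)%:F != 0 by rewrite tofrac_eq0 vdm_neq0.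
apply: (mulfI k0); rewrite mulrA divff // mul1r; apply: (mulfI v0).
have := congr1 (fun f => (mps_subst s f)%:F) hl_seriesE.
rewrite mps_substMn // mps_substM // vdm_subst //.
have -> : vdm (fun i => mps_subst s (x i)) = vdm s.
  by congr vdm; apply: funext => i; rewrite mps_subst_var.
rewrite rmorphMn rmorphM /= -mulr_natr mulrA mulrAC -mulrA => ->.
rewrite mps_subst_sum // rmorph_sum mulr_sumr; apply: eq_bigr => w _.
rewrite -signed_num_term // mps_substM // mps_substXn // mps_substN // mps_subst1 //.
rewrite mps_subst_hl_num //; congr ((_ * hl_num _)%:F).
by apply: funext => i; rewrite /xw mps_subst_var.
Qed.

Lemma hl_series_frac : hl_series%:F = ((n - r)`!)%:R^-1 * \sum_(w : 'S_n) hl_term (xw w).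
Proof. by rewrite -[hl_series in LHS]mps_subst_id mps_subst_hl_series. Qed.

Lemma hl_series_symmetric : mps_symmetric hl_series.
Proof.
move=> s; have sd (i j : 'I_n) : i != j -> xw s i - xw s j != 0.
  by move=> ij; apply: xd; rewrite (inj_eq (@perm_inj _ s)).
apply: tofrac_inj; apply: etrans (mps_subst_hl_series (xw1 s) sd) _.
have -> : \sum_(w : 'S_n) hl_term (fun i => xw s (w i)) = \sum_(w : 'S_n) hl_term (xw w).
  rewrite [RHS](reindex_inj (mulIg s)) /=; apply: eq_bigr => w _.
  by congr hl_term; apply: funext => i; rewrite /xw permM.
by rewrite -hl_series_frac.
Qed.

End HallLittlewoodTerms.

Section FixedFractions.
Variables (L : idomainType) (n : nat) (t : 'I_n -> mps n L).
Hypothesis t1 : forall i, ordge 1 (t i).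
Local Notation "x %:F" := (@tofrac (mps n L) x).

(** For [t] setting some variables to 0, these are the fractions free of those variables, expressed
    without substituting into a fraction. *)
Definition frac_fixed (q : {fraction mps n L}) : Prop := exists a b : mps n L,
  [/\ mps_subst t a = a, mps_subst t b = b, b != 0 & q = a%:F / b%:F].

Lemma frac_fixed_tofrac a : mps_subst t a = a -> frac_fixed a%:F.
Proof.
by move=> ta; exists a, 1; split; rewrite ?mps_subst1 ?oner_neq0 // rmorph1 divr1.
Qed.

Lemma frac_fixedM p q : frac_fixed p -> frac_fixed q -> frac_fixed (p * q).
Proof.
move=> [a [b [ta tb b0 ->]]] [c [d [tc td d0 ->]]]; exists (a * c), (b * d); split.
- by rewrite mps_substM // ta tc.
- by rewrite mps_substM // tb td.
- by rewrite mulf_neq0.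
- by rewrite !rmorphM /= mulf_div.
Qed.

Lemma frac_fixedD p q : frac_fixed p -> frac_fixed q -> frac_fixed (p + q).
Proof.
move=> [a [b [ta tb b0 ->]]] [c [d [tc td d0 ->]]].
exists (a * d + c * b), (b * d); split.
- by rewrite mps_substD // !mps_substM // ta tb tc td.
- by rewrite mps_substM // tb td.
- by rewrite mulf_neq0.
- by rewrite rmorphD !rmorphM /= addf_div ?tofrac_eq0.
Qed.

Lemma frac_fixedV p : frac_fixed p -> frac_fixed p^-1.
Proof.
move=> [a [b [ta tb b0 ->]]]; have [->|a0] := eqVneq a 0.
  by rewrite rmorph0 mul0r invr0 -(rmorph0 (@tofrac (mps n L))); apply: frac_fixed_tofrac; apply: mps_subst0.
by exists b, a; rewrite invf_div.
Qed.

Lemma frac_fixed1 : frac_fixed 1.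
Proof. by rewrite -(rmorph1 (@tofrac (mps n L))); apply: frac_fixed_tofrac; apply: mps_subst1. Qed.

Lemma frac_fixed0 : frac_fixed 0.
Proof. by rewrite -(rmorph0 (@tofrac (mps n L))); apply: frac_fixed_tofrac; apply: mps_subst0. Qed.

Lemma frac_fixed_prod (I : Type) (s : seq I) (P : pred I) E :
  (forall i, P i -> frac_fixed (E i)) -> frac_fixed (\prod_(i <- s | P i) E i).
Proof.
move=> h; elim/big_ind: _ => //; [exact: frac_fixed1|exact: frac_fixedM].
Qed.

Lemma frac_fixed_sum (I : Type) (s : seq I) (P : pred I) E :
  (forall i, P i -> frac_fixed (E i)) -> frac_fixed (\sum_(i <- s | P i) E i).
Proof.
move=> h; elim/big_ind: _ => //; [exact: frac_fixed0|exact: frac_fixedD].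
Qed.

Lemma frac_fixed_nat k : frac_fixed k%:R.
Proof.
by elim: k => [|k IH]; [exact: frac_fixed0|rewrite mulrS; apply: frac_fixedD => //; exact: frac_fixed1].
Qed.

(** Both f and its image, multiplied by b, give a; the nonzero b is cancelled. *)
Lemma frac_fixedP f : frac_fixed f%:F -> mps_subst t f = f.
Proof.
move=> [a [b [ta tb b0 E]]].
have fb : f * b = a.
  apply: tofrac_inj; rewrite rmorphM /= E divfK // tofrac_eq0 //.
by apply: (mulIf b0); rewrite fb -{1}tb -mps_substM // fb.
Qed.
End FixedFractions.

Section OppLinear.
Variables (R : comNzRingType) (F : mps 2 R).
Hypothesis hF : is_fgl F.

Lemma fgl_opp_mod k (a : mps k R) : ordge 1 a -> ordge 2 (fgl_opp F a + a).
Proof.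
move=> ha; have ho := ordge_fgl_opp hF ha.
have := fgl_addN hF ha; rewrite (fgl_addE hF ha ho) => /eqP.
rewrite addr_eq0 addrC => /eqP->; apply: ordgeN; apply: ordgeMr.
exact: (@ordgeM _ _ 1 1).
Qed.

Lemma fgl_opp_coef1 k i m : (mdeg m <= 1)%N ->
  fgl_opp F (mps_var R (i : 'I_k)) m = - (U_(i)%MM == m)%:R.
Proof.
move=> le; have := fgl_opp_mod (@ordge_var k R i) (leq_ltn_trans le (ltnSn 1)).
by rewrite mps_coefD mps_varE monomE => /eqP; rewrite addr_eq0 => /eqP.
Qed.
End OppLinear.

Section HallLittlewoodRing.
Variables (L : idomainType) (F : mps 2 L) (n r : nat) (g : 'I_n -> mps 1 L).
Hypothesis hF : is_fgl F.
Hypothesis le_rn : (r <= n)%N.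
Hypothesis char0 : forall k : nat, k != 0%N -> k%:R != 0 :> L.
Local Notation "x %:F" := (@tofrac (mps n L) x).
Local Notation "a +_F b" := (fgl_add F a b) (at level 50).
Local Notation x := (mps_var L).
Local Notation P := (hl_series (r := r) g hF le_rn char0).

Let x1 (i : 'I_n) : ordge 1 (x i). Proof. exact: ordge_var. Qed.

Section Cancellation.
Variables i0 i1 : 'I_n.
Hypothesis i01 : i0 != i1.

Let y (k : 'I_n) : mps n L :=
  if k == i0 then x i0 else if k == i1 then fgl_opp F (x i0) else x k.
Let t (k : 'I_n) : mps n L := if (k == i0) || (k == i1) then 0 else x k.

Let t1 k : ordge 1 (t k). Proof. by rewrite /t; case: ifP. Qed.
Let y1 k : ordge 1 (y k).
Proof. by rewrite /y; do 2!case: ifP => _ //; apply: ordge_fgl_opp. Qed.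

Let y_coef (k l : 'I_n) : y k U_(l)%MM =
  if k == i1 then - (i0 == l)%:R else (k == l)%:R.
Proof.
rewrite /y; case: (k =P i0) => [->|_]; first by rewrite (negPf i01) mps_varE monomE eq_mnm1.
case: ifP => _; first by rewrite (fgl_opp_coef1 hF) ?mdeg1 // eq_mnm1.
by rewrite mps_varE monomE eq_mnm1.
Qed.

Let two_neq0 : (1 : L) + 1 != 0.
Proof. exact: (@char0 2). Qed.

(** The linear parts differ; for the pair [i0], [i1] the difference starts with 2 x_i0, whence the
    use of characteristic 0. *)
Let yd (a b : 'I_n) : a != b -> y a - y b != 0.
Proof.
wlog: a b / b != i1 => [H ab|b1 ab].
  have [b1|nb] := eqVneq b i1; last exact: H.
  by rewrite -opprB oppr_eq0; apply: H; [rewrite -b1|rewrite eq_sym].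
apply/eqP; have [a1|a1] := eqVneq a i1.
  move/(congr1 (fun f : mps n L => f U_(i0)%MM)).
  rewrite mps_coefB !y_coef a1 eqxx (negPf b1) eqxx mps_coef0 /= => /eqP.
  rewrite -opprD oppr_eq0; case: (b == i0); first by rewrite (negPf two_neq0).
  by rewrite addr0 oner_eq0.
move/(congr1 (fun f : mps n L => f U_(a)%MM)).
rewrite mps_coefB !y_coef (negPf a1) (negPf b1) eqxx [b == a]eq_sym (negPf ab) subr0 mps_coef0.
by move/eqP; rewrite oner_eq0.
Qed.

Let den_neq0 (a b : 'I_n) : a != b -> y a +_F fgl_opp F (y b) != 0.
Proof.
move=> ab; have := yd ab; rewrite (fgl_subE hF) // mulf_eq0 negb_or.
by case/andP.
Qed.

(** Let [a] and [b] be the positions of t and -_F t. If one of them is among the first r, the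
    earlier one yields a numerator t +_F (-_F t) = 0. Otherwise, for each i < r, the quotients at
    [a] and [b] are inverse to each other, and nothing else contains t. *)
Lemma hl_term_cancel (w : 'S_n) : frac_fixed t (hl_term F r g (fun i => y (w i))).
Proof.
set a := (w^-1)%g i0; set b := (w^-1)%g i1.
have wa : w a = i0 by rewrite permKV.
have wb : w b = i1 by rewrite permKV.
have ya : y i0 = x i0 by rewrite /y eqxx.
have yb : y i1 = fgl_opp F (x i0) by rewrite /y eqxx eq_sym (negPf i01).
have ab : a != b by rewrite (inj_eq (@perm_inj _ _)).
have bad (c d : 'I_n) : (c < d)%N -> (c < r)%N -> y (w c) +_F y (w d) = 0 ->
    hl_term F r g (fun i => y (w i)) = 0.
  move=> cd cr E; rewrite /hl_term (bigD1 c) //= (bigD1 d) //= /hl_ratio E.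
  by rewrite rmorph0 !mul0r mulr0.
have sum0 : x i0 +_F fgl_opp F (x i0) = 0 by rewrite fgl_addN.
have sum0' : fgl_opp F (x i0) +_F x i0 = 0.
  by rewrite fgl_addC //; apply: ordge_fgl_opp.
have [good|low] := boolP ((r <= a)%N && (r <= b)%N); last first.
  suff -> : hl_term F r g (fun i => y (w i)) = 0 by exact: frac_fixed0.
  have [lt|le] := ltnP a b.
    by apply: (bad a b) => //; [lia|rewrite wa wb ya yb].
  have lt : (b < a)%N by rewrite ltn_neqAle le andbT; move: ab; rewrite -val_eqE eq_sym.
  by apply: (bad b a) => //; [lia|rewrite wa wb ya yb].
case/andP: good => ra rb.
have out c : c != a -> c != b -> [/\ w c != i0, w c != i1 & mps_subst t (y (w c)) = y (w c)].
  move=> ca cb; have c0 : w c != i0 by rewrite -wa (inj_eq (@perm_inj _ _)).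
  have c1 : w c != i1 by rewrite -wb (inj_eq (@perm_inj _ _)).
  by split; rewrite // /y (negPf c0) (negPf c1) mps_subst_var // /t (negPf c0) (negPf c1).
have ltr (c : 'I_n) : (c < r)%N -> c != a /\ c != b.
  by move=> cr; split; rewrite -val_eqE /= ltn_eqF //; lia.
rewrite /hl_term; apply: frac_fixedM => //.
  apply: frac_fixed_tofrac => //; rewrite /hl_head mps_subst_prod //; apply: eq_bigr => i ir.
  have [ia ib] := ltr i ir; have [_ _ E] := out i ia ib.
  by rewrite mps_subst_comp // E.
apply: frac_fixed_prod => // i ir; have [ia ib] := ltr i ir; have [n0 n1 Ei] := out i ia ib.
have lia_ : (i < a)%N by lia.
have lib_ : (i < b)%N by lia.
rewrite (bigD1 a) //= (bigD1 b) /=; last by rewrite lib_ eq_sym.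
rewrite mulrA [X in X * _](_ : _ = 1); last first.
  rewrite /hl_ratio wa wb ya yb (fgl_oppK hF) // mulf_div [X in _ / X]mulrC.
  have d1 := den_neq0 n0; have d2 := den_neq0 n1.
  rewrite ya in d1; rewrite yb (fgl_oppK hF) // in d2.
  by rewrite divff // mulf_neq0 // tofrac_eq0.
rewrite mul1r; apply: frac_fixed_prod => // j /andP[/andP[lt ja] jb].
have [m0 m1 Ej] := out j ja jb.
exists (y (w i) +_F y (w j)), (y (w i) +_F fgl_opp F (y (w j))); split => //.
- by rewrite mps_subst_fgl_add // Ei Ej.
- have ho := ordge_fgl_opp hF (y1 (w j)).
  by rewrite mps_subst_fgl_add // mps_subst_fgl_opp // Ei Ej.
- by apply: den_neq0; rewrite (inj_eq (@perm_inj _ _)) -val_eqE /= ltn_eqF.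
Qed.

(** The substituted series is free of t, hence equals its own value at t = 0, where -_F t is 0
    too. *)
Lemma hl_series_cancel : mps_subst y P = mps_subst t P.
Proof.
have fixP : mps_subst t (mps_subst y P) = mps_subst y P.
  apply: frac_fixedP => //; rewrite (mps_subst_hl_series g hF le_rn char0 y1 yd).
  apply: frac_fixedM => //; first by apply: frac_fixedV => //; apply: frac_fixed_nat.
  by apply: frac_fixed_sum => // w _; apply: hl_term_cancel.
rewrite -fixP mps_subst_comp //; apply: eq_mps_subst => k.
rewrite /y; case: (k =P i0) => [->|/eqP/negPf k0].
  by rewrite mps_subst_var // /t eqxx.
case: (k =P i1) => [->|/eqP/negPf k1]; last by rewrite mps_subst_var // /t k0 k1.
rewrite mps_subst_fgl_opp // mps_subst_var // {1}/t eqxx fgl_opp0 //.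
by rewrite /t eqxx orbT.
Qed.

End Cancellation.

Lemma hl_series_supersymmetric : supersymmetric F P.
Proof.
split; first exact: hl_series_symmetric.
move=> i0 i1 h0 h1; apply: hl_series_cancel.
by rewrite -val_eqE /= h0 h1.
Qed.

End HallLittlewoodRing.

Lemma dvd_prodB (R : comNzRingType) (q : R) (I : Type) (s : seq I) (P : pred I) (a b : I -> R) :
  (forall i, P i -> exists c, a i - b i = q * c) ->
  exists c, \prod_(i <- s | P i) a i - \prod_(i <- s | P i) b i = q * c.
Proof.
move=> h; elim/big_rec2: _ => [|i u v Pi [c E]]; first by exists 0; rewrite subrr mulr0.
have [d D] := h i Pi; exists (d * v + b i * c).
have -> : a i * v - b i * u = (a i - b i) * v + b i * (v - u) by ring.
by rewrite D E; ring.
Qed.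

Section HallLittlewoodPlus.
Variables (L : idomainType) (F : mps 2 L) (n r : nat) (g : 'I_n -> mps 1 L).
Hypothesis hF : is_fgl F.
Hypothesis le_rn : (r <= n)%N.
Hypothesis char0 : forall k : nat, k != 0%N -> k%:R != 0 :> L.
Local Notation "x %:F" := (@tofrac (mps n L) x).
Local Notation "a +_F b" := (fgl_add F a b) (at level 50).
Local Notation x := (mps_var L).
Local Notation P := (hl_series (r := r) g hF le_rn char0).

Definition fgl_double : mps 1 L := x ord0 +_F x ord0.

Hypothesis g_dvd : forall i, exists h, g i = fgl_double * h.

Variable i0 : 'I_n.
Let s (k : 'I_n) : mps n L := if k == i0 then 0 else x k.
Let q : mps n L := x i0 +_F x i0.

Let x1 (i : 'I_n) : ordge 1 (x i). Proof. exact: ordge_var. Qed.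
Let s1 k : ordge 1 (s k). Proof. by rewrite /s; case: ifP. Qed.
Let xd (i j : 'I_n) : i != j -> x i - x j != 0. Proof. exact: mps_varB_neq0. Qed.

Lemma mps_var_neq0 (R : comNzRingType) k (i : 'I_k) : mps_var R i != 0.
Proof.
apply/eqP => /(congr1 (fun f : mps k R => f U_(i)%MM)).
by rewrite mps_varE monomE eqxx mps_coef0 => /eqP; rewrite oner_eq0.
Qed.

Let sd (i j : 'I_n) : i != j -> s i - s j != 0.
Proof.
move=> ij; rewrite /s; case: (i =P i0) => [ii|_]; case: (j =P i0) => [jj|_].
- by rewrite ii jj eqxx in ij.
- by rewrite sub0r oppr_eq0 mps_var_neq0.
- by rewrite subr0 mps_var_neq0.
exact: xd.
Qed.

Lemma mps_subst_double k (a : mps k L) : ordge 1 a ->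
  mps_subst (fun _ => a) fgl_double = a +_F a.
Proof. by move=> a1; rewrite mps_subst_fgl_add // !mps_subst_var. Qed.

Lemma double_neq0 (i : 'I_n) : x i +_F x i != 0.
Proof.
apply/eqP => E; have [_] := lead_fgl_add hF i i.
rewrite E ltnn eqxx mps_coef0 => /esym/eqP.
by rewrite (negPf (@char0 2 _)).
Qed.

Lemma hl_ratioE z (i j : 'I_n) : ordge 1 (z i) -> ordge 1 (z j) -> z i - z j != 0 ->
  (z i - z j)%:F * hl_ratio F z i j = ((z i +_F z j) * sub_ratio F (z i) (z j))%:F.
Proof.
move=> zi zj; rewrite (fgl_subE hF) // mulf_eq0 negb_or => /andP[e0 _].
by rewrite /hl_ratio !rmorphM /= mulrC -mulrA mulKf // tofrac_eq0.
Qed.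

(** Let x_i0 be at position [a]. If a < r, the head contains [2](x_i0) and the term vanishes at x_i0
    = 0. Otherwise x_i0 enters only through the quotients with denominator z_i -_F z_a, and modulo
    [2](x_i0) their numerators and denominators agree. *)
Lemma hl_term_dvd (w : 'S_n) : exists H,
  (vdm x)%:F * (hl_term F r g (fun i => x (w i)) - hl_term F r g (fun i => s (w i))) = (q * H)%:F.
Proof.
set a := (w^-1)%g i0; have wa : w a = i0 by rewrite permKV.
pose z i := x (w i); pose z' i := s (w i).
have z1 i : ordge 1 (z i) by exact: x1.
have z'1 i : ordge 1 (z' i) by exact: s1.
have zd (i j : 'I_n) : i != j -> z i - z j != 0.
  by move=> ij; apply: xd; rewrite (inj_eq (@perm_inj _ _)).
have [lt|le] := ltnP a r.
  have T0 : hl_term F r g z' = 0.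
    rewrite /hl_term /hl_head (bigD1 a) //= (_ : mps_subst _ _ = 0) ?mul0r ?rmorph0 ?mul0r //.
    have [h ->] := g_dvd a; rewrite mps_substM // mps_subst_double // /z' wa /s eqxx.
    by rewrite fgl_addr0 // mul0r.
  have qz : z a +_F z a = q by rewrite /z wa.
  rewrite -/z -/z' T0 subr0 -(signed_num_term r g hF w x1 xd) -/z.
  have [h gE] := g_dvd a.
  rewrite /hl_num /hl_head (bigD1 a) //= gE mps_substM // (mps_subst_double (z1 a)) qz.
  set A := mps_subst _ h; set B := \prod_(i < n | _) mps_subst _ _; set C := _ * \prod_(i < n | ~~ _) _.
  have rg (e : mps n L) : e * (q * A * B * C) = q * (e * (A * B * C)).
    by move: (q) A B C => q' A B C; ring.
  by exists ((-1) ^+ w * (A * B * C)); rewrite rg.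
have neq (i : 'I_n) : (i < r)%N -> i != a by move=> ir; rewrite -val_eqE /= ltn_eqF //; lia.
have lta (i : 'I_n) : (i < r)%N -> (i < a)%N by move=> ir; lia.
have same (i : 'I_n) : i != a -> z' i = z i.
  by move=> ia; rewrite /z' /s -wa (inj_eq (@perm_inj _ _)) (negPf ia).
pose M (i : 'I_n) := \prod_(j < n | (i < j)%N && (j != a)) ((z i +_F z j) * sub_ratio F (z i) (z j)).
pose rest := \prod_(i < n | ~~ (i < r)%N) \prod_(j < n | (i < j)%N) (z i - z j).
pose e (i : 'I_n) := z i +_F fgl_opp F (z a).
pose rho (i : 'I_n) := sub_ratio F (z i) (z a).
have numE : hl_num F r g z = hl_head r g z * (\prod_(i < n | (i < r)%N) (rho i * M i * (z i +_F z a)) * rest).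
  rewrite /hl_num; congr (_ * (_ * _)); apply: eq_bigr => i ir.
  by rewrite (bigD1 a) ?lta //= /rho -/(M i); set A := _ +_F _; ring.
have headE : hl_head r g z' = hl_head r g z.
  by apply: eq_bigr => i ir; rewrite same ?neq.
have numE' : (vdm z)%:F * hl_term F r g z' =
    (hl_head r g z * (\prod_(i < n | (i < r)%N) (rho i * M i * e i) * rest))%:F.
  have -> : vdm z = \prod_(i < n | (i < r)%N) \prod_(j < n | (i < j)%N) (z i - z j) * rest.
    by rewrite /vdm (bigID (fun i : 'I_n => i < r)%N).
  rewrite /hl_term headE !rmorphM /= mulrCA; congr (_ * _).
  rewrite mulrAC; congr (_ * _); rewrite !rmorph_prod -big_split /=.
  apply: eq_bigr => i ir; rewrite rmorph_prod (bigD1 a) ?lta //= [X in _ * X](bigD1 a) ?lta //=.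
  (* At z_a = 0 the quotient is z_i / z_i. *)
  have -> : hl_ratio F z' i a = 1.
    rewrite /hl_ratio same ?neq // /z' wa /s eqxx fgl_opp0 // fgl_addr0 // divff //.
    by rewrite tofrac_eq0 mps_var_neq0.
  rewrite mul1r (fgl_subE hF) // -/(e i) -/(rho i) -mulrA !rmorphM /=.
  rewrite [RHS]mulrC -!mulrA; congr (_ * (_ * _)).
  rewrite /M rmorph_prod -big_split /=; apply: eq_bigr => j /andP[ij ja].
  have ij' : i != j by rewrite -val_eqE /= ltn_eqF.
  by rewrite -(hl_ratioE (z1 i) (z1 j) (zd _ _ ij')) /hl_ratio (same i (neq i ir)) (same j ja).
have [c cE] : exists c, \prod_(i < n | (i < r)%N) (rho i * M i * (z i +_F z a)) -
    \prod_(i < n | (i < r)%N) (rho i * M i * e i) = q * c.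
  apply: dvd_prodB => i ir.
  have ho := ordge_fgl_opp hF (z1 a); have hq : ordge 1 q by apply: ordge_fgl_add.
  have e1 : ordge 1 (e i) by apply: ordge_fgl_add.
  (* z_i +_F z_a is (z_i -_F z_a) +_F (z_a +_F z_a), which differs from its first summand by a
     multiple of the second. *)
  have sumE : z i +_F z a = e i +_F q.
    rewrite /e -fgl_addA //; congr (_ +_F _).
    by rewrite /q -wa -/(z a) fgl_addA // (fgl_addC hF ho) // fgl_addN // fgl_add0r.
  exists (rho i * M i * (1 + e i * fgl_add (fgl_cross F) (e i) q)).
  rewrite sumE fgl_addE //; ring.
exists ((-1) ^+ w * (hl_head r g z * rest * c)).
have vE : vdm x = (-1) ^+ w * vdm z by rewrite (vdm_perm x w) signrMK.
have T1 : (vdm x)%:F * hl_term F r g z = ((-1) ^+ w * hl_num F r g z)%:F.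
  exact: (esym (signed_num_term r g hF w x1 xd)).
have T2 : (vdm x)%:F * hl_term F r g z' = ((-1) ^+ w * (hl_head r g z *
    (\prod_(i < n | (i < r)%N) (rho i * M i * e i) * rest)))%:F.
  by rewrite vE rmorphM /= -mulrA numE' [in RHS]rmorphM.
rewrite mulrBr T1 T2 -rmorphB /= numE; move: cE.
set A := \prod_(i < n | _) (_ * (_ +_F _)); set B := \prod_(i < n | (i < r)%N) (_ * e _).
have rg (p1 p2 p3 : mps n L) : p1 * (p2 * (A * p3)) - p1 * (p2 * (B * p3)) = p1 * (p2 * p3 * (A - B)).
  by move: A B => A B; ring.
by move=> cE; rewrite rg cE !mulrA [_ * q]mulrC !mulrA.
Qed.

Lemma hl_series_plus : exists G, P - mps_subst s P = q * G.
Proof.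
pose H w := projT1 (cid (hl_term_dvd w)).
have HE (w : 'S_n) : (vdm x)%:F * (hl_term F r g (fun i => x (w i)) - hl_term F r g (fun i => s (w i))) =
    (q * H w)%:F by rewrite /H; case: cid.
have q0 : q != 0 := double_neq0 i0.
(* The coset argument is applied to the quotients by [2](x_i0), so (n - r)! is cancelled with no
   coprimality between it and [2](x_i0). *)
have [v w hv|H' H'E] := sum_tail_invariant le_rn (G := H).
  apply: (mulfI q0); apply: tofrac_inj; apply: etrans (esym (HE _)) (etrans _ (HE w)).
  have tail (y : 'I_n -> mps n L) :
      hl_term F r g (fun i => y ((v * w)%g i)) = hl_term F r g (fun i => y (w i)).
    rewrite -(hl_term_tail F g (fun i => y (w i)) hv); congr hl_term.
    by apply: funext => i; rewrite permM.
  by rewrite (tail x) (tail s).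
pose k := ((n - r)`!)%:R : {fraction mps n L}.
have k0 : k != 0.
  rewrite /k -(rmorph_nat (@tofrac (mps n L))) tofrac_eq0; apply/eqP => E.
  have := mps_mulrn_inj char0 (fact_neq0 (n - r)) (_ : (1 : mps n L) *+ _ = 0 *+ _).
  by rewrite E mul0rn => /(_ erefl)/eqP; rewrite oner_eq0.
have VE : vdm x * (P - mps_subst s P) = q * H'.
  apply: tofrac_inj; rewrite rmorphM rmorphB /= hl_series_frac (mps_subst_hl_series _ _ _ _ s1 sd).
  rewrite -mulrBr -sumrB mulrCA mulr_sumr.
  under eq_bigr do rewrite HE.
  rewrite -rmorph_sum -mulr_sumr H'E mulrnAr rmorphMn -/k /= -mulr_natl mulrA mulVf // mul1r //.
have [||G GE] := @diff_dvd_cancel n L (ord_pairs n) _ _ _ _ _ (etrans (congr1 (fun v => v * _) (esym (vdm_diff_prod L n))) VE).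
- by move=> p /ord_pairs_lt lt; rewrite -val_eqE /= ltn_eqF.
(* Identifying two variables turns [2](x_i0) into [2] of some variable, still nonzero. *)
- move=> p _; have hi := @ordge_identify n L p.1 p.2.
  rewrite mps_subst_fgl_add // mps_subst_var // /identify; case: ifP => _; exact: double_neq0.
exists G; apply: (mulfI (vdm_neq0 xd)); rewrite VE GE -vdm_diff_prod mulrCA //.
Qed.

End HallLittlewoodPlus.

Lemma mdeg_perm n (m : 'X_{1..n}) (w : 'S_n) : mdeg [multinom m (w i) | i < n] = mdeg m.
Proof.
rewrite !mdegE [RHS](reindex_inj (@perm_inj _ w)) /=.
by apply: eq_bigr => i _; rewrite mnmE.
Qed.

Lemma nondecreasing_le_perm n (m : 'X_{1..n}) (w : 'S_n) :
  (forall i j : 'I_n, (i < j)%N -> (m i <= m j)%N) ->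
  (m <= [multinom m (w i) | i < n])%O.
Proof.
move=> mono; rewrite leNgt; apply/negP; case/ltmcP; first by rewrite mdeg_perm.
move=> i eq; rewrite mnmE => lt.
pose B : {set 'I_n} := [set p | (m p < m i)%N].
have Blt p : p \in B -> (p < i)%N.
  rewrite inE => lt'; rewrite ltnNge; apply/negP; rewrite leq_eqVlt => /orP[/eqP/val_inj E|/mono].
    by rewrite E ltnn in lt'.
  by rewrite leqNgt lt'.
(* At the first difference i, [w] preserves the set of indices with exponent below m_i, all of them
   before i; yet it would also send i into that set. *)
have wB : w @: B = B.
  apply/eqP; rewrite eqEcard card_imset ?leqnn ?andbT; last exact: perm_inj.
  apply/subsetP => _ /imsetP[p pB ->]; have := eq p (Blt p pB); rewrite mnmE inE => ->.
  by rewrite inE in pB.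
have : w i \in w @: B by rewrite wB inE.
by rewrite mem_imset ?inE ?ltnn //; exact: perm_inj.
Qed.

Lemma swap_lt n (m : 'X_{1..n}) (i j : 'I_n) : (i < j)%N -> (m j < m i)%N ->
  ([multinom m (tperm i j k) | k < n] < m)%O.
Proof.
move=> ij lt; apply/ltmcP; first by rewrite mdeg_perm.
exists i => [k ki|]; rewrite mnmE; last by rewrite tpermL.
by rewrite tpermD // -val_eqE /= gtn_eqF //; apply: ltn_trans ij.
Qed.

Section LeadCancel.
Variables (n : nat) (L : idomainType).
Implicit Types (f p : mps n L).

Lemma lead_cancel f p m m' e c : e != 0 -> lead f m' e ->
  lead (f * p) (m' + m)%MM (e * c) -> lead p m c.
Proof.
move=> e0 lf [low top]; suff low' : forall k : 'X_{1..n}, (k < m)%O -> p k = 0.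
  split=> //; have [_] := leadM lf (conj low' (erefl (p m))).
  by rewrite top => /(mulfI e0).
apply: ltmwf => k IH lt; have lp : lead p k (p k) by split=> // l lk; apply: IH => //; apply: lt_trans lt.
have [_] := leadM lf lp; rewrite low; last by rewrite ltmc_add2r.
by move/esym/eqP; rewrite mulf_eq0 (negPf e0) => /eqP.
Qed.

Lemma lead_monom_uniq f m m' c c' : c != 0 -> c' != 0 -> lead f m c -> lead f m' c' -> m = m'.
Proof.
move=> c0 c0' [l1 e1] [l2 e2]; case: (ltgtP m m') => // lt.
  by rewrite l2 // in e1; rewrite -e1 eqxx in c0.
by rewrite l1 // in e2; rewrite -e2 eqxx in c0'.
Qed.
End LeadCancel.

Section LeadHallLittlewood.
Variables (L : idomainType) (F : mps 2 L) (n r : nat) (g : 'I_n -> mps 1 L).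
Hypothesis hF : is_fgl F.
Hypothesis le_rn : (r <= n)%N.
Hypothesis char0 : forall k : nat, k != 0%N -> k%:R != 0 :> L.
Local Notation x := (mps_var L).
Local Notation P := (hl_series (r := r) g hF le_rn char0).

Variables (l : 'I_n -> nat) (c : 'I_n -> L).
Hypothesis g_lead : forall i a : 'I_n, (i < r)%N ->
  lead (mps_subst (fun _ => x a) (g i)) (U_(a) *+ l i)%MM (c i).
Hypothesis l_pos : forall i : 'I_n, (0 < l i)%N = (i < r)%N.
Hypothesis l_decr : forall i j : 'I_n, (i < j)%N -> (j < r)%N -> (l j < l i)%N.

Let x1 (i : 'I_n) : ordge 1 (x i). Proof. exact: ordge_var. Qed.

Let sgn (a b : 'I_n) : L := if (a < b)%N then -1 else 1.
Let maxi (a b : 'I_n) : 'I_n := if (a < b)%N then b else a.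
Let mu (w : 'S_n) : 'X_{1..n} := (\sum_(i < n | (i < r)%N) U_(w i) *+ l i)%MM.
Let delta (w : 'S_n) : 'X_{1..n} :=
  (\sum_(i < n) \sum_(j < n | (i < j)%N) U_(maxi (w i) (w j)))%MM.
Let eps (w : 'S_n) : L := \prod_(i < n) \prod_(j < n | (i < j)%N) sgn (w i) (w j).
Let eps' (w : 'S_n) : L :=
  \prod_(i < n | ~~ (i < r)%N) \prod_(j < n | (i < j)%N) sgn (w i) (w j).

Let sgn_neq0 a b : sgn a b != 0.
Proof. by rewrite /sgn; case: ifP; rewrite ?oppr_eq0 oner_eq0. Qed.

Let eps_neq0 w : eps w != 0.
Proof. by apply/prodf_neq0 => i _; apply/prodf_neq0 => j _; apply: sgn_neq0. Qed.

Let lead_diff (w : 'S_n) (i j : 'I_n) : (i < j)%N ->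
  lead (x (w i) - x (w j)) U_(maxi (w i) (w j))%MM (sgn (w i) (w j)).
Proof.
by move=> ij; apply: lead_varB; rewrite (inj_eq (@perm_inj _ w)) -val_eqE /= ltn_eqF.
Qed.

Let lead_vdm (w : 'S_n) : lead (vdm (fun i => x (w i))) (delta w) (eps w).
Proof. by apply: lead_prod => i _; apply: lead_prod => j; apply: lead_diff. Qed.

(** One and the same series, its leading term computed for each ordering of the variables: hence the
    monomial and the signed coefficient do not depend on [w]. *)
Let lead_vdm1 (w : 'S_n) : lead (vdm x) (delta w) ((-1) ^+ w * eps w).
Proof.
have -> : vdm x = (-1) ^+ w * vdm (fun i => x (w i)) by rewrite vdm_perm signrMK.
exact/leadZsign/lead_vdm.
Qed.

Let signM_neq0 (w : 'S_n) (e : L) : e != 0 -> (-1) ^+ w * e != 0.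
Proof. by move=> e0; rewrite mulf_neq0 // signr_eq0. Qed.

Let delta_const (w : 'S_n) : delta w = delta 1%g.
Proof.
by apply: lead_monom_uniq (lead_vdm1 w) (lead_vdm1 1%g); apply: signM_neq0.
Qed.

Let eps_const (w : 'S_n) : (-1) ^+ w * eps w = eps 1%g.
Proof.
have h1 := lead_vdm1 w; have h2 := lead_vdm1 1%g; rewrite delta_const in h1.
by have := lead_uniq h1 h2; rewrite odd_perm1 expr0 mul1r.
Qed.

Let C : L := \prod_(i < n | (i < r)%N) c i.

(** Distinct variables give x_i +_F x_j and x_i - x_j the same least monomial, but the sum has
    coefficient 1 where the difference has a sign; hence [eps'] in place of [eps]. *)
Let lead_num (w : 'S_n) : lead (hl_num F r g (fun i => x (w i))) (mu w + delta w)%MM (C * eps' w).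
Proof.
have -> : delta w = (\sum_(i < n | (i < r)%N) \sum_(j < n | (i < j)%N) (U_(maxi (w i) (w j)) + 0) +
   \sum_(i < n | ~~ (i < r)%N) \sum_(j < n | (i < j)%N) U_(maxi (w i) (w j)))%MM.
  rewrite /delta (bigID (fun i : 'I_n => i < r)%N) /=; congr (_ + _)%MM.
  by apply: eq_bigr => i _; apply: eq_bigr => j _; rewrite addm0.
have -> : C * eps' w = C * ((\prod_(i < n | (i < r)%N) \prod_(j < n | (i < j)%N) (1 * 1)) * eps' w).
  rewrite [X in C * (X * _)]big1 ?mul1r // => i _; rewrite big1 // => j _; by rewrite mul1r.
apply: leadM; first by apply: lead_prod => i; apply: g_lead.
apply: leadM; last first.
  by apply: lead_prod => i _; apply: lead_prod => j; apply: lead_diff.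
apply: lead_prod => i _; apply: lead_prod => j ij; apply: leadM.
  have := lead_fgl_add hF (w i) (w j).
  by rewrite (inj_eq (@perm_inj _ w)) -val_eqE /= ltn_eqF.
exact: lead_sub_ratio.
Qed.

(** The permutations giving the largest exponents to the last variables, which makes the monomial
    least. *)
Let minimal (w : 'S_n) : bool := [forall i : 'I_n, (i < r)%N ==> (w i == rev_ord i)].
Let w0 : 'S_n := perm (@rev_ord_inj n).
Let w0E p : w0 p = rev_ord p. Proof. by rewrite permE. Qed.
Let w0V p : (w0^-1)%g (rev_ord p) = p. Proof. by rewrite -w0E permK. Qed.

Let muE (w : 'S_n) : mu w = [multinom l ((w^-1)%g p) | p < n].
Proof.
apply/mnmP => p; rewrite mnm_sumE mnmE (bigID (fun i => i == (w^-1)%g p)) /=.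
rewrite [X in (_ + X)%N]big1 ?addn0 => [|i /andP[_ ne]]; last first.
  rewrite mulmnE mnm1E; case: (w i =P p) => [E|_]; first by rewrite -E permK eqxx in ne.
  by rewrite mul0n.
have [lt|ge] := ltnP ((w^-1)%g p) r.
  rewrite (big_pred1 ((w^-1)%g p)) => [|i]; last by rewrite /= andbC; case: eqP => //= ->; rewrite lt.
  by rewrite mulmnE mnm1E permKV eqxx mul1n.
rewrite big_pred0 => [|i]; last by rewrite andbC; case: eqP => //= ->; rewrite ltnNge ge.
by apply/esym/eqP; rewrite -leqn0 leqNgt l_pos -leqNgt.
Qed.

Let l_mono (i j : 'I_n) : (i <= j)%N -> (l j <= l i)%N.
Proof.
rewrite leq_eqVlt => /orP[/eqP/val_inj->//|lt].
have [jr|rj] := ltnP j r; first exact/ltnW/l_decr.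
have : (0 < l j)%N = false by rewrite l_pos ltnNge rj.
by case: (l j).
Qed.

Let l_inj (i j : 'I_n) : (i < r)%N -> l i = l j -> i = j.
Proof.
move=> ir E; have jr : (j < r)%N by rewrite -l_pos -E l_pos.
apply: val_inj => /=; case: (ltngtP i j) => // lt.
  by have := l_decr lt jr; rewrite E ltnn.
by have := l_decr lt ir; rewrite E ltnn.
Qed.

Definition hl_mu : 'X_{1..n} := [multinom l (rev_ord p) | p < n].

Let mu_perm (w : 'S_n) : mu w = [multinom hl_mu ((w^-1 * w0)%g p) | p < n].
Proof. by rewrite muE; apply/mnmP => p; rewrite !mnmE permM w0E rev_ordK. Qed.

Let mu_min w : (hl_mu <= mu w)%O.
Proof.
rewrite mu_perm; apply: nondecreasing_le_perm => i j ij; rewrite !mnmE.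
by apply: l_mono => /=; lia.
Qed.

Let mu_eq w : mu w = hl_mu -> minimal w.
Proof.
move=> E; apply/forallP => i; apply/implyP => ir.
have := congr1 (fun m : 'X_{1..n} => m (w i)) E; rewrite muE !mnmE permK => /(l_inj ir) E'.
by apply/eqP; rewrite [in RHS]E' rev_ordK.
Qed.

Let minimal_mu w : minimal w -> mu w = hl_mu.
Proof.
move=> /forallP min; have -> : hl_mu = mu w0.
  rewrite muE; apply/mnmP => p; rewrite !mnmE; congr l.
  by rewrite -[p in RHS]rev_ordK w0V.
by apply: eq_bigr => i ir; have := min i; rewrite ir => /eqP->; rewrite w0E.
Qed.

(** For i < r all later indices than [w i] are already taken, so the missing signs are all 1. *)
Let minimal_eps w : minimal w -> eps' w = eps w.
Proof.
move=> /forallP min; rewrite /eps (bigID (fun i : 'I_n => i < r)%N) /=.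
rewrite [X in _ = X * _]big1 ?mul1r // => i ir; rewrite big1 // => j ij.
have wi : w i = rev_ord i by apply/eqP; have := min i; rewrite ir.
rewrite /sgn wi ltnNge; suff -> : (w j <= rev_ord i)%N by [].
have [jr|rj] := ltnP j r.
  by have := min j; rewrite jr => /eqP-> /=; lia.
rewrite leqNgt; apply/negP => gt.
have wj_lt : (rev_ord (w j) < i)%N by have := ltn_ord (w j); move: gt => /=; lia.
have := min (rev_ord (w j)); rewrite (ltn_trans wj_lt ir) rev_ordK /=.
rewrite (inj_eq (@perm_inj _ w)) => /eqP E.
by rewrite E in wj_lt; have := ltn_trans wj_lt ij; rewrite ltnn.
Qed.

Let card_minimal : #|[pred w | minimal w]| = (n - r)`!.
Proof.
rewrite -(card_tail_set le_rn) -card_Sym -(card_rcoset _ w0); apply: eq_card => w.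
rewrite inE mem_rcoset inE; apply/forallP/subsetP => [min i|on i].
  rewrite !inE permM; apply: contraNT; rewrite -ltnNge => ir.
  by have := min i; rewrite ir => /eqP->; rewrite w0V.
apply/implyP => ir; apply: contraLR ir => ne; rewrite -leqNgt.
have : i \in [pred k | (w * w0^-1)%g k != k].
  rewrite inE permM; apply: contraNneq ne => E.
  by rewrite -(permKV w0 (w i)) E w0E.
by move/on; rewrite inE.
Qed.

(** The (n - r)! minimal permutations contribute equally and the others only larger monomials; the
    factorial and the leading term of the Vandermonde product are then cancelled. *)
Lemma lead_hl_series : lead P hl_mu C.
Proof.
have termE (w : 'S_n) : lead ((-1) ^+ w * hl_num F r g (fun i => x (w i)))
    (hl_mu + delta 1%g)%MM (if minimal w then C * eps 1%g else 0).
  have lw := leadZsign (odd_perm w) (lead_num w); rewrite delta_const in lw.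
  have [min|nmin] := boolP (minimal w).
    by move: lw; rewrite (minimal_mu min) (minimal_eps min) [_ * (C * _)]mulrCA eps_const.
  apply: lead_lt lw _; rewrite ltmc_add2l lt_neqAle mu_min andbT.
  by apply: contra nmin => /eqP/esym; apply: mu_eq.
have sumE : lead (\sum_(w : 'S_n) (-1) ^+ w * hl_num F r g (fun i => x (w i)))
    (hl_mu + delta 1%g)%MM ((C * eps 1%g) *+ (n - r)`!).
  have -> : (C * eps 1%g) *+ (n - r)`! = \sum_(w : 'S_n) (if minimal w then C * eps 1%g else 0).
    by rewrite -big_mkcond sumr_const card_minimal.
  by apply: lead_sum => w _; apply: termE.
have h1 := lead_vdm1 1%g; rewrite odd_perm1 expr0 mul1r in h1.
apply: (lead_cancel (eps_neq0 1%g) h1).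
rewrite addmC [eps _ * C]mulrC; move: sumE; rewrite -(hl_seriesE g hF le_rn char0) => -[low top].
have cancel (a b : L) : a *+ (n - r)`! = b *+ (n - r)`! -> a = b.
  move=> /eqP; rewrite -subr_eq0 -mulrnBl -mulr_natr mulf_eq0.
  by rewrite (negPf (char0 (fact_neq0 _))) orbF subr_eq0 => /eqP.
split=> [k lt|]; apply: cancel; first by rewrite -mps_coefMn mul0rn low.
by rewrite -mps_coefMn top.
Qed.

End LeadHallLittlewood.

(** * Leading monomials of supersymmetric series *)

Section StrictLead.
Variables (L : idomainType) (F : mps 2 L) (n : nat).
Hypothesis hF : is_fgl F.
Local Notation x := (mps_var L).

Lemma mps_symmetric_coef (h : mps n L) (w : 'S_n) (m : 'X_{1..n}) : mps_symmetric h ->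
  h [multinom m (w i) | i < n] = h m.
Proof. by move=> sym; rewrite -mps_subst_perm sym. Qed.

Section Minimal.
Variables (h : mps n L) (m : 'X_{1..n}).
Hypothesis hG : supersymmetric F h.
Hypothesis h_low : forall k : 'X_{1..n}, (k < m)%O -> h k = 0.
Hypothesis h_m : h m != 0.

Lemma min_nondecreasing (i j : 'I_n) : (i < j)%N -> (m i <= m j)%N.
Proof.
move=> ij; rewrite leqNgt; apply/negP => lt; case/negP: h_m; apply/eqP.
by rewrite -(mps_symmetric_coef (tperm i j) m hG.1) h_low // swap_lt.
Qed.

Lemma perm_two (i0 i1 i j : 'I_n) : i0 != i1 -> i != j ->
  exists w : 'S_n, w i0 = i /\ w i1 = j.
Proof.
move=> i01 ij; pose c := tperm i0 i i1; exists (tperm i0 i * tperm c j)%g.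
rewrite !permM tpermL -/c tpermL; split=> //; apply: tpermD; last by rewrite eq_sym.
by rewrite /c -{2}(tpermL i0 i) (inj_eq (@perm_inj _ _)) eq_sym.
Qed.

Section Substitution.
Variables i0 i1 : 'I_n.
Hypothesis i01 : i0 != i1.
Let y (k : 'I_n) : mps n L :=
  if k == i0 then x i0 else if k == i1 then fgl_opp F (x i0) else x k.
Let merge (e : 'X_{1..n}) : 'X_{1..n} := 
  [multinom if k == i0 then (e i0 + e i1)%N else if k == i1 then 0%N else e k | k < n].

Let y1 k : ordge 1 (y k).
Proof.
rewrite /y; case: ifP => _; first exact: ordge_var.
by case: ifP => _; [apply: (ordge_fgl_opp hF); apply: ordge_var|apply: ordge_var].
Qed.

(* modulo higher degree, the formal inverse of [x_i0] is [- x_i0] *)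
Lemma cancel_monomial (e k : 'X_{1..n}) : (mdeg k <= mdeg e)%N ->
  (\prod_i y i ^+ e i) k = (-1) ^+ e i1 * (merge e == k)%:R.
Proof.
move=> le; have x0 : ordge 1 (x i0) by exact: ordge_var.
pose c : mps n L := \prod_(i | i != i1) y i ^+ e i.
have cord : ordge (\sum_(i | i != i1) e i) c.
  rewrite /c; elim/big_rec2: _ => // i u v _; apply: ordgeM; exact: ordgeX.
have yi1 : y i1 = fgl_opp F (x i0) by rewrite /y eq_sym (negPf i01) eqxx.
have mE : mdeg e = (\sum_(i | i != i1) e i + e i1)%N by rewrite mdegE (bigD1 i1) //= addnC.
have high : ordge (mdeg e).+1 (c * (fgl_opp F (x i0) ^+ e i1 - (- x i0) ^+ e i1)).
  rewrite mE -addnS; apply: ordgeM => //; apply: ordge_exprB; first exact: ordge_fgl_opp.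
    exact: ordgeN.
  by rewrite opprK; apply: fgl_opp_mod.
have -> : \prod_i y i ^+ e i = c * (fgl_opp F (x i0) ^+ e i1 - (- x i0) ^+ e i1) +
    (-1) ^+ e i1 * (c * x i0 ^+ e i1).
  rewrite (bigD1 i1) //= yi1 -/c (exprNn (x i0)).
  move: (fgl_opp F (x i0) ^+ e i1) ((-1) ^+ e i1) (x i0 ^+ e i1) (c) => A b X c'; ring.
rewrite mps_coefD high ?ltnS // add0r.
have -> : c * x i0 ^+ e i1 = monom L (merge e).
  rewrite monom_var /c (bigD1 i0) //= mulrAC -mulrA; symmetry; rewrite (bigD1 i0) //= (bigD1 i1) //=; last by rewrite eq_sym.
  rewrite !mnmE eqxx [i1 == i0]eq_sym (negPf i01) eqxx expr0 mul1r [in RHS]mulrA /y eqxx -exprD.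
  congr (_ * _); apply: eq_big => [k'|k' /andP[/negPf k0 /negPf k1]]; first by rewrite andbC.
  by rewrite mnmE k0 k1.
have signE b (f : mps n L) : ((-1) ^+ b * f) k = (-1) ^+ b * f k.
  rewrite -[(-1) ^+ b]signr_odd -[(-1) ^+ b in RHS]signr_odd.
  by case: (odd b); rewrite ?expr0 ?expr1 ?mul1r ?mulN1r.
by rewrite signE monomE.
Qed.

End Substitution.

(** Suppose the common exponent a is positive, and move [i] and [j] to the variables replaced by t
    and -_F t. The coefficient with exponent 2 a of t is then plus or minus [h m]: the other
    monomials merging into it have an exponent below a, which symmetry places at [i], so they
    precede [m]. At t = 0 this coefficient is zero. *)
Lemma min_strict (i j : 'I_n) : (i < j)%N -> m i = m j -> m i = 0%N.
Proof.
move=> ij mij; apply/eqP; apply: contraT; rewrite -lt0n => a0; set a := m i in a0.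
have n2 : (1 < n)%N by have := ltn_ord j; lia.
pose i0 := Ordinal (ltnW n2); pose i1 := Ordinal n2.
have i01 : i0 != i1 by [].
have nij : i != j by rewrite -val_eqE /= ltn_eqF.
have [w [wi0 wi1]] := perm_two i01 nij.
have [sym canc] := hG.
have := canc i0 i1 erefl erefl; set y := fun k : 'I_n => _.
have y1 k : ordge 1 (y k).
  rewrite /y; case: ifP => _; first exact: ordge_var.
by case: ifP => _; [apply: (ordge_fgl_opp hF); apply: ordge_var|apply: ordge_var].
pose m' := [multinom m (w k) | k < n].
pose M : 'X_{1..n} := [multinom if k == i0 then (m' i0 + m' i1)%N else if k == i1 then 0%N else m' k | k < n].
move/(congr1 (fun f : mps n L => f M)); rewrite /= mps_subst_zeroing ifN; last first.
  apply/forallPn; exists i0; rewrite eqxx /= !mnmE eqxx wi0 wi1; lia.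
have degm' : mdeg m' = mdeg m by rewrite mdeg_perm.
have degM : mdeg M = mdeg m.
  rewrite -degm' !mdegE [RHS](bigD1 i0) //= [in RHS](bigD1 i1) //= (bigD1 i0) //= (bigD1 i1) //=.
  have M0 : M i0 = (m' i0 + m' i1)%N by rewrite mnmE eqxx.
  have M1 : M i1 = 0%N by rewrite mnmE [i1 == i0]eq_sym (negPf i01) eqxx.
  rewrite M0 M1 add0n addnA; congr (_ + _)%N.
  by apply: eq_bigr => k /andP[/negPf k0 /negPf k1]; rewrite mnmE k0 k1.
have lt : (mdeg m' < (mdeg M).+1)%N by rewrite degm' degM.
rewrite (mps_substE y1 _ (ltnSn _)) (bigD1 (BMultinom lt)) //= [X in _ + X]big1 ?addr0.
  rewrite (cancel_monomial i01) ?degm' ?degM // eqxx mulr1 => /eqP.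
  by rewrite mulf_eq0 signr_eq0 orbF /m' mps_symmetric_coef // (negPf h_m).
move=> e ne; have [lt_e|ge_e] := ltnP (mdeg e) (mdeg m).
  by rewrite h_low ?mul0r //; apply: lt_mdeg_ltmc.
have cE := @cancel_monomial i0 i1 i01 e M; rewrite cE; last by apply: leq_trans ge_e; rewrite degM.
case: (_ =P M) => [E|_]; last by rewrite !mulr0.
rewrite (_ : h e = 0) ?mul0r //.
have e_sum : (e i0 + e i1 = a + a)%N.
  have := congr1 (fun k : 'X_{1..n} => k i0) E; rewrite !mnmE eqxx wi0 wi1 -mij //.
have e_out (k : 'I_n) : k != i0 -> k != i1 -> (e : 'X_{1..n}) k = m (w k).
  move=> /negPf k0 /negPf k1; have := congr1 (fun l : 'X_{1..n} => l k) E.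
  by rewrite !mnmE k0 k1.
have e_neq : e i0 != a.
  apply: contra ne => /eqP e0; rewrite bmeqP /=; apply/eqP/mnmP => k; rewrite mnmE.
  have [->|k0] := eqVneq k i0; first by rewrite e0 wi0.
  have [->|k1] := eqVneq k i1; first by rewrite wi1 -mij -/a; lia.
  exact: e_out.
(* The two exponents have sum 2 a and are not both a; [u] brings the smaller one to [i]. *)
pose u := if (e i0 < a)%N then w else (tperm i0 i1 * w)%g.
have [ui uj] : ((e : 'X_{1..n}) ((u^-1)%g i) < a)%N /\ (forall k, k != i -> k != j ->
    (e : 'X_{1..n}) ((u^-1)%g k) = m k).
  have wVi : (w^-1)%g i = i0 by rewrite -wi0 permK.
  have wVj : (w^-1)%g j = i1 by rewrite -wi1 permK.
  have gen k : k != i -> k != j -> (w^-1)%g k != i0 /\ (w^-1)%g k != i1.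
    by rewrite -{1}wi0 -{1}wi1 => ki kj; split; [apply: contraNneq ki => <-|apply: contraNneq kj => <-]; rewrite permKV.
  rewrite /u; have [h0|h0] := ltnP (e i0) a; split.
  - by rewrite wVi.
  - by move=> k ki kj; have [k0 k1] := gen k ki kj; rewrite e_out // permKV.
  - rewrite invMg tpermV permM wVi tpermL; lia.
  move=> k ki kj; have [k0 k1] := gen k ki kj.
  by rewrite invMg tpermV permM tpermD 1?eq_sym // e_out // permKV.
rewrite -(mps_symmetric_coef (u^-1)%g _ sym); apply: h_low; apply/ltmcP.
  by rewrite mdeg_perm; apply/eqP; rewrite eqn_leq ge_e andbT -ltnS -degM bmdeg.
exists i => [k ki|]; rewrite mnmE //; apply: uj; rewrite -val_eqE /= ltn_eqF //.
exact: ltn_trans ij.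
Qed.

End Minimal.

Definition part_mu (lam : strict_partition n) : 'X_{1..n} :=
  [multinom nth 0%N lam (rev_ord p) | p < n].

Lemma nth_filter_pos (s : seq nat) i : sorted geq s ->
  nth 0%N [seq v <- s | v != 0%N] i = nth 0%N s i.
Proof.
elim: s i => [|v s IH] i //= ps; have ss := path_sorted ps.
case: eqP => [v0|_] /=; last by case: i => //= i; exact: IH.
have allz : all (pred1 0%N) s.
  have := order_path_min (fun a b c (h1 : (b >= a)%N) (h2 : (a >= c)%N) => leq_trans h2 h1) ps.
  by apply: sub_all => z /=; rewrite v0 leqn0.
have -> : [seq v <- s | v != 0%N] = [::].
  apply/eqP; rewrite -size_eq0 size_filter -leqn0 leqNgt -has_count; apply/hasPn => z /(allP allz) /= /eqP->.
  by [].
rewrite nth_nil v0; case: i => //= i.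
have [lt|ge] := ltnP i (size s); last by rewrite nth_default.
by have /eqP-> := all_nthP 0%N allz i lt.
Qed.

Lemma part_of_mnm (m : 'X_{1..n}) :
  (forall i j : 'I_n, (i < j)%N -> (m i <= m j)%N) ->
  (forall i j : 'I_n, (i < j)%N -> m i = m j -> m i = 0%N) ->
  exists lam, part_mu lam = m.
Proof.
move=> mono strict; pose f (k : 'I_n) := m (rev_ord k).
pose s := [seq f k | k <- enum 'I_n].
have sizes : size s = n by rewrite size_map size_enum_ord.
have nths (k : 'I_n) : nth 0%N s k = f k.
  by rewrite (nth_map k) ?size_enum_ord // nth_ord_enum.
(* Strictly decreasing except for repeated zeros, which are removed to get the parts. *)
pose rr a b := (b < a)%N || ((a == 0%N) && (b == 0%N)).
have pw : pairwise rr s.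
  apply/(pairwiseP 0%N) => i j; rewrite !inE sizes => lti ltj ij.
  rewrite (nths (Ordinal lti)) (nths (Ordinal ltj)) /rr /f.
  have lt : (rev_ord (Ordinal ltj) < rev_ord (Ordinal lti))%N by rewrite /=; lia.
  have := mono _ _ lt; rewrite leq_eqVlt => /orP[/eqP E|->//].
  by have h0 := strict _ _ lt E; rewrite -E h0 eqxx orbT.
pose lam := [seq v <- s | v != 0%N].
have lamP : [&& sorted gtn lam, 0%N \notin lam & (size lam <= n)%N].
  apply/and3P; split.
  - apply: pairwise_sorted; have : pairwise rr lam by apply: pairwise_filter.
    apply: sub_in_pairwise (allss _) => a b; rewrite !mem_filter /rr => /andP[a0 _] _.
    by rewrite (negPf a0) orbF.
  - by rewrite mem_filter eqxx.
  - by rewrite size_filter -sizes count_size.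
exists (StrictPartition lamP); apply/mnmP => p; rewrite mnmE.
have -> : nth 0%N (StrictPartition lamP) (rev_ord p) = nth 0%N s (rev_ord p).
  apply: nth_filter_pos; apply: pairwise_sorted; apply: sub_pairwise pw => a b.
  by move=> /orP[/ltnW //|/andP[/eqP-> /eqP->]].
by rewrite nths /f rev_ordK.
Qed.

Lemma part_mu_inj : injective part_mu.
Proof.
move=> lam kap E; apply: val_inj => /=.
have nthE i : nth 0%N lam i = nth 0%N kap i.
  have [lt|ge] := ltnP i n; last first.
    by case: lam kap {E} => [l /and3P[_ _ sl]] [k /and3P[_ _ sk]] /=; rewrite !nth_default // (leq_trans _ ge).
  have := congr1 (fun m : 'X_{1..n} => m (rev_ord (Ordinal lt))) E.
  by rewrite !mnmE rev_ordK.
have size_le (l k : seq nat) : 0%N \notin l -> (forall i, nth 0%N l i = nth 0%N k i) -> (size l <= size k)%N.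
  move=> l0 e; rewrite leqNgt; apply/negP => lt; have := mem_nth 0%N lt.
  by rewrite e nth_default // (negPf l0).
have /and3P[_ l0 _] := valP lam; have /and3P[_ k0 _] := valP kap.
apply: (@eq_from_nth _ 0%N) => [|i _]; last exact: nthE.
by apply/eqP; rewrite eqn_leq !size_le // => i; rewrite nthE.
Qed.

End StrictLead.

(** * Divisibility of leading coefficients by powers of 2 *)

Lemma mps_subst1_coefM n (R : comNzRingType) (i : 'I_n) (f : mps 1 R) (A : mps n R) m :
  (mps_subst (fun _ => mps_var R i) f * A) m =
  \sum_(l < (m i).+1) f (U_(ord0) *+ l)%MM * A (m - U_(i) *+ l)%MM.
Proof.
pose d := (mdeg m).+1; have xi : 'I_1 -> ordge 1 (mps_var R i) by move=> _; apply: ordge_var.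
pose T : mps 1 R := \sum_(l < d) mpsC 1 (f (U_(ord0) *+ l)%MM) * mps_var R ord0 ^+ l.
have fT : ordge d (f - T).
  move=> k lt; have kE : k = (U_(ord0) *+ mdeg k)%MM.
    by apply/mnmP => j; rewrite ord1 mulmnE mnm1E eqxx mul1n mdegE big_ord1.
  rewrite mps_coefB /T mps_coef_sum (bigD1 (Ordinal lt)) //= big1 ?addr0.
    by rewrite mps_coefCM mps_varE -monomMn monomE -kE eqxx mulr1 subrr.
  move=> l ne; rewrite mps_coefCM mps_varE -monomMn monomE; case: eqP => [E|_]; last by rewrite mulr0.
  case/negP: ne; apply/eqP/val_inj => /=; rewrite -E mdegMn mdeg1 mul1n //.
have : ordge d (mps_subst (fun _ => mps_var R i) (f - T) * A).
  by apply: ordgeMr; apply: mps_subst_ordge.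
move=> /(_ m (ltnSn _)) /eqP; rewrite mps_substB // mulrBl mps_coefB subr_eq0 => /eqP->.
rewrite /T mps_subst_sum // mulr_suml mps_coef_sum.
have mi_d : ((m i).+1 <= d)%N by rewrite ltnS mdegE (bigD1 i) //= leq_addr.
rewrite [RHS](big_ord_widen d (fun l => f (U_(ord0) *+ l)%MM * A (m - U_(i) *+ l)%MM) mi_d).
rewrite [RHS]big_mkcond /=; apply: eq_bigr => l _.
rewrite mps_substM // mps_substXn // mps_substC // mps_subst_var // -mulrA mps_coefCM.
rewrite mps_varE -monomMn monom_coefM; have -> : (U_(i) *+ l <= m)%MM = (l < (m i).+1)%N.
  rewrite ltnS; apply/mnm_lepP/idP => [/(_ i)|le j]; first by rewrite mulmnE mnm1E eqxx mul1n.
  by rewrite mulmnE mnm1E; case: eqP => [<-|_]; rewrite ?mul1n ?mul0n.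
by case: ifP => // _; rewrite mulr0.
Qed.

Section TwoRegularity.
Variables (L : idomainType) (F : mps 2 L).
Hypothesis hF : is_fgl F.
Hypothesis regular : forall b c : L, F (mnm2 1 1) * b = 2%:R * c -> exists d, b = 2%:R * d.
Hypothesis two_neq0 : 2%:R != 0 :> L.

Let qc l : L := fgl_double F (U_(ord0) *+ l)%MM.

Lemma double_coef : [/\ qc 0 = 0, qc 1 = 2%:R & qc 2 = F (mnm2 1 1)].
Proof.
have t1 := @ordge_var 1 L ord0.
rewrite /qc /fgl_double (fgl_addE hF) // !mps_coefD !mps_varE -monomD !monom_coefM !monomE.
have e (a b : nat) : (U_(ord0) *+ a == U_(ord0) *+ b :> 'X_{1..1})%MM = (a == b).
  apply/eqP/eqP => [/(congr1 (fun k : 'X_{1..1} => k ord0))|->//].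
  by rewrite !mulmnE !mnm1E eqxx !mul1n.
have e1 (a : nat) : (U_(ord0) == U_(ord0) *+ a :> 'X_{1..1})%MM = (1 == a)%N.
  by rewrite -e mulm1n.
have uu : (U_(ord0) + U_(ord0) = U_(ord0) *+ 2 :> 'X_{1..1})%MM by rewrite mulmS mulm1n.
have le (a : nat) : ((U_(ord0) : 'X_{1..1}) *+ 2 <= U_(ord0) *+ a)%MM = (2 <= a)%N.
  apply/mnm_lepP/idP => [/(_ ord0)|le2 k]; rewrite !mulmnE ?mnm1E ?eqxx ?mul1n //.
  by rewrite (ord1 k) eqxx !mul1n.
rewrite !uu !le !e1 /= !addr0 !add0r; split=> //.
have -> : (U_(ord0) *+ 2 - U_(ord0) *+ 2 = 0 :> 'X_{1..1})%MM.
  by apply/mnmP => k; rewrite mnmBE subnn mnm0E.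
rewrite /fgl_add (mps_substE _ _ (d := 1)) ?mdeg0 // => [|k]; last by case: ifP => _; rewrite -mps_varE.
have lt0 : (mdeg (0%MM : 'X_{1..2}) < 1)%N by rewrite mdeg0.
rewrite (bigD1 (BMultinom lt0)) //= [X in _ + X]big1 ?addr0 => [|k ne]; last first.
  case/negP: ne; rewrite bmeqP /=; have := bmdeg k; rewrite ltnS leqn0 mdeg_eq0 //.
rewrite big1 => [|k _]; last by rewrite mnm0E expr0.
rewrite mps_coef1 eqxx mulr1; congr (F _); apply: mnm2P; rewrite !mnmDE !mnm0E !mnm1E ?mnm2_0 ?mnm2_1 //.
Qed.

(* coefficient sequences of the multiples of the series [[2](t)] *)
Definition double_dvd (a : nat -> L) : Prop :=
  exists b : nat -> L, forall t, a t = \sum_(l < t.+1) qc l * b (t - l)%N.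

Lemma double_dvdB a b : double_dvd a -> double_dvd b -> double_dvd (fun t => a t - b t).
Proof.
move=> [a' aE] [b' bE]; exists (fun t => a' t - b' t) => t.
by rewrite aE bE -sumrB; apply: eq_bigr => l _; rewrite mulrBr.
Qed.

Lemma double_dvd_sum (I : Type) (r : seq I) (P : pred I) (c : I -> L) (a : I -> nat -> L) :
  (forall i, P i -> double_dvd (a i)) ->
  double_dvd (fun t => \sum_(i <- r | P i) c i * a i t).
Proof.
move=> h; elim: r => [|i r [b bE]].
  by exists (fun=> 0) => t; rewrite big_nil big1 // => l _; rewrite mulr0.
have [Pi|nPi] := boolP (P i); last first.
  by exists b => t; rewrite big_cons (negPf nPi).
have [b' b'E] := h i Pi; exists (fun t => c i * b' t + b t) => t.
rewrite big_cons Pi bE b'E mulr_sumr -big_split /=; apply: eq_bigr => l _.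
by rewrite mulrDr mulrCA.
Qed.

(* 2 is a nonzerodivisor modulo [[2](t) = 2 t + a_11 t^2 + ...] because
   [a_11] is one modulo 2 *)
Lemma double_dvd_two a : double_dvd (fun t => 2%:R * a t) -> double_dvd a.
Proof.
move=> [b bE]; have [q0 q1 q2] := double_coef.
have b2 t : exists d, b t = 2%:R * d.
  elim/ltn_ind: t => t IH.
  pose rest := \sum_(l < t) qc l.+3 * b (t - l.+1)%N.
  have [d dE] : exists d, rest = 2%:R * d.
    rewrite /rest; elim/big_ind: _ => [|u v [c ->] [c' ->]|l _].
    - by exists 0; rewrite mulr0.
    - by exists (c + c'); rewrite mulrDr.
    have [|c ->] := IH (t - l.+1)%N; first by have := ltn_ord l; lia.
    by exists (qc l.+3 * c); rewrite mulrCA.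
  (* The coefficient of degree t + 2 reads 2 a_(t+2) = 2 b_(t+1) + a_11 b_t + [rest], with [rest]
     even by induction; so a_11 b_t is even. *)
  apply: (regular (c := a t.+2 - b t.+1 - d)).
  have := bE t.+2; rewrite big_ord_recl /= q0 mul0r add0r big_ord_recl /= q1.
  rewrite big_ord_recl /= q2 !subSS !subn0.
  rewrite (eq_bigr (fun l : 'I_t => qc l.+3 * b (t - l.+1)%N)) // -/rest dE.
  by rewrite !mulrBr => ->; ring.
exists (fun t => projT1 (cid (b2 t))) => t; apply: (mulfI two_neq0).
rewrite bE mulr_sumr; apply: eq_bigr => l _; rewrite mulrCA; congr (_ * _).
by case: cid.
Qed.

Section Coprime.
Variables (n : nat) (i j : 'I_n).
Hypothesis ij : i != j.
Local Notation x := (mps_var L).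
Let q (k : 'I_n) : mps n L := fgl_add F (x k) (x k).

Lemma double_coefM k (A : mps n L) m :
  (q k * A) m = \sum_(l < (m k).+1) qc l * A (m - U_(k) *+ l)%MM.
Proof.
have xk := @ordge_var n L k.
have -> : q k = mps_subst (fun _ => x k) (fgl_double F) by rewrite mps_subst_double.
exact: mps_subst1_coefM.
Qed.

Let slice (A : mps n L) (m : 'X_{1..n}) t := A (m + U_(j) *+ t)%MM.

(** Induction on the exponent of x_i. One degree higher in x_i, the left side is twice the wanted
    slice plus multiples of earlier slices, and the right side is a multiple of [2](x_j);
    [double_dvd_two] removes the 2. *)
Lemma double_slice (A B : mps n L) : q i * A = q j * B ->
  forall m : 'X_{1..n}, m j = 0%N -> double_dvd (slice A m).
Proof.
move=> E m; move: {2}(m i) (erefl (m i)) => N; elim/ltn_ind: N m => N IH m mi mj.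
apply: double_dvd_two; have [q0 q1 _] := double_coef; have ji : j != i by rewrite eq_sym.
pose m1 := (m + U_(i))%MM.
have m1i : m1 i = N.+1 by rewrite mnmDE mnm1E eqxx mi addn1.
have m1j : m1 j = 0%N by rewrite mnmDE mnm1E (negPf ij) mj.
have hB : double_dvd (fun t => (q j * B) (m1 + U_(j) *+ t)%MM).
  exists (fun t => slice B m1 t) => t; rewrite double_coefM mnmDE m1j mulmnE mnm1E eqxx mul1n add0n.
  apply: eq_bigr => l _; rewrite /slice; congr (_ * B _); apply/mnmP => k.
  rewrite !(mnmBE, mnmDE, mulmnE) !mnm1E; have := ltn_ord l; case: (j =P k) => [<-|_]; rewrite ?mul1n ?mul0n; lia.
pose tail t := \sum_(l < N) qc l.+2 * slice A (m1 - U_(i) *+ l.+2)%MM t.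
have htail : double_dvd tail.
  apply: double_dvd_sum => l _; apply: (IH (N - l.+1)%N); first by have := ltn_ord l; lia.
    by rewrite mnmBE m1i mulmnE mnm1E eqxx mul1n; lia.
  by rewrite mnmBE m1j.
have := double_dvdB hB htail; congr double_dvd; apply: funext => t.
rewrite -E double_coefM mnmDE m1i mulmnE mnm1E (negPf ji) mul0n addn0.
rewrite big_ord_recl /= q0 mul0r add0r big_ord_recl /= q1 /tail.
rewrite (_ : \sum_(l < N) _ = \sum_(l < N) qc l.+2 * slice A (m1 - U_(i) *+ l.+2)%MM t).
  rewrite addrK /slice; congr (_ * A _); apply/mnmP => k.
  by rewrite /m1 !(mnmBE, mnmDE, mulmnE) !mnm1E /=; move: (_ * t)%N => T; case: (i =P k) => _; lia.
apply: eq_bigr => l _; congr (_ * A _); apply/mnmP => k; have := ltn_ord l.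
rewrite !(mnmBE, mnmDE, mulmnE) !mnm1E /bump /=; case: (i =P k) => [<-|_]; rewrite ?mul1n ?mul0n; last by lia.
by rewrite (negPf ji) mi; lia.
Qed.

Lemma double_coprime (A B : mps n L) : q i * A = q j * B -> exists C, A = q j * C.
Proof.
move=> E; pose base (m : 'X_{1..n}) : 'X_{1..n} := [multinom if k == j then 0%N else m k | k < n].
have basej (m : 'X_{1..n}) : base m j = 0%N by rewrite mnmE eqxx.
have base_eq m : m = (base m + U_(j) *+ m j)%MM.
  apply/mnmP => k; rewrite mnmDE mulmnE mnm1E mnmE eq_sym.
  by case: eqP => [->|_]; rewrite ?mul1n ?mul0n ?addn0.
have ex (m : 'X_{1..n}) : exists b : nat -> L, m j = 0%N ->
    forall t, slice A m t = \sum_(l < t.+1) qc l * b (t - l)%N.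
  have [mj|ne] := eqVneq (m j) 0%N; last by exists (fun=> 0) => mj; rewrite mj in ne.
  by have [b bE] := double_slice E mj; exists b.
pose b (m : 'X_{1..n}) := projT1 (cid (ex m)).
have bE (m : 'X_{1..n}) : m j = 0%N -> forall t, slice A m t = \sum_(l < t.+1) qc l * b m (t - l)%N.
  by rewrite /b; case: cid.
pose C : mps n L := Mps (fun m => b (base m) (m j)).
exists C; apply: mpsP => m; rewrite double_coefM [in LHS](base_eq m) -/(slice A (base m) (m j)).
rewrite bE //; apply: eq_bigr => l _; congr (_ * _); rewrite /C /=.
have -> : base (m - U_(j) *+ l)%MM = base m; last by rewrite mnmBE mulmnE mnm1E eqxx mul1n.
apply/mnmP => k; rewrite !mnmE; case: eqP => // /eqP kj.
by rewrite mulmnE mnm1E eq_sym (negPf kj) mul0n subn0.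
Qed.
End Coprime.
End TwoRegularity.

Section PlusLead.
Variables (L : idomainType) (F : mps 2 L) (n : nat).
Hypothesis hF : is_fgl F.
Hypothesis regular : forall b c : L, F (mnm2 1 1) * b = 2%:R * c -> exists d, b = 2%:R * d.
Hypothesis two_neq0 : 2%:R != 0 :> L.
Local Notation x := (mps_var L).
Local Notation q k := (fgl_add F (x k) (x k)).
Implicit Types (f h : mps n L) (i j : 'I_n).

Definition zero_at i (k : 'I_n) : mps n L := if k == i then 0 else x k.

Lemma ordge_zero_at i k : ordge 1 (zero_at i k).
Proof. by rewrite /zero_at; case: ifP => _; [apply: ordge0|apply: ordge_var]. Qed.

(** The terms of [f] that contain x_i. *)
Definition var_part i f : mps n L := f - mps_subst (zero_at i) f.

Lemma var_part_coef i f m : var_part i f m = if m i == 0%N then 0 else f m.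
Proof.
rewrite /var_part mps_coefB mps_subst_zeroing; case: eqP => [mi|/eqP mi].
  by rewrite ifT ?subrr //; apply/forallP => k; apply/implyP => /eqP->; apply/eqP.
by rewrite ifN ?subr0 //; apply/forallPn; exists i; rewrite negb_imply eqxx.
Qed.

Lemma var_part_doubleM i j f : i != j -> var_part i (q j * f) = q j * var_part i f.
Proof.
move=> ij; have z1 := ordge_zero_at i; have xj := @ordge_var n L j.
rewrite /var_part mps_substM // mps_subst_fgl_add // mps_subst_var // /zero_at.
by rewrite eq_sym (negPf ij) -mulrBr.
Qed.

Lemma var_partC i j f : var_part i (var_part j f) = var_part j (var_part i f).
Proof. by apply: mpsP => m; rewrite !var_part_coef; do 2!case: eqP. Qed.

Definition vars_part (J : seq 'I_n) f : mps n L := foldr var_part f J.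

Lemma vars_part_coef J f m :
  vars_part J f m = if all (fun i => m i != 0%N) J then f m else 0.
Proof.
elim: J => // i J IH; rewrite -[vars_part (i :: J) f]/(var_part i (vars_part J f)).
by rewrite var_part_coef IH [all _ (i :: J)]/=; case: eqP.
Qed.

Lemma vars_part_doubleM J j f : j \notin J -> vars_part J (q j * f) = q j * vars_part J f.
Proof.
elim: J => //= i J IH; rewrite inE negb_or => /andP[ji jJ].
by rewrite IH // var_part_doubleM // eq_sym.
Qed.

Lemma vars_partC J i f : vars_part J (var_part i f) = var_part i (vars_part J f).
Proof. by elim: J => //= j J ->; rewrite var_partC. Qed.

(** The condition is stated for the first variable; symmetry carries it to every other one. *)
Lemma plus_var_part h i : supersymmetric_plus F h -> exists k, var_part i h = q i * k.
Proof.
move=> [[sym _] plus]; have n0 : (0 < n)%N by have := ltn_ord i; lia.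
pose i0 := Ordinal n0; have [k kE] := plus i0 erefl.
pose w : 'S_n := tperm i0 i; pose s (l : 'I_n) : mps n L := x (w l).
have s1 l : ordge 1 (s l) by apply: ordge_var.
have z1 := ordge_zero_at i; have z01 := ordge_zero_at i0.
exists (mps_subst s k); have := congr1 (mps_subst s) kE.
have x0 := @ordge_var n L i0.
rewrite mps_substM // mps_subst_fgl_add // mps_subst_var // {2 3}/s /w tpermL => <-.
rewrite mps_substB // -[in LHS](sym w) /var_part; congr (_ - _).
rewrite (mps_subst_comp _ z01 s1) (mps_subst_comp _ s1 z1); apply: eq_mps_subst => l.
rewrite mps_subst_var // /zero_at /w; case: (l =P i0) => [->|/eqP l0].
  by rewrite tpermL eqxx mps_subst0.
rewrite mps_subst_var // /s ifN // -[X in _ != X](tpermL i0 i) (inj_eq (@perm_inj _ w)) //.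
Qed.

Lemma doubles_coprime (J : seq 'I_n) i A B : i \notin J ->
  (\prod_(j <- J) q j) * A = q i * B -> exists C, A = q i * C.
Proof.
elim: J B => [|j J IH] B; first by rewrite big_nil mul1r => _ ->; exists B.
rewrite inE negb_or => /andP[ij iJ]; rewrite big_cons -mulrA => E.
have ji : j != i by rewrite eq_sym.
by have [B' B'E] := double_coprime hF regular two_neq0 ji E; apply: IH B'E.
Qed.

(** A new variable x_i makes its own [2](x_i) divide the product already extracted times a cofactor;
    coprimality moves it into the cofactor. *)
Lemma plus_vars_part h (J : seq 'I_n) : supersymmetric_plus F h -> uniq J ->
  exists g, vars_part J h = (\prod_(j <- J) q j) * g.
Proof.
move=> hp; elim: J => [|i J IH] /=; first by exists h; rewrite big_nil mul1r.
move=> /andP[iJ uJ]; have [g gE] := IH uJ; have [k kE] := plus_var_part i hp.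
have doubles (K : seq 'I_n) f : i \notin K ->
    var_part i ((\prod_(j <- K) q j) * f) = (\prod_(j <- K) q j) * var_part i f.
  elim: K f => [|j K IHK] f; first by rewrite big_nil !mul1r.
  rewrite inE negb_or => /andP[ij iK].
  by rewrite big_cons -!mulrA var_part_doubleM // IHK.
have [|C CE] := @doubles_coprime J i (var_part i g) (vars_part J k) iJ.
  by rewrite -doubles // -gE -vars_partC kE vars_part_doubleM.
by exists C; rewrite gE doubles // CE big_cons mulrCA mulrA.
Qed.

Lemma lead_dvd f p m m' e c : e != 0 -> lead f m' e ->
  lead (f * p) (m' + m)%MM c -> exists d : L, c = e * d.
Proof.
move=> e0 lf lfp; exists (p m).
have low (k : 'X_{1..n}) : (k < m)%O -> p k = 0.
  move: k; apply: ltmwf => k IH lt.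
  have lp : lead p k (p k) by split=> // l lk; apply: IH => //; apply: lt_trans lt.
  have [_] := leadM lf lp; rewrite (proj1 lfp); last by rewrite ltmc_add2r.
  by move/esym/eqP; rewrite mulf_eq0 (negPf e0) => /eqP.
by apply: lead_uniq lfp _; apply: leadM lf _.
Qed.

Lemma plus_lead_dvd h (m : 'X_{1..n}) : supersymmetric_plus F h ->
  (forall k : 'X_{1..n}, (k < m)%O -> h k = 0) ->
  exists c, h m = (\prod_(p < n | m p != 0%N) 2%:R) * c.
Proof.
move=> hp low; pose J := enum [pred p | m p != 0%N].
have [g gE] := plus_vars_part hp (enum_uniq [pred p | m p != 0%N]).
have allJ : all (fun i => m i != 0%N) J.
  by apply/allP => i; rewrite mem_enum.
have lq : lead (\prod_(j <- J) q j) (\sum_(j <- J) U_(j))%MM (\prod_(j <- J) 2%:R).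
  apply: lead_prod => j _; have := lead_fgl_add hF j j; by rewrite ltnn eqxx.
have le_m : (\sum_(j <- J) U_(j) <= m)%MM.
  apply/mnm_lepP => k; rewrite mnm_sumE (eq_bigr (fun j => (j == k) : nat)) => [|j _]; last by rewrite mnm1E.
  have -> : (\sum_(j <- J) (j == k) = count_mem k J)%N.
    by rewrite -sum1_count [RHS]big_mkcond; apply: eq_bigr => j _ /=; case: (j == k).
  rewrite (count_uniq_mem _ (enum_uniq _)) mem_enum inE; by case: (m k).
have e0 : \prod_(j <- J) 2%:R != 0 :> L.
  by rewrite prodf_seq_neq0; apply/allP => j _; apply/implyP.
have lh : lead (vars_part J h) m (h m).
  by split=> [k lt|]; rewrite vars_part_coef; [rewrite low ?if_same|rewrite allJ].
have mE : m = (\sum_(j <- J) U_(j) + (m - \sum_(j <- J) U_(j)))%MM by rewrite addmC submK.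
have lh' : lead (\prod_(j <- J) q j * g) (\sum_(j <- J) U_(j) + (m - \sum_(j <- J) U_(j)))%MM (h m).
  by rewrite -mE -gE.
by have [c cE] := lead_dvd e0 lq lh'; exists c; rewrite cE /J big_enum.
Qed.

End PlusLead.

(** * The two formal bases *)

Section Basis.
Variables (L : idomainType) (F : mps 2 L) (n : nat).
Hypothesis hL : is_lazard F.
Let hF : is_fgl F := proj1 hL.
Let char0 (k : nat) : k != 0%N -> k%:R != 0 :> L := @lazard_natr_neq0 L F k hL.
Local Notation x := (mps_var L).
Implicit Type lam : strict_partition n.

Let le_part lam : (size lam <= n)%N.
Proof. by case/and3P: (valP lam). Qed.

Let part_pos lam (i : nat) : (0 < nth 0%N lam i)%N = (i < size lam)%N.
Proof.
case/and3P: (valP lam) => _ lam0 _; apply/idP/idP => [|lt]; last first.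
  by rewrite lt0n; apply: contraNneq lam0 => E; have := mem_nth 0%N lt; rewrite E.
by apply: contraLR; rewrite -!leqNgt => ge; rewrite nth_default.
Qed.

Let part_decr lam (i j : nat) : (i < j)%N -> (j < size lam)%N -> (nth 0%N lam j < nth 0%N lam i)%N.
Proof.
case/and3P: (valP lam) => srt _ _ ij js.
have tr : transitive gtn by move=> a b c h1 h2; apply: ltn_trans h2 h1.
by apply: (sorted_ltn_nth tr 0%N srt); rewrite ?inE // (ltn_trans ij).
Qed.

Definition P_factor lam (i : 'I_n) : mps 1 L := mps_var L ord0 ^+ nth 0%N lam i.
(** The predecessor matters only for i < size lam, where the part is positive. *)
Definition Q_factor lam (i : 'I_n) : mps 1 L :=
  fgl_double F * mps_var L ord0 ^+ (nth 0%N lam i).-1.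

Let P_series lam : mps n L := hl_series (P_factor lam) hF (le_part lam) char0.
Let Q_series lam : mps n L := hl_series (Q_factor lam) hF (le_part lam) char0.

Lemma P_series_frac lam : tofrac (P_series lam) = HL_P F lam.
Proof.
rewrite /P_series hl_series_frac /HL_P; congr (_ * _); apply: eq_bigr => w _.
rewrite /hl_term; congr (tofrac _ * _); apply: eq_bigr => i _.
have xi := @ordge_var n L (w i).
by rewrite mps_substXn // mps_subst_var.
Qed.

Lemma Q_series_frac lam : tofrac (Q_series lam) = HL_Q F lam.
Proof.
rewrite /Q_series hl_series_frac /HL_Q; congr (_ * _); apply: eq_bigr => w _.
rewrite /hl_term; congr (tofrac _ * _); apply: eq_bigr => i _.
have xi := @ordge_var n L (w i).
by rewrite mps_substM // mps_substXn // mps_subst_var // mps_subst_double.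
Qed.

Lemma lead_P_series lam : lead (P_series lam) (part_mu lam) 1.
Proof.
have -> : 1 = \prod_(i < n | (i < size lam)%N) (1 : L) by rewrite big1.
apply: (lead_hl_series hF (le_part lam) char0 (l := fun i => nth 0%N lam i)) => [i a _|i|i j].
- have xa := @ordge_var n L a; rewrite mps_substXn // mps_subst_var //.
  by rewrite -(expr1n _ (nth 0%N lam i)); apply: leadX; apply: lead_var.
- exact: part_pos.
- exact: part_decr.
Qed.

Lemma lead_Q_series lam :
  lead (Q_series lam) (part_mu lam) (\prod_(i < n | (i < size lam)%N) 2%:R).
Proof.
apply: (lead_hl_series hF (le_part lam) char0 (l := fun i => nth 0%N lam i)) => [i a ir|i|i j].
- have xa := @ordge_var n L a; rewrite mps_substM // mps_substXn // mps_subst_var // mps_subst_double //.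
  rewrite -(prednK (_ : 0 < nth 0 lam i)%N) ?part_pos // mulmS /=.
  have -> : 2%:R = 2%:R * 1 ^+ (nth 0%N lam i).-1 :> L by rewrite expr1n mulr1.
  apply: leadM.
    by have := lead_fgl_add hF a a; rewrite ltnn eqxx.
  by apply: leadX; apply: lead_var.
- exact: part_pos.
- exact: part_decr.
Qed.

Lemma supersymmetricB (f g : mps n L) c : supersymmetric F f -> supersymmetric F g ->
  supersymmetric F (f - c *: g).
Proof.
move=> [fs fc] [gs gc]; split=> [w|i0 i1 h0 h1].
  have s1 i : ordge 1 (x ((w : 'S_n) i)) by apply: ordge_var.
  by rewrite mps_substB // mps_substZ // fs gs.
have h2 (k : 'I_n) : ordge 1 (if (k == i0) || (k == i1) then 0 else x k).
  by case: ifP => _; [apply: ordge0|apply: ordge_var].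
rewrite mps_substB ?mps_substZ ?fc ?gc // ?mps_substB ?mps_substZ // => k;
  case: ifP => _; try exact: ordge_var; case: ifP => _; try exact: ordge_var;
  by apply: (ordge_fgl_opp hF); apply: ordge_var.
Qed.

Lemma supersymmetric_plusB (f g : mps n L) c :
  supersymmetric_plus F f -> supersymmetric_plus F g -> supersymmetric_plus F (f - c *: g).
Proof.
move=> [fs fp] [gs gp]; split=> [|i0 h0]; first exact: supersymmetricB.
have [f' f'E] := fp i0 h0; have [g' g'E] := gp i0 h0; exists (f' - c *: g').
have z1 := @ordge_zero_at L n i0; rewrite /zero_at in z1.
rewrite mps_substB // mps_substZ // mulrBr -f'E.
have -> : fgl_add F (x i0) (x i0) * (c *: g') = c *: (fgl_add F (x i0) (x i0) * g').
  by rewrite -!mpsCM mulrCA.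
rewrite -g'E scalerBr; move: (mps_subst _ f) (mps_subst _ g) => u v; ring.
Qed.

Lemma supersymmetric_lead (h : mps n L) (m : 'X_{1..n}) : supersymmetric F h ->
  (forall k : 'X_{1..n}, (k < m)%O -> h k = 0) -> h m != 0 ->
  exists lam, part_mu lam = m.
Proof.
move=> hs low hm; apply: part_of_mnm => i j ij.
  exact: (min_nondecreasing hs low hm ij).
exact: (min_strict hF hs low hm ij).
Qed.

Lemma P_basis : is_formal_basis (@supersymmetric L F n) (@HL_P L F n).
Proof.
apply: (triangular_formal_basis (b := P_series) (mu := @part_mu n) (d := fun _ => 1)).
- exact: P_series_frac.
- by move=> lam; apply: hl_series_supersymmetric.
- exact: supersymmetricB.
- exact: part_mu_inj.
- by move=> lam; apply: oner_neq0.
- by move=> lam m lt; case: (lead_P_series lam) => low _; apply: low.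
- by move=> lam; case: (lead_P_series lam).
move=> h m hs low hm; have [lam lamE] := supersymmetric_lead hs low hm.
by exists lam => //; exists (h m); rewrite mulr1.
Qed.

Lemma Q_basis : is_formal_basis (@supersymmetric_plus L F n) (@HL_Q L F n).
Proof.
have two0 : 2%:R != 0 :> L by apply: char0.
apply: (triangular_formal_basis (b := Q_series) (mu := @part_mu n)
  (d := fun lam => \prod_(i < n | (i < size lam)%N) 2%:R)).
- exact: Q_series_frac.
- move=> lam; split; first exact: hl_series_supersymmetric.
  move=> i0 _; apply: hl_series_plus => i.
  by exists (mps_var L ord0 ^+ (nth 0%N lam i).-1).
- exact: supersymmetric_plusB.
- exact: part_mu_inj.
- by move=> lam; apply/prodf_neq0 => i _.
- by move=> lam m lt; case: (lead_Q_series lam) => low _; apply: low.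
- by move=> lam; case: (lead_Q_series lam).
move=> h m hp low hm; have [lam lamE] := supersymmetric_lead hp.1 low hm.
exists lam => //; have [c cE] := plus_lead_dvd hF (lazard_two_regular hL) two0 hp low.
exists c; rewrite cE mulrC; congr (_ * _).
rewrite (reindex_inj rev_ord_inj) /=; apply: eq_bigl => p.
by rewrite -lamE mnmE rev_ordK -lt0n part_pos.
Qed.
End Basis.

Theorem theorem4p20 (L : idomainType) (F : mps 2 L) (n : nat) :
  is_lazard F -> (1 <= n)%N ->
  is_formal_basis (@supersymmetric L F n) (@HL_P L F n) /\
  is_formal_basis (@supersymmetric_plus L F n) (@HL_Q L F n).
Proof. by move=> hL _; split; [apply: P_basis|apply: Q_basis]. Qed.
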